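(* Let $\rho_1>0$, $\rho_2>1$, $s>0$ and $t>\rho_1+\rho_2$, and suppose that $\sigma:=\rho_1+\rho_2-1<s$. Let $\psi\in(\mathcal{S}^{\rho_1}_{\rho_2})_0(\mathbb{R}^n)$ be a non-degenerate wavelet, let $\phi\in(\mathcal{S}^{\rho_1}_{\rho_2})_0(\mathbb{R}^n)$ be a reconstruction wavelet for it, and let $f\in((\mathcal{S}^s_t)_0(\mathbb{R}^n))'$. Then $$\langle f,\varphi\rangle=\frac{1}{c_{\psi,\phi}}\int_0^\infty\int_{\mathbb{R}^n}\mathcal{W}_\psi f(b,a)\,\mathcal{W}_{\overline\phi}\varphi(b,a)\,\frac{db\,da}{a},\qquad\forall\varphi\in(\mathcal{S}^{s-\sigma}_{t-\sigma})_0(\mathbb{R}^n).$$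
   Context: Notation: $\mathbb{N}=\{0,1,2,\dots\}$, $\mathbb{H}^{n+1}=\mathbb{R}^n\times(0,\infty)$ with points $(b,a)$, $\mathbb{S}^{n-1}$ is the unit sphere of $\mathbb{R}^n$, $\hat\varphi(\xi)=\int_{\mathbb{R}^n}\varphi(x)e^{-ix\cdot\xi}dx$; for $\beta\in\mathbb{N}^n$, $|\beta|=\beta_1+\dots+\beta_n$, $\beta!=\beta_1!\cdots\beta_n!$; $\beta!^{s}$ means $(\beta!)^s$. Primes denote (continuous) dual spaces, and $\langle\cdot,\cdot\rangle$ is the bilinear dual pairing. Gelfand-Shilov spaces: for $\rho_1,\rho_2>0$, $\mathcal{S}^{\rho_1}_{\rho_2}(\mathbb{R}^n)$ consists of all $\varphi$ in the Schwartz space $\mathcal{S}(\mathbb{R}^n)$ such that for some $h>0$ $$p_h^{\rho_1,\rho_2}(\varphi)=\sup_{x\in\mathbb{R}^n,\ \alpha,\beta\in\mathbb{N}^n}\frac{h^{|\alpha+\beta|}}{\alpha!^{\rho_2}\beta!^{\rho_1}}|x^\alpha\varphi^{(\beta)}(x)|<\infty,$$ with the inductive limit topology (in $h>0$). Its closed subspace, with the relative topology, $(\mathcal{S}^{\rho_1}_{\rho_2})_0(\mathbb{R}^n)$ consists of those $\varphi\in\mathcal{S}^{\rho_1}_{\rho_2}(\mathbb{R}^n)$ with $\int_{\mathbb{R}^n}x^m\varphi(x)\,dx=0$ for all $m\in\mathbb{N}^n$. Similarly $\mathcal{S}_0(\mathbb{R}^n)$ is the subspace of $\mathcal{S}(\mathbb{R}^n)$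 of functions all of whose moments vanish. Non-degenerate and reconstruction wavelets: $\varphi\in\mathcal{S}(\mathbb{R}^n)$ is non-degenerate if for every $\omega\in\mathbb{S}^{n-1}$ the function $r\mapsto\hat\varphi(r\omega)$, $r\in[0,\infty)$, is not identically zero; it is a non-degenerate wavelet if in addition $\int\varphi\,dx=0$. A function $\phi\in\mathcal{S}_0(\mathbb{R}^n)$ is a reconstruction wavelet for $\psi\in\mathcal{S}_0(\mathbb{R}^n)$ if $$c_{\psi,\phi}(\omega)=\int_0^\infty\overline{\hat\psi}(r\omega)\hat\phi(r\omega)\frac{dr}{r},\qquad\omega\in\mathbb{S}^{n-1},$$ is finite, non-zero and independent of $\omega$; then $c_{\psi,\phi}:=c_{\psi,\phi}(\omega)$. Wavelet transform: for $f$ a function or an ultradistribution for which the pairing makes sense, $$\mathcal{W}_\psi f(b,a)=\left\langle f(x),\frac{1}{a^n}\overline\psi\left(\frac{x-b}{a}\right)\right\rangle,\qquad(b,a)\in\mathbb{H}^{n+1},$$ which for functions equals $\frac{1}{a^n}\int_{\mathbb{R}^n}f(x)\overline\psi\left(\frac{x-b}{a}\right)dx$. *)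

(* Defs.v *)
From HB Require Import structures.
From mathcomp Require Import all_boot all_order all_algebra.
From mathcomp Require Import all_classical all_reals all_analysis.
From mathcomp Require Import complex.

Set Implicit Arguments.
Unset Strict Implicit.
Unset Printing Implicit Defensive.

Import Order.TTheory GRing.Theory Num.Theory.
Import numFieldNormedType.Exports.
Import ComplexField.Normc.

Local Open Scope classical_set_scope.
Local Open Scope ring_scope.
Local Open Scope complex_scope.


(* R^n is 'rV[R]_n.  Its sigma-algebra is the one generated by the coordinates,
   the construction the library uses for n.-tuple T. *)
Definition measure_rV_display : measure_display -> measure_display.
Proof. exact. Qed.

Section measurable_rV.
Context {d} {T : sigmaRingType d} (n : nat).

Let coord : 'I_n -> 'rV[T]_n -> T := fun i x => x ord0 i.

Let rV_set0 : g_sigma_preimage coord set0.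
Proof. exact: sigma_algebra0. Qed.

Let rV_setC A : g_sigma_preimage coord A -> g_sigma_preimage coord (~` A).
Proof. exact: sigma_algebraC. Qed.

Let rV_bigcup (F : _^nat) : (forall i, g_sigma_preimage coord (F i)) ->
  g_sigma_preimage coord (\bigcup_i (F i)).
Proof. exact: sigma_algebra_bigcup. Qed.

HB.instance Definition _ := @isMeasurable.Build (measure_rV_display d)
  'rV[T]_n (g_sigma_preimage coord) rV_set0 rV_setC rV_bigcup.

End measurable_rV.

Lemma measurable_coord d (T : sigmaRingType d) n (i : 'I_n) :
  measurable_fun [set: 'rV[T]_n] (fun x : 'rV[T]_n => x ord0 i).
Proof.
move=> _ Y mY; rewrite setTI; apply: sub_sigma_algebra => /=.
rewrite -bigcup_seq/=; exists i => /=; first by rewrite mem_index_enum.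
by exists Y => //; rewrite setTI.
Qed.

Lemma measurable_fun_rV d1 d2 (T1 : measurableType d1) (T2 : measurableType d2)
    n (f : T1 -> 'rV[T2]_n) :
  (forall i, measurable_fun [set: T1] (fun x => f x ord0 i)) ->
  measurable_fun [set: T1] f.
Proof.
move=> mf _ A mA; rewrite setTI.
have : g_sigma_preimage (fun i : 'I_n => (fun y : 'rV[T2]_n => y ord0 i) \o f)
    `<=` measurable.
  apply: smallest_sub; first exact: sigma_algebra_measurable.
  case: n => [|n] in f mf A mA *; first by rewrite big_ord0.
  rewrite -bigcup_mkord_ord; apply: bigcup_sub => i Ii.
  by move=> B [C mC <-]; exact: mf.
apply; rewrite (g_sigma_preimage_comp (fun i (y : 'rV[T2]_n) => y ord0 i) f).
by exists A => //; rewrite setTI.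
Qed.

Section lebesgue_rV.
Context {R : realType}.

Definition consr n (p : R * 'rV[R]_n) : 'rV[R]_n.+1 := row_mx p.1%:M p.2.

Definition splitr n (x : 'rV[R]_n.+1) : R * 'rV[R]_n :=
  (x ord0 ord0, \row_j x ord0 (lift ord0 j)).

Lemma consr0 n p : @consr n p ord0 ord0 = p.1.
Proof.
have -> : ord0 = lshift n (ord0 : 'I_1) by exact: val_inj.
by rewrite (@row_mxEl _ 1 1 n) mxE.
Qed.

Lemma consrS n p j : @consr n p ord0 (lift ord0 j) = p.2 ord0 j.
Proof.
have -> : lift ord0 j = rshift 1 j by exact: val_inj.
by rewrite (@row_mxEr _ 1 1 n).
Qed.

Lemma measurable_consr n : measurable_fun setT (@consr n).
Proof.
apply: measurable_fun_rV => i; case: (unliftP ord0 i) => [j ->|->].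
- under eq_fun do rewrite consrS.
  apply: (measurableT_comp (measurable_coord j)); exact: measurable_snd.
- by under eq_fun do rewrite consr0; exact: measurable_fst.
Qed.

Lemma measurable_splitr n : measurable_fun setT (@splitr n).
Proof.
apply/measurable_fun_pair; first exact: measurable_coord.
apply: measurable_fun_rV => i; under eq_fun do rewrite mxE.
exact: measurable_coord.
Qed.

Lemma consrK n : cancel (@consr n) (@splitr n).
Proof.
move=> [a x]; rewrite /splitr consr0; congr (_, _).
by apply/rowP => j; rewrite mxE consrS.
Qed.

Section step.
Variables (n : nat) (mu : {sigma_finite_measure set 'rV[R]_n -> \bar R}).

Definition lebesgue_consr :=
  pushforward (@lebesgue_measure R \x mu)%E (@consr n).

Let lc0 : lebesgue_consr set0 = 0%E.
Proof. by rewrite /lebesgue_consr /pushforward preimage_set0 measure0. Qed.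

Let lc_ge0 A : (0 <= lebesgue_consr A)%E.
Proof. exact: integral_ge0. Qed.

Let lc_sadd : semi_sigma_additive lebesgue_consr.
Proof.
move=> F mF tF mUF; rewrite /lebesgue_consr /pushforward preimage_bigcup.
apply: (@measure_semi_sigma_additive _ _ _ (@lebesgue_measure R \x mu)%E).
- by move=> k; rewrite -[X in measurable X]setTI; exact: measurable_consr.
- apply/trivIsetP => /= i j _ _ ij; rewrite -preimage_setI.
  by move/trivIsetP : tF => /(_ _ _ _ _ ij) ->//; rewrite preimage_set0.
- by rewrite -preimage_bigcup -[X in measurable X]setTI; exact: measurable_consr.
Qed.

HB.instance Definition _ := isMeasure.Build _ _ _ lebesgue_consr
  lc0 lc_ge0 lc_sadd.

Let lc_sigma_finite : sigma_finite setT lebesgue_consr.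
Proof.
have /sigma_finiteP[F [TF ndF Foo]] := sigma_finiteT (@lebesgue_measure R).
have /sigma_finiteP[G [TG ndG Goo]] := sigma_finiteT mu.
exists (fun k => @splitr n @^-1` (F k `*` G k)).
  rewrite -preimage_bigcup [X in _ @^-1` X](_ : _ = setT) ?preimage_setT//.
  rewrite -subTset => -[x y] _.
  have [k _ Fkx] : (\bigcup_k F k) x by rewrite -TF.
  have [l _ Gly] : (\bigcup_k G k) y by rewrite -TG.
  exists (maxn k l) => //; split => /=.
  - by have /subsetPset := ndF _ _ (leq_maxl k l); exact.
  - by have /subsetPset := ndG _ _ (leq_maxr k l); exact.
move=> k; have [mF Fk] := Foo k; have [mG Gk] := Goo k.
have mFG : measurable (F k `*` G k) by exact: measurableX.
split; first by rewrite -[X in measurable X]setTI; exact: measurable_splitr.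
rewrite /lebesgue_consr /pushforward -comp_preimage.
rewrite (_ : @splitr n \o @consr n = id); last first.
  by apply/funext => p; exact: consrK.
by rewrite preimage_id product_measure1E// lte_mul_pinfty// ge0_fin_numE.
Qed.

HB.instance Definition _ := Measure_isSigmaFinite.Build _ _ _ lebesgue_consr
  lc_sigma_finite.

End step.

(* Lebesgue measure on R^n: n-fold product of the Lebesgue measure of R,
   transported along R * R^n = R^(n+1); see lebesgue_rV_box. *)
Fixpoint lebesgue_rV n : {sigma_finite_measure set 'rV[R]_n -> \bar R} :=
  if n is n'.+1 then lebesgue_consr (lebesgue_rV n')
  else \d_(0 : 'rV[R]_0).

Lemma lebesgue_rV_box n (A : 'I_n -> set R) : (forall i, measurable (A i)) ->
  lebesgue_rV n [set x | forall i, A i (x ord0 i)] =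
  (\prod_(i < n) lebesgue_measure (A i))%E.
Proof.
elim: n A => [|n IHn] A mA.
  rewrite big_ord0 /= diracE (_ : (_ \in _) = true)//.
  by apply/mem_set => -[].
rewrite big_ord_recl -IHn//=.
pose B : set 'rV[R]_n := [set x | forall i, A (lift ord0 i) (x ord0 i)].
rewrite -/B.
have mB : measurable B.
  rewrite (_ : B = \bigcap_(i in [set: 'I_n])
      ((fun x : 'rV[R]_n => x ord0 i) @^-1` A (lift ord0 i))); last first.
    by apply/seteqP; split => x /= h i; [move=> _; exact: h|exact: (h i I)].
  apply: fin_bigcap_measurable => // i _.
  by rewrite -[X in measurable X]setTI; exact: measurable_coord.
rewrite /lebesgue_consr /pushforward.
rewrite -(product_measure1E lebesgue_measure (lebesgue_rV n) (mA ord0) mB).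
congr (product_measure1 _ _ _); apply/seteqP; split => -[a x] /=.
  move=> h; split=> [|i]; first by have := h ord0; rewrite consr0.
  by have := h (lift ord0 i); rewrite consrS.
move=> [h0 h] i; case: (unliftP ord0 i) => [j ->|->].
  by rewrite consrS; exact: h.
by rewrite consr0.
Qed.

End lebesgue_rV.

Section integralC.
Context {d} {T : measurableType d} {R : realType}.
Variable mu : {measure set T -> \bar R}.
Implicit Types (D : set T) (F : T -> R[i]).

Definition integrableC D F : Prop :=
  mu.-integrable D (fun x => (complex.Re (F x))%:E) /\
  mu.-integrable D (fun x => (complex.Im (F x))%:E).

(* Meaningful when integrableC D F holds; as Rintegral, it is total. *)
Definition integralC D F : R[i] :=
  (\int[mu]_(x in D) complex.Re (F x)) +i* (\int[mu]_(x in D) complex.Im (F x)).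

End integralC.

Section test_spaces.
Context {R : realType} {n : nat}.
Local Notation V := 'rV[R]_n.
Local Notation midx := {ffun 'I_n -> nat}.
Implicit Types (phi psi chi : V -> R[i]) (alpha beta m : midx).

Definition mdeg alpha : nat := (\sum_i alpha i)%N.
Definition mfact alpha : nat := (\prod_i (alpha i)`!)%N.
Definition monom (x : V) alpha : R := \prod_i x ord0 i ^+ alpha i.

(* Partial derivatives of complex-valued functions are taken on the real and
   imaginary parts, R[i] being no normed R-module in the library. *)
Definition pderivable (i : 'I_n) phi : Prop := forall x : V,
  derivable (fun y => complex.Re (phi y)) x (delta_mx ord0 i) /\
  derivable (fun y => complex.Im (phi y)) x (delta_mx ord0 i).

Definition pderive (i : 'I_n) phi : V -> R[i] := fun x =>
  ('D_(delta_mx ord0 i) (fun y => complex.Re (phi y)) x) +i*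
  ('D_(delta_mx ord0 i) (fun y => complex.Im (phi y)) x).

(* C^oo: the iterated partial derivatives along every list of directions exist
   and are continuous. *)
Definition smooth phi : Prop := forall l : seq 'I_n,
  let g := foldr pderive phi l in
  [/\ continuous (fun x : V => complex.Re (g x)),
      continuous (fun x : V => complex.Im (g x)) &
      forall i, pderivable i g].

Definition mderive beta phi : V -> R[i] :=
  foldr (fun i => iter (beta i) (pderive i)) phi (enum 'I_n).

Definition schwartz phi : Prop := smooth phi /\
  forall alpha beta, exists M : R, forall x : V,
    normc ((monom x alpha)%:C * mderive beta phi x) <= M.

Definition moments_vanish phi : Prop := forall m,
  integralC (lebesgue_rV n) setT (fun x => (monom x m)%:C * phi x) = 0.

Definition schwartz0 phi : Prop := schwartz phi /\ moments_vanish phi.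

Definition gs_norm (rho1 rho2 h : R) phi : \bar R :=
  ereal_sup [set e : \bar R | exists (x : V) (alpha beta : midx),
    e = (h ^+ (mdeg alpha + mdeg beta) /
         ((mfact alpha)%:R `^ rho2 * (mfact beta)%:R `^ rho1) *
         normc ((monom x alpha)%:C * mderive beta phi x))%:E].

Definition gelfand_shilov (rho1 rho2 : R) phi : Prop := schwartz phi /\
  exists2 h : R, 0 < h & (gs_norm rho1 rho2 h phi < +oo)%E.

Definition gelfand_shilov0 (rho1 rho2 : R) phi : Prop :=
  gelfand_shilov rho1 rho2 phi /\ moments_vanish phi.

(* The basic neighbourhoods of 0 of the (locally convex) inductive limit of the
   normed spaces {phi in S | gs_norm rho1 rho2 h phi < +oo}, h > 0: the
   absolutely convex sets whose trace on each step is a neighbourhood of 0. *)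
Definition gs_nbhs0 (rho1 rho2 : R) (U : set (V -> R[i])) : Prop :=
  (forall phi chi (l k : R[i]), U phi -> U chi -> normc l + normc k <= 1 ->
     U (fun x => l * phi x + k * chi x)) /\
  (forall h : R, 0 < h -> exists2 e : R, 0 < e &
     forall phi, schwartz phi -> (gs_norm rho1 rho2 h phi < e%:E)%E -> U phi).

Definition gs_nbhs (rho1 rho2 : R) phi : set_system (V -> R[i]) :=
  [set A | exists2 U, gs_nbhs0 rho1 rho2 U &
    forall chi, gelfand_shilov rho1 rho2 chi -> U (chi \- phi) -> A chi].

(* Functionals are total; only their values on the subspace matter. *)
Definition gs0_dual (rho1 rho2 : R) (f : (V -> R[i]) -> R[i]) : Prop :=
  (forall phi chi (l : R[i]),
     gelfand_shilov0 rho1 rho2 phi -> gelfand_shilov0 rho1 rho2 chi ->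
     f (fun x => l * phi x + chi x) = l * f phi + f chi) /\
  (forall phi, gelfand_shilov0 rho1 rho2 phi -> forall e : R, 0 < e ->
     \forall chi \near
       within (gelfand_shilov0 rho1 rho2) (gs_nbhs rho1 rho2 phi),
       normc (f chi - f phi) < e).

End test_spaces.

Section wavelets.
Context {R : realType} {n : nat}.
Local Notation V := 'rV[R]_n.
Implicit Types (phi psi : V -> R[i]).

Definition dot (x y : V) : R := \sum_i x ord0 i * y ord0 i.

(* The Euclidean sphere; the library norm on 'rV[R]_n is the sup norm. *)
Definition sphere : set V := [set w | dot w w = 1].

Definition fourier phi (xi : V) : R[i] :=
  integralC (lebesgue_rV n) setT
    (fun x => phi x * (cos (dot x xi) -i* sin (dot x xi))).

Definition nondegenerate phi : Prop := schwartz phi /\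
  forall w, sphere w -> exists2 r : R, 0 <= r & fourier phi (r *: w) != 0.

Definition nondegenerate_wavelet phi : Prop :=
  nondegenerate phi /\ integralC (lebesgue_rV n) setT phi = 0.

Definition admissibility_integrand psi phi (w : V) (r : R) : R[i] :=
  (fourier psi (r *: w))^* * fourier phi (r *: w) / r%:C.

(* phi is a reconstruction wavelet for psi and c is the constant c_{psi,phi}. *)
Definition reconstruction_wavelet psi phi (c : R[i]) : Prop :=
  [/\ schwartz0 psi, schwartz0 phi, c != 0 &
      forall w, sphere w ->
        integrableC lebesgue_measure `]0, +oo[ (admissibility_integrand psi phi w)
        /\ integralC lebesgue_measure `]0, +oo[ (admissibility_integrand psi phi w)
           = c].

Definition wavelet_atom psi (b : V) (a : R) : V -> R[i] :=
  fun x => ((a ^+ n)^-1)%:C * (psi (a^-1 *: (x - b)))^*.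

Definition wavelet_transform psi (f : (V -> R[i]) -> R[i]) (b : V) (a : R) :
  R[i] := f (wavelet_atom psi b a).

(* The functional given by a function. *)
Definition pairing (g : V -> R[i]) : (V -> R[i]) -> R[i] :=
  fun chi => integralC (lebesgue_rV n) setT (fun x => g x * chi x).

End wavelets.

(* Main.v *)
Require Import Defs.
From HB Require Import structures.
From mathcomp Require Import all_boot all_order all_algebra.
From mathcomp Require Import all_classical all_reals all_analysis.
From mathcomp Require Import measurable_realfun complex.
From mathcomp Require Import ring lra.

Set Implicit Arguments.
Unset Strict Implicit.
Unset Printing Implicit Defensive.

Import Order.TTheory GRing.Theory Num.Theory.
Import numFieldNormedType.Exports.
Import ComplexField.Normc.

Local Open Scope classical_set_scope.
Local Open Scope ring_scope.
Local Open Scope complex_scope.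

(** Formally the theorem is one line. The test function c * g is the integral of

      F (a, b) = a^-1 * W g (b, a) * psi_(b, a),

    where W g is the wavelet transform of g with respect to the conjugate of phi
    and psi_(b, a) is the wavelet atom of psi; applying f under the integral sign
    gives the formula. The proof has to show that this integral converges in the
    topology of the test space on which f lives, and that its value is c * g.

    Convergence rests on a decay estimate for W g (b, a) with Gelfand-Shilov
    constants. Both g and phi have vanishing moments, so in the integral of
    phi (u) g (a u + b) the Taylor polynomial of g at b can be subtracted
    (moment_estimate). With the remainder of order N this gains a ^ N and 1 / N!,
    at the price of N derivatives of g and N moments of phi. That is decay as
    a -> 0 with constants N! ^ (s - rho1) (coef_small_scale). Exchanging the roles
    of g and phi gives decay as a -> oo with constants N! ^ (t - rho2)
    (coef_large_scale). The loss sigma in the exponents of g is what makes the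
    derivatives and the moments of the atoms fit: the value F (a, b) satisfies the
    estimates of the space with exponents s and t, with one radius and with a
    constant that is integrable in (a, b) (field_bound).

    The value of the integral is computed with Fourier transforms
    (admissible_scales). The transform in b of the coefficients at scale a is a
    product, and after the substitution r = a |xi| the integral over the scales is
    the admissibility constant in the direction of - xi. Two integrable continuous
    functions with the same transform coincide, by averaging against Fejer kernels
    (fourier_unique). Derivatives pass under the integral sign by Taylor bounds of
    order two (synthesis_pderives).

    For the last step (dual_integral) the slabs 1 / m <= a <= m, |b| <= m exhaust
    the half-space, and on each of them F is uniformly continuous for the norm of
    one step of the inductive limit (family_ucont). Hence c * g is approximated in
    that norm by finite sums of values of F. On such a step f is bounded
    (gs0_dual_bound), so f (c * g) is the integral of f (F (a, b)).

    Throughout, the estimates are written with the sup norm and total degrees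
    (gs_bound), and only with derivatives taken in the order of the coordinates,
    because these are the ones that the norms of the space control. *)

(** * Complex-valued integration *)

Section complex_modulus.
Context {R : realType}.
Implicit Types z w : R[i].

Lemma normc_ge0 z : 0 <= normc z.
Proof. by case: z => a b; exact: sqrtr_ge0. Qed.

Lemma normc_real (x : R) : normc x%:C = `|x|.
Proof. by rewrite /= expr0n addr0 sqrtr_sqr. Qed.

Lemma normc_conj z : normc z^* = normc z.
Proof. by case: z => a b /=; rewrite sqrrN. Qed.

Lemma Re_le_normc z : `|complex.Re z| <= normc z.
Proof.
by case: z => a b /=; rewrite -sqrtr_sqr ler_wsqrtr// lerDl sqr_ge0.
Qed.

Lemma Im_le_normc z : `|complex.Im z| <= normc z.
Proof.
by case: z => a b /=; rewrite -sqrtr_sqr ler_wsqrtr// lerDr sqr_ge0.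
Qed.

Lemma normc_le_ReIm z : normc z <= `|complex.Re z| + `|complex.Im z|.
Proof.
case: z => a b /=; rewrite -[leRHS]ger0_norm ?addr_ge0// -sqrtr_sqr.
rewrite ler_wsqrtr// sqrrD !real_normK ?num_real//.
by rewrite -addrA lerD2l lerDr mulrn_wge0 ?mulr_ge0.
Qed.

Lemma normc_sum I (r : seq I) (P : pred I) (F : I -> R[i]) :
  normc (\sum_(i <- r | P i) F i) <= \sum_(i <- r | P i) normc (F i).
Proof.
elim/big_rec2 : _ => [|i y x _ yx]; first by rewrite normc0.
by rewrite (le_trans (le_normcD _ _))// lerD2l.
Qed.

Lemma normc_prod I (r : seq I) (P : pred I) (F : I -> R[i]) :
  normc (\prod_(i <- r | P i) F i) = \prod_(i <- r | P i) normc (F i).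
Proof.
elim/big_rec2 : _ => [|i y x _ yx]; first by rewrite normc1.
by rewrite normcM yx.
Qed.

Lemma normc_le_eq0 z : (forall e : R, 0 < e -> normc z <= e) -> z = 0.
Proof.
move=> h; apply: eq0_normc; apply/eqP; rewrite eq_le normc_ge0 andbT.
by apply/ler_addgt0Pl => e e0; rewrite addr0; exact: h.
Qed.

Lemma cReM z w : complex.Re (z * w) =
  complex.Re z * complex.Re w - complex.Im z * complex.Im w.
Proof. by case: z w => [a b] [c d]. Qed.

Lemma cImM z w : complex.Im (z * w) =
  complex.Re z * complex.Im w + complex.Im z * complex.Re w.
Proof. by case: z w => [a b] [c d]. Qed.

Lemma cReD z w : complex.Re (z + w) = complex.Re z + complex.Re w.
Proof. by case: z w => [a b] [c d]. Qed.

Lemma cImD z w : complex.Im (z + w) = complex.Im z + complex.Im w.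
Proof. by case: z w => [a b] [c d]. Qed.

Lemma cReN z : complex.Re (- z) = - complex.Re z.
Proof. by case: z. Qed.

Lemma cImN z : complex.Im (- z) = - complex.Im z.
Proof. by case: z. Qed.

Lemma cReJ z : complex.Re z^* = complex.Re z.
Proof. by case: z. Qed.

Lemma cImJ z : complex.Im z^* = - complex.Im z.
Proof. by case: z. Qed.

End complex_modulus.

Section complex_integral.
Context {d} {T : measurableType d} {R : realType}.
Implicit Types (F G : T -> R[i]) (B : T -> R).

Definition measurableC F := measurable_fun setT (fun x => complex.Re (F x)) /\
  measurable_fun setT (fun x => complex.Im (F x)).

Lemma measurableC_cst (z : R[i]) : measurableC (cst z).
Proof. by split; exact: measurable_cst. Qed.

Lemma measurableC_real B : measurable_fun setT B ->
  measurableC (fun x => (B x)%:C).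
Proof. by move=> mB; split => //=; exact: measurable_cst. Qed.

Lemma measurableCM F G : measurableC F -> measurableC G ->
  measurableC (fun x => F x * G x).
Proof.
move=> [F1 F2] [G1 G2]; split.
- by under eq_fun do rewrite cReM; apply: measurable_funB; exact: measurable_funM.
- by under eq_fun do rewrite cImM; apply: measurable_funD; exact: measurable_funM.
Qed.

Lemma measurableCJ F : measurableC F -> measurableC (fun x => (F x)^*).
Proof.
move=> [F1 F2]; split; first by under eq_fun do rewrite cReJ.
by under eq_fun do rewrite cImJ; exact: measurableT_comp.
Qed.

Lemma measurableC_if (A : T -> bool) F G : measurable_fun setT A ->
  measurableC F -> measurableC G ->
  measurableC (fun x => if A x then F x else G x).
Proof.
move=> mA [F1 F2] [G1 G2]; split.
- by under eq_fun do rewrite (fun_if (@complex.Re R)); exact: measurable_fun_ifT.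
- by under eq_fun do rewrite (fun_if (@complex.Im R)); exact: measurable_fun_ifT.
Qed.

Lemma measurableC_cvg (h : nat -> T -> R[i]) F :
  (forall k, measurableC (h k)) ->
  (forall x (e : R), 0 < e -> \forall k \near \oo, normc (h k x - F x) <= e) ->
  measurableC F.
Proof.
move=> mh hF; split.
- apply: (@measurable_fun_cvg _ _ _ _ (fun k x => complex.Re (h k x))).
  + by move=> k; exact: (mh k).1.
  + move=> x _; apply/cvgrPdist_le => e e0; have := hF x e e0.
    apply: filterS => k; apply: le_trans; rewrite distrC -cReN -cReD.
    exact: Re_le_normc.
- apply: (@measurable_fun_cvg _ _ _ _ (fun k x => complex.Im (h k x))).
  + by move=> k; exact: (mh k).2.
  + move=> x _; apply/cvgrPdist_le => e e0; have := hF x e e0.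
    apply: filterS => k; apply: le_trans; rewrite distrC -cImN -cImD.
    exact: Im_le_normc.
Qed.

Variable mu : {measure set T -> \bar R}.
Notation integrableT := (integrableC mu setT).
Notation intC := (integralC mu setT).
Notation intR := (fun B => \int[mu]_x B x)%R.
Notation summable B := (mu.-integrable setT (fun x => (B x)%:E)).

Lemma integrable_le (f B : T -> R) : measurable_fun setT f -> summable B ->
  (forall x, `|f x| <= B x) -> summable f.
Proof.
move=> mf iB fB; apply: (le_integrable _ _ _ iB) => //.
- exact/measurable_EFinP.
- by move=> x _; rewrite lee_fin (le_trans (fB x))// ler_norm.
Qed.

Lemma integrableC_le F B : measurableC F -> summable B ->
  (forall x, normc (F x) <= B x) -> integrableT F.
Proof.
move=> [F1 F2] iB FB; split; apply: (integrable_le _ iB) => // x.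
- exact: le_trans (Re_le_normc _) (FB x).
- exact: le_trans (Im_le_normc _) (FB x).
Qed.

Lemma integrableC_measurable F : integrableT F -> measurableC F.
Proof.
by move=> [F1 F2]; split; apply/measurable_EFinP; [exact: measurable_int F1|
  exact: measurable_int F2].
Qed.

(** The real and the imaginary parts of the integral are bounded separately,
    whence the constant 2. *)
Lemma normc_integralC_le F B : integrableT F -> summable B ->
  (forall x, normc (F x) <= B x) -> normc (intC F) <= 2 * intR B.
Proof.
move=> [F1 F2] iB FB; apply: le_trans (normc_le_ReIm _) _ => /=.
rewrite mulr_natl mulr2n; apply: lerD.
- apply: (le_trans (le_normr_Rintegral _ _)) => //.
  apply: le_Rintegral => //; first exact: (integrable_norm F1).
  by move=> x _; exact: le_trans (Re_le_normc _) (FB x).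
- apply: (le_trans (le_normr_Rintegral _ _)) => //.
  apply: le_Rintegral => //; first exact: (integrable_norm F2).
  by move=> x _; exact: le_trans (Im_le_normc _) (FB x).
Qed.

Lemma eq_integralC F G : F =1 G -> intC F = intC G.
Proof. by move=> /funext ->. Qed.

Lemma eq_integrableC F G : F =1 G -> integrableT F -> integrableT G.
Proof. by move=> /funext ->. Qed.

Lemma integrableCD F G : integrableT F -> integrableT G ->
  integrableT (fun x => F x + G x).
Proof.
move=> [F1 F2] [G1 G2]; split.
- under eq_fun do rewrite cReD EFinD; exact: integrableD.
- under eq_fun do rewrite cImD EFinD; exact: integrableD.
Qed.

Lemma integralCD F G : integrableT F -> integrableT G ->
  intC (fun x => F x + G x) = intC F + intC G.
Proof.
move=> [F1 F2] [G1 G2]; apply/eqP; rewrite eq_complex/=.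
apply/andP; split; apply/eqP.
- by rewrite -RintegralD//; congr fine; congr integral; apply/funext => x; rewrite cReD.
- by rewrite -RintegralD//; congr fine; congr integral; apply/funext => x; rewrite cImD.
Qed.

Lemma integrableCZ z F : integrableT F -> integrableT (fun x => z * F x).
Proof.
move=> [F1 F2]; split.
- under eq_fun do rewrite cReM EFinB !EFinM.
  by apply: integrableB => //; exact: integrableZl.
- under eq_fun do rewrite cImM EFinD !EFinM.
  by apply: integrableD => //; exact: integrableZl.
Qed.

Lemma integralCZ z F : integrableT F -> intC (fun x => z * F x) = z * intC F.
Proof.
move=> [F1 F2]; apply/eqP; rewrite eq_complex cReM cImM/=.
have i1 (c : R) (f : T -> R) : summable f -> summable (fun x => c * f x).
  by move=> If; under eq_fun do rewrite EFinM; exact: integrableZl.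
apply/andP; split; apply/eqP.
- rewrite -2?RintegralZl// -RintegralB//; [|exact: i1|exact: i1].
  by congr fine; congr integral; apply/funext => x; rewrite cReM.
- rewrite -2?RintegralZl// -RintegralD//; [|exact: i1|exact: i1].
  by congr fine; congr integral; apply/funext => x; rewrite cImM.
Qed.

Lemma integrableCB F G : integrableT F -> integrableT G ->
  integrableT (fun x => F x - G x).
Proof.
move=> iF iG; apply: eq_integrableC (integrableCD iF (integrableCZ (-1) iG)).
by move=> x; rewrite mulN1r.
Qed.

Lemma integralCB F G : integrableT F -> integrableT G ->
  intC (fun x => F x - G x) = intC F - intC G.
Proof.
move=> iF iG; have iNG := integrableCZ (-1) iG.
rewrite -[in RHS]mulN1r -integralCZ// -integralCD//.
by apply: eq_integralC => x; rewrite mulN1r.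
Qed.

Lemma integralC0 : intC (fun=> 0) = 0.
Proof.
by apply/eqP; rewrite eq_complex/=; apply/andP; split; apply/eqP;
  rewrite /Rintegral integral0.
Qed.

Lemma integrableC0 : integrableT (fun=> 0).
Proof. by split; exact: integrable0. Qed.

Lemma integrableC_sum I (r : seq I) (F : I -> T -> R[i]) :
  (forall i, integrableT (F i)) -> integrableT (fun x => \sum_(i <- r) F i x).
Proof.
move=> iF; elim: r => [|i r IH].
  by apply: eq_integrableC integrableC0 => x; rewrite big_nil.
by apply: eq_integrableC (integrableCD (iF i) IH) => x; rewrite big_cons.
Qed.

Lemma integralC_sum I (r : seq I) (F : I -> T -> R[i]) :
  (forall i, integrableT (F i)) ->
  intC (fun x => \sum_(i <- r) F i x) = \sum_(i <- r) intC (F i).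
Proof.
move=> iF; elim: r => [|i r IH].
  by rewrite big_nil -[RHS]integralC0; apply: eq_integralC => x; rewrite big_nil.
rewrite big_cons -IH -integralCD//; last exact: integrableC_sum.
by apply: eq_integralC => x; rewrite big_cons.
Qed.

Lemma integrableCJ F : integrableT F -> integrableT (fun x => (F x)^*).
Proof.
move=> [F1 F2]; split; first by under eq_fun do rewrite cReJ.
by under eq_fun do rewrite cImJ EFinN; exact: integrableN.
Qed.

Lemma integralCJ F : integrableT F -> intC (fun x => (F x)^*) = (intC F)^*.
Proof.
move=> [F1 F2]; apply/eqP; rewrite eq_complex/=; apply/andP; split; apply/eqP.
  by congr fine; congr integral; apply/funext => x; rewrite cReJ.
rewrite -mulN1r -RintegralZl//.
by congr fine; congr integral; apply/funext => x; rewrite cImJ mulN1r.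
Qed.

End complex_integral.

Lemma measurableC_comp d1 d2 (T1 : measurableType d1) (T2 : measurableType d2)
    (R : realType) (F : T2 -> R[i]) (g : T1 -> T2) :
  measurableC F -> measurable_fun setT g -> measurableC (F \o g).
Proof.
by move=> [F1 F2] mg; split; [exact: measurableT_comp F1 mg|
  exact: measurableT_comp F2 mg].
Qed.

Section complex_fubini.
Context {d1 d2} {T1 : measurableType d1} {T2 : measurableType d2} {R : realType}.
Variables (m1 : {sigma_finite_measure set T1 -> \bar R})
          (m2 : {sigma_finite_measure set T2 -> \bar R}).
Local Open Scope ereal_scope.

Lemma integrable_prod (A : T1 -> R) (B : T2 -> R) :
  (forall x, 0 <= A x)%R -> (forall y, 0 <= B y)%R ->
  m1.-integrable setT (EFin \o A) -> m2.-integrable setT (EFin \o B) ->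
  (m1 \x m2).-integrable setT (fun p => (A p.1 * B p.2)%:E).
Proof.
move=> A0 B0 iA iB.
have mA := measurable_int _ iA; have mB := measurable_int _ iB.
have mAB : measurable_fun setT (fun p : T1 * T2 => (A p.1 * B p.2)%:E).
  apply/measurable_EFinP/measurable_funM.
  - by apply: measurableT_comp; [exact/measurable_EFinP|exact: measurable_fst].
  - by apply: measurableT_comp; [exact/measurable_EFinP|exact: measurable_snd].
apply/integrable12ltyP => //=.
have iB' : \int[m2]_y (B y)%:E < +oo.
  by move/integrableP : iB => [_]; under eq_integral do rewrite gee0_abs ?lee_fin//.
have iA' : \int[m1]_x (A x)%:E < +oo.
  by move/integrableP : iA => [_]; under eq_integral do rewrite gee0_abs ?lee_fin//.
rewrite [ltLHS](_ : _ = (\int[m1]_x ((A x)%:E * \int[m2]_y (B y)%:E))).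
  have iB0 : 0 <= \int[m2]_y (B y)%:E.
    by apply: integral_ge0 => y _; rewrite lee_fin.
  rewrite ge0_integralZr//; last by move=> x _; rewrite lee_fin.
  by apply: lte_mul_pinfty => //; [apply: integral_ge0 => x _; rewrite lee_fin|
    rewrite ge0_fin_numE//; apply: integral_ge0 => x _; rewrite lee_fin].
apply: eq_integral => x _; rewrite -ge0_integralZl//.
- by apply: eq_integral => y _; rewrite ger0_norm ?mulr_ge0.
- by move=> y _; rewrite lee_fin.
- by rewrite lee_fin.
Qed.

Section fubini.
Variable F : T1 * T2 -> R[i].
Hypothesis iF : integrableC (m1 \x m2) setT F.
Hypothesis iF1 : forall x, integrableC m2 setT (fun y => F (x, y)).

Lemma fubiniC1 : integrableC m1 setT (fun x => integralC m2 setT (fun y => F (x, y)))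
  /\ integralC (m1 \x m2) setT F =
     integralC m1 setT (fun x => integralC m2 setT (fun y => F (x, y))).
Proof.
have key (f : T1 * T2 -> R) : (m1 \x m2).-integrable setT (EFin \o f) ->
    (forall x, m2.-integrable setT (fun y => (f (x, y))%:E)) ->
    m1.-integrable setT (fun x => (\int[m2]_y f (x, y))%R%:E) /\
    (\int[m1 \x m2]_p f p = \int[m1]_x \int[m2]_y f (x, y))%R.
  move=> i i1; have E : (fun x => (\int[m2]_y f (x, y))%R%:E) =
      fubini_F m2 (EFin \o f).
    by apply/funext => x; rewrite /Rintegral fineK//; exact: integrable_fin_num.
  split; first by rewrite E; exact: integrable_fubini_F.
  by rewrite {1}/Rintegral -(fubini1 i) -E.
case: iF => i1 i2.
have [a1 b1] := key _ i1 (fun x => (iF1 x).1).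
have [a2 b2] := key _ i2 (fun x => (iF1 x).2).
by split; [split|rewrite /integralC/= b1 b2].
Qed.

End fubini.

Lemma fubiniC2 (F : T1 * T2 -> R[i]) : integrableC (m1 \x m2) setT F ->
  (forall y, integrableC m1 setT (fun x => F (x, y))) ->
  integrableC m2 setT (fun y => integralC m1 setT (fun x => F (x, y))) /\
  integralC (m1 \x m2) setT F =
     integralC m2 setT (fun y => integralC m1 setT (fun x => F (x, y))).
Proof.
move=> iF iF1.
have key (f : T1 * T2 -> R) : (m1 \x m2).-integrable setT (EFin \o f) ->
    (forall y, m1.-integrable setT (fun x => (f (x, y))%:E)) ->
    m2.-integrable setT (fun y => (\int[m1]_x f (x, y))%R%:E) /\
    (\int[m1 \x m2]_p f p = \int[m2]_y \int[m1]_x f (x, y))%R.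
  move=> i i1; have E : (fun y => (\int[m1]_x f (x, y))%R%:E) =
      fubini_G m1 (EFin \o f).
    by apply/funext => x; rewrite /Rintegral fineK//; exact: integrable_fin_num.
  split.
    rewrite E; apply/integrableP; split; first exact: (measurable_fubini_G i).
    have mf := measurable_int _ i.
    apply: le_lt_trans ((integrable21ltyP m1 m2 mf).1 i).
    apply: ge0_le_integral => //.
    - by apply: measurableT_comp => //; exact: (measurable_fubini_G i).
    - apply: (@measurable_fun_fubini_tonelli_G _ _ _ _ _ m1 (fun p => `|(f p)%:E|)).
        exact: measurableT_comp.
      by move=> p; exact: abse_ge0.
    move=> y _; apply: le_abse_integral => //.
    by apply: measurable_int (i1 y).
  by rewrite {1}/Rintegral -(fubini2 i) -E.
case: iF => i1 i2.
have [a1 b1] := key _ i1 (fun x => (iF1 x).1).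
have [a2 b2] := key _ i2 (fun x => (iF1 x).2).
by split; [split|rewrite /integralC/= b1 b2].
Qed.

End complex_fubini.

Lemma measurableC_prod {R : realType} d (T : measurableType d) I (r : seq I) (F : I -> T -> R[i]) :
  (forall i, measurableC (F i)) -> measurableC (fun x => \prod_(i <- r) F i x).
Proof.
move=> mF; elim: r => [|i r IHr].
  rewrite (_ : (fun _ => _) = cst 1); first exact: measurableC_cst.
  by apply/funext => x; rewrite big_nil.
rewrite (_ : (fun _ => _) = fun x => F i x * \prod_(j <- r) F j x); last first.
  by apply/funext => x; rewrite big_cons.
exact: measurableCM.
Qed.

Section norm_integrable.
Context {d} {T : measurableType d} {R : realType} (mu : {measure set T -> \bar R}).

Lemma integrableC_norm (F : T -> R[i]) : integrableC mu setT F ->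
  mu.-integrable setT (EFin \o (fun x => `|complex.Re (F x)| + `|complex.Im (F x)|)).
Proof.
move=> [F1 F2]; rewrite (_ : _ \o _ = (fun x =>
  (`|complex.Re (F x)|)%:E + (`|complex.Im (F x)|)%:E)%E)//.
by apply: integrableD => //; [exact: (integrable_norm F1)|exact: (integrable_norm F2)].
Qed.

Lemma integrableC_bounded (F G : T -> R[i]) (c : R) : integrableC mu setT F ->
  measurableC G -> (forall x, normc (G x) <= c) ->
  integrableC mu setT (fun x => F x * G x).
Proof.
move=> iF mG Gc.
apply: (integrableC_le (B := fun x => c * (`|complex.Re (F x)| + `|complex.Im (F x)|))).
- by apply: measurableCM => //; exact: integrableC_measurable iF.
- by under eq_fun do rewrite EFinM; apply: integrableZl => //; exact: integrableC_norm.
- move=> x; rewrite normcM mulrC ler_pM ?normc_ge0//; exact: normc_le_ReIm.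
Qed.

End norm_integrable.

(** * Affine changes of variables and product integrals on R^n *)

Section lebesgue_line.
Context {R : realType}.
Local Open Scope ereal_scope.

Definition affine (a v : R) : measurableTypeR R -> measurableTypeR R :=
  fun x => (a * x + v)%R.

Lemma measurable_affine a v : measurable_fun setT (affine a v).
Proof. by apply: measurable_funD => //; exact: measurable_funM. Qed.

Definition affine_lebesgue (a v : R) (a0 : (0 < a)%R) :
  {measure set (measurableTypeR R) -> \bar R}.
Proof.
refine (mscale (NngNum (ltW a0)) (pushforward lebesgue_measure (affine a v)
  : {measure set (measurableTypeR R) -> \bar R})).
exact: measurable_affine.
Defined.

Lemma lebesgue_measure_affine a v (a0 : (0 < a)%R) (A : set R) : measurable A ->
  lebesgue_measure A = affine_lebesgue v a0 A.
Proof.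
move=> mA; apply: lebesgue_measure_unique => //= _ [[x y]] _ <-.
rewrite /mscale /= /pushforward.
have -> : affine a v @^-1` [set` `]x, y]%R] =
    [set` `]((x - v) / a)%R, ((y - v) / a)%R]%R].
  apply/seteqP; split => z /=; rewrite !in_itv/= /affine.
    by rewrite ltr_pdivrMr// ler_pdivlMr// ltrBlDr lerBrDr mulrC.
  by rewrite ltr_pdivrMr// ler_pdivlMr// ltrBlDr lerBrDr mulrC.
rewrite !lebesgue_measure_itv/= !lte_fin ltr_pM2r ?invr_gt0// ltrD2r.
case: ifPn => xy; last by rewrite mule0.
by rewrite -!EFinB -EFinM; congr EFin; field; rewrite gt_eqF.
Qed.

Lemma ge0_integral_affine a v (F : R -> \bar R) : (0 < a)%R ->
  measurable_fun setT F -> (forall x, 0 <= F x) ->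
  \int[lebesgue_measure]_x F x =
  a%:E * \int[lebesgue_measure]_x F (a * x + v)%R.
Proof.
move=> a0 mF F0; rewrite (eq_measure_integral
  (affine_lebesgue v a0)).
  rewrite /affine_lebesgue ge0_integral_mscale//; congr (_ * _).
  by rewrite ge0_integral_pushforward//; exact: measurable_affine.
by move=> A mA _; exact: (lebesgue_measure_affine v a0 mA).
Qed.

Lemma integrable_oneDsqrV :
  lebesgue_measure.-integrable setT (fun x : R => ((1 + x ^+ 2)^-1)%:E).
Proof.
have mf : measurable_fun setT (fun x : R => (1 + x ^+ 2)^-1)%R.
  exact: continuous_measurable_fun (@continuous_oneDsqrV R).
have f0 (x : R) : (0 <= (1 + x ^+ 2)^-1)%R by rewrite invr_ge0 addr_ge0// sqr_ge0.
apply/integrableP; split; first exact/measurable_EFinP.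
under eq_integral do rewrite /= ger0_norm//.
rewrite (ge0_symfun_integralT (f := fun x => (1 + x ^+ 2)^-1%R))//.
- rewrite (_ : [set x | _] = `[0%R, +oo[%classic); last first.
    by apply/seteqP; split => x/=; rewrite in_itv/= andbT.
  by rewrite (integral0y_oneDsqr R) -EFinM ltry.
- exact: (@continuous_oneDsqrV R).
- by move=> x /=; rewrite sqrrN.
Qed.

End lebesgue_line.

Section lebesgue_space.
Context {R : realType}.
Local Open Scope ereal_scope.
Local Notation lebV n := (@lebesgue_rV R n).

Lemma ge0_integral_consr n (F : 'rV[R]_n.+1 -> \bar R) :
  measurable_fun setT F -> (forall x, 0 <= F x) ->
  \int[lebV n.+1]_x F x =
  \int[lebesgue_measure]_a \int[lebV n]_y F (consr (a, y)).
Proof.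
move=> mF F0; rewrite /= /lebesgue_consr ge0_integral_pushforward//; last first.
  exact: measurable_consr.
rewrite preimage_setT fubini_tonelli1//; last by move=> x; exact: F0.
by apply: measurableT_comp => //; exact: measurable_consr.
Qed.

Lemma measurable_affine_rV d (T : measurableType d) n (a : T -> R) (x v : T -> 'rV[R]_n) :
  measurable_fun setT a -> measurable_fun setT x -> measurable_fun setT v ->
  measurable_fun setT (fun t => a t *: x t + v t)%R.
Proof.
move=> ma mx mv; apply: measurable_fun_rV => i; under eq_fun do rewrite !mxE.
apply: measurable_funD; last exact: (measurableT_comp (measurable_coord i) mv).
by apply: measurable_funM => //; exact: (measurableT_comp (measurable_coord i) mx).
Qed.

Lemma ge0_integral_affine_rV n (a : R) (v : 'rV[R]_n) (F : 'rV[R]_n -> \bar R) :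
  (0 < a)%R -> measurable_fun setT F -> (forall x, 0 <= F x) ->
  \int[lebV n]_x F x = (a ^+ n)%:E * \int[lebV n]_x F (a *: x + v)%R.
Proof.
move=> a0; elim: n v F => [|n IH] v F mF F0.
  rewrite mul1e; apply: eq_integral => x _; congr F.
  by apply/rowP => -[].
have mFa : measurable_fun setT (fun x : 'rV[R]_n.+1 => F (a *: x + v)%R).
  by apply: measurableT_comp => //; exact: measurable_affine_rV.
rewrite !ge0_integral_consr//.
have mG : measurable_fun setT (fun x => \int[lebV n]_y F (consr (x, y))).
  apply: (@measurable_fun_fubini_tonelli_F _ _ _ _ _ (lebV n) (F \o @consr R n)) => //;
    last by move=> x; exact: F0.
  by apply: measurableT_comp => //; exact: measurable_consr.
rewrite (ge0_integral_affine (v ord0 ord0) a0)//; last first.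
  by move=> x; exact: integral_ge0.
rewrite exprS EFinM -muleA; congr (_ * _).
have mG' : measurable_fun setT
    (fun x => \int[lebV n]_y F (a *: consr (x, y) + v)%R).
  apply: (@measurable_fun_fubini_tonelli_F _ _ _ _ _ (lebV n)
     (fun p => F (a *: @consr R n p + v)%R)) => //.
  by apply: (measurableT_comp mFa); exact: measurable_consr.
rewrite -ge0_integralZl//; last 2 first.
- by move=> x _; exact: integral_ge0.
- by rewrite lee_fin exprn_ge0// ltW.
apply: eq_integral => x _.
rewrite (IH (\row_j v ord0 (lift ord0 j))%R)//; last first.
  apply: measurableT_comp => //.
  apply: measurableT_comp (@measurable_consr R n) _.
  by apply/measurable_fun_pair.
congr (_ * _); apply: eq_integral => y _; congr F.
have mE (x1 x2 : 'rV[R]_n.+1) i : (x1 + x2)%R ord0 i = (x1 ord0 i + x2 ord0 i)%R.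
  by rewrite mxE.
have zE (x1 : 'rV[R]_n.+1) i : (a *: x1)%R ord0 i = (a * x1 ord0 i)%R.
  by rewrite mxE.
apply/rowP => j; case: (unliftP ord0 j) => [k ->|->].
  by rewrite mE zE !consrS !mxE.
by rewrite mE zE !consr0.
Qed.

End lebesgue_space.

Section complex_lebesgue.
Context {R : realType}.
Local Notation lebV n := (@lebesgue_rV R n).

Lemma integrable_affine_rV n (a : R) (v : 'rV[R]_n) (f : 'rV[R]_n -> R) : 0 < a ->
  (lebV n).-integrable setT (EFin \o f) ->
  (lebV n).-integrable setT (fun x : 'rV[R]_n => (f (a *: x + v))%:E).
Proof.
move=> a0 /integrableP[mf foo].
have mfa : measurable_fun setT (fun x : 'rV[R]_n => (f (a *: x + v))%:E).
  apply: (measurableT_comp mf); exact: measurable_affine_rV.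
apply/integrableP; split => //.
move: foo; rewrite (ge0_integral_affine_rV v a0)//; last exact: measurableT_comp.
rewrite /= -lte_pdivlMl ?exprn_gt0//.
by move=> h; apply: (lt_le_trans h); rewrite leey.
Qed.

Lemma Rintegral_affine_rV n (a : R) (v : 'rV[R]_n) (f : 'rV[R]_n -> R) : 0 < a ->
  (lebV n).-integrable setT (EFin \o f) ->
  (\int[lebV n]_x f x = a ^+ n * \int[lebV n]_x f (a *: x + v))%R.
Proof.
move=> a0 fi; have fai := integrable_affine_rV v a0 fi.
have mf := measurable_int _ fi; have mfa := measurable_int _ fai.
pose T (x : 'rV[R]_n) : 'rV[R]_n := a *: x + v.
have E : (integral (lebV n) setT (EFin \o f) =
    (a ^+ n)%:E * integral (lebV n) setT ((EFin \o f) \o T))%E.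
  rewrite (integralE _ _ (EFin \o f)) (integralE _ _ ((EFin \o f) \o T)).
  rewrite (funepos_comp (EFin \o f) T) (funeneg_comp (EFin \o f) T).
  rewrite (ge0_integral_affine_rV v a0)//; last exact: measurable_funepos.
  rewrite [X in (_ - X)%E](ge0_integral_affine_rV v a0)//; last first.
    exact: measurable_funeneg.
  rewrite -muleBr// fin_num_adde_defl// fin_numN.
  have := integrable_neg_fin_num measurableT fai.
  by rewrite [X in funeneg X](_ : _ = (EFin \o f) \o T)// funeneg_comp.
by rewrite /Rintegral E fineM//; exact: integrable_fin_num.
Qed.

Lemma integrableC_affine_rV n (a : R) (v : 'rV[R]_n) (F : 'rV[R]_n -> R[i]) : 0 < a ->
  integrableC (lebV n) setT F ->
  integrableC (lebV n) setT (fun x : 'rV[R]_n => F (a *: x + v)).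
Proof.
by move=> a0 [F1 F2]; split; [exact: (integrable_affine_rV v a0 F1)|
  exact: (integrable_affine_rV v a0 F2)].
Qed.

Lemma integralC_affine_rV n (a : R) (v : 'rV[R]_n) (F : 'rV[R]_n -> R[i]) : 0 < a ->
  integrableC (lebV n) setT F ->
  integralC (lebV n) setT F =
  (a ^+ n)%:C * integralC (lebV n) setT (fun x : 'rV[R]_n => F (a *: x + v)).
Proof.
move=> a0 [F1 F2]; apply/eqP; rewrite eq_complex cReM cImM/= !mul0r subr0 addr0.
by rewrite (Rintegral_affine_rV v a0 F1) (Rintegral_affine_rV v a0 F2) !eqxx.
Qed.

Lemma integral_consr n (f : 'rV[R]_n.+1 -> R) :
  measurable_fun setT f ->
  (lebesgue_measure \x lebV n)%E.-integrable setT (fun p => (f (consr p))%:E) ->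
  (lebV n.+1).-integrable setT (EFin \o f) /\
  (\int[lebV n.+1]_x f x =
   \int[(lebesgue_measure \x lebV n)%E]_p f (consr p))%R.
Proof.
move=> mf fi; have mc := @measurable_consr R n; split.
  by apply: integrable_pushforward => //; exact/measurable_EFinP.
by rewrite /Rintegral integral_pushforward//; exact/measurable_EFinP.
Qed.

Lemma integralC_consr n (F : 'rV[R]_n.+1 -> R[i]) : measurableC F ->
  integrableC (lebesgue_measure \x lebV n)%E setT (F \o @consr R n) ->
  integrableC (lebV n.+1) setT F /\
  integralC (lebV n.+1) setT F =
  integralC (lebesgue_measure \x lebV n)%E setT (F \o @consr R n).
Proof.
move=> [m1 m2] [i1 i2].
have [a1 b1] := integral_consr m1 i1; have [a2 b2] := integral_consr m2 i2.
by split => //; rewrite /integralC b1 b2.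
Qed.

Lemma integralC_prod n (q : 'I_n -> R -> R[i]) :
  (forall i, integrableC lebesgue_measure setT (q i)) ->
  integrableC (lebV n) setT (fun x => \prod_i q i (x ord0 i)) /\
  integralC (lebV n) setT (fun x => \prod_i q i (x ord0 i)) =
  \prod_i integralC lebesgue_measure setT (q i).
Proof.
elim: n q => [|n IH] q iq.
  have E : (fun x : 'rV[R]_0 => \prod_(i < 0) q i (x ord0 i)) = cst 1.
    by apply/funext => x; rewrite big_ord0.
  rewrite E big_ord0; split.
    split => /=; apply/integrableP; split => //.
      by rewrite integral_cst//= diracE mem_set//= mule1 ltry.
    by rewrite integral_cst//= diracE mem_set//= mule1 ltry.
  have d1 (c : R) : (\int[lebV 0]_x c)%R = c.
    by rewrite /Rintegral integral_cst//= indicE mem_set//= mulr1.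
  by rewrite /integralC; congr (_ +i* _); exact: d1.
pose q' i := q (lift ord0 i).
have [iq' eq'] := IH q' (fun i => iq _).
pose P (x : 'rV[R]_n.+1) := \prod_i q i (x ord0 i).
have PE p : P (consr p) = q ord0 p.1 * \prod_i q' i (p.2 ord0 i).
  rewrite /P big_ord_recl consr0; congr (_ * _).
  by apply: eq_bigr => i _; rewrite consrS.
have mP : measurableC P.
  apply: measurableC_prod => i.
  by apply: (measurableC_comp (integrableC_measurable (iq i))); exact: measurable_coord.
have iP : integrableC (lebesgue_measure \x lebV n)%E setT (P \o @consr R n).
  apply: (integrableC_le _ (integrable_prod _ _
    (integrableC_norm (iq ord0)) (integrableC_norm iq'))).
  - by apply: measurableC_comp => //; exact: measurable_consr.
  - by move=> x; rewrite addr_ge0.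
  - by move=> x; rewrite addr_ge0.
  - move=> p /=; rewrite PE normcM; apply: ler_pM; rewrite ?normc_ge0//;
    exact: normc_le_ReIm.
have [iP' EP] := integralC_consr mP iP.
split => //; rewrite -/P EP.
have [|_ ->] := fubiniC1 iP.
  move=> x; apply: eq_integrableC (integrableCZ (q ord0 x) iq') => y.
  by rewrite /= PE.
rewrite big_ord_recl -eq' mulrC -integralCZ//; apply: eq_integralC => x /=.
rewrite mulrC -integralCZ//; apply: eq_integralC => y /=.
by rewrite PE.
Qed.

End complex_lebesgue.

(** * Grids, measurability of continuous functions, and the reference weight *)

Section sup_norm.
Context {R : realType} {n : nat}.
Implicit Types x v : 'rV[R]_n.

Lemma coord_le_norm x i : `|x ord0 i| <= `|x|.
Proof.
rewrite [leRHS]/Num.norm /= mx_normrE; apply/bigmax_geP; right => /=.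
by exists (ord0, i).
Qed.

Lemma norm_le_coord x (c : R) : 0 <= c -> (forall i, `|x ord0 i| <= c) -> `|x| <= c.
Proof.
move=> c0 xc; rewrite [leLHS]/Num.norm /= mx_normrE; apply/bigmax_leP; split => //.
by move=> [i j] _ /=; rewrite ord1.
Qed.

Lemma norm_coordP x : (0 < n)%N -> exists i, `|x| = `|x ord0 i|.
Proof.
move=> n0; have [x0|x0] := eqVneq (mx_norm x) 0.
  exists (Ordinal n0); rewrite [LHS]/Num.norm /= x0.
  by have /eqP := @mx_norm_eq0 _ _ _ _ x0 => /eqP ->; rewrite mxE normr0.
by have [[i j] /= E] := mx_norm_neq0 x0; exists j; rewrite [LHS]/Num.norm /= E ord1.
Qed.

End sup_norm.

Section grid.
Context {R : realType}.

Lemma measurable_fun_countable d (T : measurableType d) (I : countType) (r : T -> I)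
    d' (T' : measurableType d') (m : I -> T') :
  (forall i, measurable (r @^-1` [set i])) -> measurable_fun setT (m \o r).
Proof.
move=> mr _ Y mY; rewrite setTI.
rewrite (_ : _ @^-1` Y = \bigcup_i (if m i \in Y then r @^-1` [set i] else set0)).
  apply: countable_bigcupT_measurable; first exact: countableP.
  by move=> i; case: ifP.
apply/seteqP; split => [x /= Yx|x [i _]].
  by exists (r x) => //; rewrite mem_set.
by case: ifPn => // + /= -> ; rewrite inE.
Qed.

Definition cell {n} (k : nat) (x : 'rV[R]_n) : {ffun 'I_n -> int} :=
  [ffun i => Num.floor (k.+1%:R * x ord0 i)].

Definition corner {n} (k : nat) (z : {ffun 'I_n -> int}) : 'rV[R]_n :=
  \row_i ((z i)%:~R / k.+1%:R).

Definition cellp {n} (k : nat) (p : R * 'rV[R]_n) : int * {ffun 'I_n -> int} :=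
  (Num.floor (k.+1%:R * p.1), cell k p.2).

Definition cornerp {n} (k : nat) (z : int * {ffun 'I_n -> int}) : R * 'rV[R]_n :=
  (z.1%:~R / k.+1%:R, corner k z.2).

Lemma floor_approx (k : nat) (x : R) :
  x - k.+1%:R^-1 <= (Num.floor (k.+1%:R * x))%:~R / k.+1%:R <= x.
Proof.
have k0 : (0 : R) < k.+1%:R by rewrite ltr0n.
have /andP[h1 h2] := floor_itv (k.+1%:R * x).
apply/andP; split; last by rewrite ler_pdivrMr// [x * _]mulrC.
rewrite ler_pdivlMr// mulrBl mulVf ?gt_eqF// [x * _]mulrC lerBlDr.
by rewrite (le_trans (ltW h2))// intrD.
Qed.

Lemma floor_approx_gt0 (k : nat) (x : R) : 0 < x -> (k.+1%:R^-1 : R) <= x / 2 ->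
  (0 : R) < (Num.floor (k.+1%:R * x))%:~R / k.+1%:R.
Proof.
move=> x0 kx; have /andP[h1 _] := floor_approx k x; apply: lt_le_trans h1.
by rewrite subr_gt0 (le_lt_trans kx)// ltr_pdivrMr// ltr_pMr// ltr1n.
Qed.

Lemma floor_approx_dist (k : nat) (x : R) :
  `|(Num.floor (k.+1%:R * x))%:~R / k.+1%:R - x| <= k.+1%:R^-1.
Proof.
have /andP[] := floor_approx k x; set c := _ / _ => h1 h2.
by rewrite distrC ger0_norm ?subr_ge0// lerBlDr -lerBlDl.
Qed.

Lemma dist_corner n k (x : 'rV[R]_n) : `|corner k (cell k x) - x| <= k.+1%:R^-1.
Proof.
apply: norm_le_coord => [|i]; first by rewrite invr_ge0.
rewrite !mxE ffunE; have /andP[h1 h2] := floor_approx k (x ord0 i).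
by rewrite distrC ger0_norm ?subr_ge0// lerBlDr -lerBlDl.
Qed.

Lemma measurable_floor_fiber d (T : measurableType d) (f : T -> R) (k : nat) (z : int) :
  measurable_fun setT f -> measurable [set x | Num.floor (k.+1%:R * f x) = z].
Proof.
move=> mf; rewrite (_ : [set _ | _] =
   (fun x => k.+1%:R * f x) @^-1` [set` `[z%:~R, (z + 1)%:~R[]); last first.
  apply/seteqP; split => x /=; rewrite in_itv/=.
    by move=> <-; rewrite -floor_eq.
  by rewrite -floor_eq => /eqP.
rewrite -[X in measurable X]setTI; apply: measurable_funM => //.
Qed.

Lemma measurable_cell n k (z : {ffun 'I_n -> int}) :
  measurable (@cell n k @^-1` [set z]).
Proof.
rewrite (_ : _ @^-1` _ = \bigcap_(i in [set: 'I_n])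
    [set x : 'rV[R]_n | Num.floor (k.+1%:R * x ord0 i) = z i]); last first.
  apply/seteqP; split => [x /= <- i _ /=|x h]; first by rewrite ffunE.
  by apply/ffunP => i; rewrite ffunE; exact: h.
apply: fin_bigcap_measurable => // i _.
by apply: measurable_floor_fiber; exact: measurable_coord.
Qed.

Lemma measurable_cellp n k z : measurable (@cellp n k @^-1` [set z]).
Proof.
case: z => u z; rewrite (_ : _ @^-1` _ =
    [set p : R * 'rV[R]_n | Num.floor (k.+1%:R * p.1) = u] `&`
    snd @^-1` (@cell n k @^-1` [set z])); last first.
  by apply/seteqP; split => p /=; rewrite /cellp => -[<- <-].
apply: measurableI; first by apply: measurable_floor_fiber; exact: measurable_fst.
by rewrite -[X in measurable X]setTI; apply: measurable_snd => //;
  exact: measurable_cell.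
Qed.

Lemma cvg_invSn (e : R) : 0 < e -> \forall k \near \oo, k.+1%:R^-1 <= e.
Proof.
move=> e0; have /cvgrPdist_le/(_ e e0) := @cvg_harmonic R.
by apply: filterS => k; rewrite sub0r normrN ger0_norm// /harmonic invr_ge0.
Qed.

(** A continuous function is the limit of its values at the corners of finer
    and finer grids, and each approximation takes countably many values. *)
Lemma measurable_continuous_rV n (f : 'rV[R]_n -> R) : continuous f ->
  measurable_fun setT f.
Proof.
move=> cf; apply: (@measurable_fun_cvg _ _ _ _ (fun k x => f (corner k (cell k x)))).
  move=> k; apply: (@measurable_fun_countable _ _ _ (@cell n k) _ _ (fun z => f (corner k z))).
  by move=> z; exact: measurable_cell.
move=> x _; apply: (@continuous_cvg _ _ _ _ _ (fun k => corner k (cell k x)) f).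
  exact: cf.
apply/cvgrPdist_le => e e0; apply: filterS (cvg_invSn e0) => k; apply: le_trans.
by rewrite distrC; exact: dist_corner.
Qed.

Lemma measurableC_continuous_rV n (F : 'rV[R]_n -> R[i]) :
  continuous (fun x => complex.Re (F x)) -> continuous (fun x => complex.Im (F x)) ->
  measurableC F.
Proof. by move=> c1 c2; split; exact: measurable_continuous_rV. Qed.

(** The same for functions on the half-space; they are continuous only where
    the first coordinate is positive, and extended by zero elsewhere. *)
Lemma measurableC_halfspace n (F : R * 'rV[R]_n -> R[i]) :
  (forall p : R * 'rV[R]_n, p.1 <= 0 -> F p = 0) ->
  (forall p : R * 'rV[R]_n, 0 < p.1 -> forall e : R, 0 < e ->
     exists2 d : R, 0 < d & forall q : R * 'rV[R]_n, 0 < q.1 -> `|q.1 - p.1| <= d -> `|q.2 - p.2| <= d ->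
       normc (F q - F p) <= e) ->
  measurableC F.
Proof.
move=> F0 cF; apply: (@measurableC_cvg _ _ _ (fun k x => F (cornerp k (cellp k x)))).
  move=> k; split.
    apply: (@measurable_fun_countable _ _ _ (@cellp n k) _ _ (fun z => complex.Re (F (cornerp k z)))).
    by move=> z; exact: measurable_cellp.
  apply: (@measurable_fun_countable _ _ _ (@cellp n k) _ _ (fun z => complex.Im (F (cornerp k z)))).
  by move=> z; exact: measurable_cellp.
move=> [a b] e e0; case: (leP a 0) => a0.
  apply: nearW => k; rewrite !F0//; first by rewrite subrr normc0 ltW.
  by have /andP[_ h] := floor_approx k a; exact: le_trans h a0.
have [d d0 cd] := cF (a, b) a0 e e0.
have a20 : 0 < a / 2 by rewrite divr_gt0.
near=> k.
have kd : k.+1%:R^-1 <= d by near: k; exact: cvg_invSn.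
have ka : k.+1%:R^-1 <= a / 2 by near: k; exact: cvg_invSn.
apply: cd => /=; last by apply: le_trans kd; exact: dist_corner.
  exact: floor_approx_gt0.
exact: le_trans (floor_approx_dist _ _) kd.
Unshelve. all: by end_near. Qed.

End grid.

Section decay.
Context {R : realType}.
Implicit Types n : nat.

(** An integrable weight that, being a product, is integrated one coordinate at
    a time. *)
Definition decay {n} (x : 'rV[R]_n) : R := \prod_i (1 + x ord0 i ^+ 2)^-1.

Lemma decay_gt0 n (x : 'rV[R]_n) : 0 < decay x.
Proof. by apply: prodr_gt0 => i _; rewrite invr_gt0 ltr_pwDl// sqr_ge0. Qed.

Lemma decay_ge0 n (x : 'rV[R]_n) : 0 <= decay x.
Proof. exact/ltW/decay_gt0. Qed.

Lemma integrable_decay n : (@lebesgue_rV R n).-integrable setT (EFin \o @decay n).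
Proof.
have [|[h _] _] := @integralC_prod R n (fun _ t => ((1 + t ^+ 2)^-1)%:C).
  move=> _; split; first exact: integrable_oneDsqrV.
  by under eq_fun do rewrite /=; exact: integrable0.
move: h; congr (integrable _ _ _); apply/funext => x /=; congr EFin.
by rewrite -rmorph_prod.
Qed.

(** A function f with f and |x|^(2n) f bounded is therefore dominated by the
    weight. *)
Lemma decay_lower n (x : 'rV[R]_n) : 1 <= 2 ^+ n * (1 + `|x| ^+ (2 * n)) * decay x.
Proof.
rewrite /decay prodfV ler_pdivlMr ?mul1r; last first.
  by apply: prodr_gt0 => i _; rewrite ltr_pwDl// sqr_ge0.
have h : \prod_(i < n) (1 + x ord0 i ^+ 2) <= (1 + `|x| ^+ 2) ^+ n.
  rewrite -[X in _ <= _ ^+ X]card_ord -prodr_const; apply: ler_prod => i _.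
  rewrite addr_ge0 ?sqr_ge0//= lerD2l -[leLHS]real_normK ?num_real//.
  by rewrite lerXn2r ?nnegrE// coord_le_norm.
apply: le_trans h _; rewrite exprM.
have X0 : 0 <= `|x| ^+ 2 by rewrite sqr_ge0.
move: X0; set X := `|x| ^+ 2 => X0.
case: (leP X 1) => X1.
  rewrite (@le_trans _ _ (2 ^+ n))//.
    by rewrite lerXn2r ?nnegrE ?addr_ge0//; lra.
  by rewrite ler_peMr ?exprn_ge0// lerDl exprn_ge0.
rewrite (@le_trans _ _ (2 ^+ n * X ^+ n))//.
  by rewrite -exprMn lerXn2r ?nnegrE ?addr_ge0 ?mulr_ge0//; lra.
by rewrite ler_pM2l ?exprn_gt0// lerDr.
Qed.

End decay.

(** * Uniqueness for the Fourier transform *)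

Section characters.
Context {R : realType}.

(** exp (- i t), with the sign of the Fourier transform. *)
Definition expi (t : R) : R[i] := cos t -i* sin t.

Lemma normc_expiE (t : R) : normc (expi t) = 1.
Proof. by rewrite /= sqrrN cos2Dsin2 sqrtr1. Qed.

Lemma expiD (s t : R) : expi (s + t) = expi s * expi t.
Proof.
by apply/eqP; rewrite eq_complex/= cosD sinD; apply/andP; split; apply/eqP; ring.
Qed.

Lemma expi0 : expi 0 = 1.
Proof. by rewrite /expi cos0 sin0; apply/eqP; rewrite eq_complex/= oppr0 !eqxx. Qed.

Lemma expiN (t : R) : expi (- t) = (expi t)^*.
Proof. by rewrite /expi cosN sinN. Qed.

Lemma expi_sum I (r : seq I) (F : I -> R) :
  expi (\sum_(i <- r) F i) = \prod_(i <- r) expi (F i).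
Proof. by apply: (big_morph expi expiD expi0). Qed.

Lemma measurable_expi : measurableC expi.
Proof.
split; first exact: continuous_measurable_fun (@continuous_cos R).
by rewrite /expi/=; apply: measurableT_comp => //;
  exact: continuous_measurable_fun (@continuous_sin R).
Qed.

Lemma measurable_dot n d (T : measurableType d) (x y : T -> 'rV[R]_n) :
  measurable_fun setT x -> measurable_fun setT y ->
  measurable_fun setT (fun t => dot (x t) (y t)).
Proof.
move=> mx my; rewrite /dot; elim: (index_enum _) => [|i r IH].
  by under eq_fun do rewrite big_nil; exact: measurable_cst.
under eq_fun do rewrite big_cons; apply: measurable_funD => //.
by apply: measurable_funM; [exact: (measurableT_comp (measurable_coord i) mx)|
  exact: (measurableT_comp (measurable_coord i) my)].
Qed.

Lemma measurable_expi_dot n d (T : measurableType d) (x y : T -> 'rV[R]_n) :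
  measurable_fun setT x -> measurable_fun setT y ->
  measurableC (fun t => expi (dot (x t) (y t))).
Proof.
by move=> mx my; apply: (measurableC_comp measurable_expi); exact: measurable_dot.
Qed.

Lemma dotC n (x y : 'rV[R]_n) : dot x y = dot y x.
Proof. by apply: eq_bigr => i _; rewrite mulrC. Qed.

Lemma dotDl n (x y z : 'rV[R]_n) : dot (x + y) z = dot x z + dot y z.
Proof. by rewrite /dot -big_split; apply: eq_bigr => i _; rewrite mxE mulrDl. Qed.

Lemma dotDr n (x y z : 'rV[R]_n) : dot z (x + y) = dot z x + dot z y.
Proof. by rewrite dotC dotDl !(dotC z). Qed.

Lemma dotZl n (a : R) (x z : 'rV[R]_n) : dot (a *: x) z = a * dot x z.
Proof. by rewrite /dot mulr_sumr; apply: eq_bigr => i _; rewrite mxE mulrA. Qed.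

Lemma dotZr n (a : R) (x z : 'rV[R]_n) : dot z (a *: x) = a * dot z x.
Proof. by rewrite dotC dotZl dotC. Qed.

Lemma dotNl n (x z : 'rV[R]_n) : dot (- x) z = - dot x z.
Proof. by rewrite -scaleN1r dotZl mulN1r. Qed.

Lemma dotNr n (x z : 'rV[R]_n) : dot z (- x) = - dot z x.
Proof. by rewrite dotC dotNl dotC. Qed.

Lemma fourierE n (g : 'rV[R]_n -> R[i]) xi :
  fourier g xi = integralC (lebesgue_rV n) setT (fun x => g x * expi (dot x xi)).
Proof. by []. Qed.

End characters.

Section fourier_uniqueness.
Context {R : realType}.
Local Notation lebV n := (@lebesgue_rV R n).
Local Notation leb := (@lebesgue_measure R).

(** The Fourier kernel of the indicator of [0, 1]; its integral unit_hat is the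
    transform of that indicator. *)
Definition unit_char (y t : R) : R[i] := if (0 <= t <= 1) then expi (y * t) else 0.

Definition unit_hat (y : R) : R[i] := integralC leb setT (unit_char y).

Lemma unit_char_measurable d (T : measurableType d) (y t : T -> R) :
  measurable_fun setT y -> measurable_fun setT t ->
  measurableC (fun x => unit_char (y x) (t x)).
Proof.
move=> my mt; apply: measurableC_if.
- by apply: measurable_and; apply: measurable_fun_ler.
- by apply: (measurableC_comp measurable_expi); exact: measurable_funM.
- exact: measurableC_cst.
Qed.

Definition unit_bound (t : R) : R := (0 <= t <= 1)%R%:R.

Lemma integrable_unit_bound : leb.-integrable setT (EFin \o unit_bound).
Proof.
rewrite (_ : _ \o _ = (fun x => (\1_(`[0%R, 1%R]%classic) x)%:E)); last first.
  apply/funext => t; rewrite /unit_bound /= indicE.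
  by congr (_%:R)%:E; rewrite mem_setE in_itv.
exact: integrable_indic_itv.
Qed.

Lemma normc_unit_char y t : normc (unit_char y t) <= unit_bound t.
Proof.
by rewrite /unit_char /unit_bound; case: ifP => _; rewrite ?normc_expiE ?normc0.
Qed.

Lemma integrable_unit_char y : integrableC leb setT (unit_char y).
Proof.
apply: (integrableC_le _ integrable_unit_bound (normc_unit_char y)).
by apply: (@unit_char_measurable _ _ (cst y) id) => //; exact: measurable_cst.
Qed.

Let parts y : complex.Re (unit_hat y) = (\int[leb]_(t in `[0, 1]) cos (y * t))%R /\
  complex.Im (unit_hat y) = - (\int[leb]_(t in `[0, 1]) sin (y * t))%R.
Proof.
have cc (f : R -> R) : continuous f -> leb.-integrable `[0, 1] (fun t => (f (y * t))%:E).
  move=> cf; apply: continuous_compact_integrable; first exact: segment_compact.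
  apply: continuous_subspaceT => t; apply: continuous_comp; last exact: cf.
  by apply: cvgM; [exact: cvg_cst|exact: cvg_id].
split.
  rewrite [RHS]Rintegral_mkcond; apply: eq_Rintegral => t _.
  by rewrite /patch mem_setE in_itv/= /unit_char; case: ifP.
rewrite -mulN1r -RintegralZl//; last exact: (cc _ (@continuous_sin R)).
rewrite [RHS]Rintegral_mkcond; apply: eq_Rintegral => t _.
by rewrite /patch mem_setE in_itv/= /unit_char; case: ifP => //= _; rewrite mulN1r.
Qed.

Lemma unit_hatE (y : R) : y != 0 ->
  unit_hat y = (sin y / y) -i* ((1 - cos y) / y).
Proof.
move=> y0; have [p1 p2] := parts y.
have dy (t : R) : is_derive t 1 (fun t => y * t) y.
  by apply: is_derive_eq; rewrite [_ *: _]mulr1.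
have ftc (f F : R -> R) : continuous f -> (forall t : R, is_derive t 1 F (f (y * t) )) ->
    (\int[leb]_(t in `[0, 1]) f (y * t))%R = F 1 - F 0.
  move=> cf dF; rewrite /Rintegral (@continuous_FTC2 _ _ F)//.
  - apply: continuous_subspaceT => t; apply: continuous_comp; last exact: cf.
    by apply: cvgM; [exact: cvg_cst|exact: cvg_id].
  - split.
    + by move=> t _; exact: ex_derive.
    + by apply: cvg_at_right_filter; apply: differentiable_continuous;
        apply/derivable1_diffP; exact: ex_derive.
    + by apply: cvg_at_left_filter; apply: differentiable_continuous;
        apply/derivable1_diffP; exact: ex_derive.
  - by move=> t _; rewrite derive1E; exact: derive_val.
apply/eqP; rewrite eq_complex p1 p2/=; apply/andP; split; apply/eqP.
- have dS (t : R) : is_derive t (1 : R) (fun t => y^-1 *: sin (y * t)) (cos (y * t)).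
    have h : is_derive t (1 : R) (sin \o (fun t => y * t)) (cos (y * t) * y).
      exact: is_derive1_comp.
    have := is_deriveZ y^-1 h; move=> h'; apply: (is_derive_eq h').
    by rewrite /GRing.scale/= mulrCA mulVf// mulr1.
  rewrite (ftc _ _ (@continuous_cos R) dS).
  by rewrite mulr1 mulr0 sin0 scaler0 subr0 mulrC.
- have dC (t : R) : is_derive t (1 : R) (fun t => (- y^-1) *: cos (y * t)) (sin (y * t)).
    have h : is_derive t (1 : R) (cos \o (fun t => y * t)) (- sin (y * t) * y).
      exact: is_derive1_comp.
    have := is_deriveZ (- y^-1) h; move=> h'; apply: (is_derive_eq h').
    by rewrite /GRing.scale/=; field.
  rewrite (ftc _ _ (@continuous_sin R) dC).
  by rewrite mulr1 mulr0 cos0 /GRing.scale/= ; field.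
Qed.

End fourier_uniqueness.

(** Inversion is discontinuous at 0, but it is the pointwise limit of the
    functions y / (y ^ 2 + 1 / (k + 1)). *)
Lemma measurable_inv (R : realType) : measurable_fun setT (fun y : R => y^-1).
Proof.
pose h k (y : R) : R := y * (y ^+ 2 + k.+1%:R^-1)^-1.
apply: (@measurable_fun_cvg _ _ _ _ h) => [k|y _].
  apply: continuous_measurable_fun => y; apply: cvgM; first exact: cvg_id.
  apply: cvgV; first by rewrite gt_eqF// ltr_wpDl ?sqr_ge0// invr_gt0 ltr0n.
  by apply: cvgD; [exact: exprn_continuous|exact: cvg_cst].
have [->|y0] := eqVneq y 0.
  rewrite invr0 (_ : h ^~ 0 = cst 0); first exact: cvg_cst.
  by apply/funext => k; rewrite /h mul0r.
rewrite [X in _ --> X](_ : _ = y * (y ^+ 2 + 0)^-1); last first.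
  by rewrite addr0; field.
apply: cvgM; first exact: cvg_cst.
apply: cvgV; first by rewrite addr0 sqrf_eq0.
by apply: cvgD; [exact: cvg_cst|exact: cvg_harmonic].
Qed.

Section fejer.
Context {R : realType}.
Local Notation lebV n := (@lebesgue_rV R n).
Local Notation leb := (@lebesgue_measure R).

Lemma normc_sqr (z : R[i]) : normc z ^+ 2 = complex.Re z ^+ 2 + complex.Im z ^+ 2.
Proof. by case: z => a b /=; rewrite sqr_sqrtr// addr_ge0// sqr_ge0. Qed.

Lemma mulc_conj (z : R[i]) : z^* * z = (normc z ^+ 2)%:C.
Proof.
rewrite normc_sqr; case: z => a b; apply/eqP; rewrite eq_complex/=.
by apply/andP; split; apply/eqP; ring.
Qed.

(** Up to normalization, the Fejer kernel: it is nonnegative and integrable,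
    and it is the transform of a compactly supported function, namely of the
    autocorrelation of the indicator of [0, 1]. *)
Definition fejer (y : R) : R := normc (unit_hat y) ^+ 2.

Lemma fejer_ge0 y : 0 <= fejer y. Proof. exact: sqr_ge0. Qed.

Lemma measurable_unit_hat : measurableC (@unit_hat R).
Proof.
rewrite (_ : @unit_hat R = fun y => if y == 0 then unit_hat 0 else
  (sin y / y) -i* ((1 - cos y) / y)); last first.
  by apply/funext => y; case: eqVneq => [->//|y0]; exact: unit_hatE.
have mV : measurable_fun setT (fun y : R => y^-1).
  exact: measurable_inv.
have ms := continuous_measurable_fun (@continuous_sin R).
have mc := continuous_measurable_fun (@continuous_cos R).
apply: measurableC_if; [exact: measurable_fun_eqr|exact: measurableC_cst|split => /=].
- exact: measurable_funM.
- apply: measurableT_comp => //; apply: measurable_funM => //.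
  exact: measurable_funB.
Qed.

Lemma measurable_fejer : measurable_fun setT fejer.
Proof.
rewrite (_ : fejer = fun y =>
  complex.Re (unit_hat y) ^+ 2 + complex.Im (unit_hat y) ^+ 2); last first.
  by apply/funext => y; rewrite /fejer normc_sqr.
have [m1 m2] := measurable_unit_hat.
by apply: measurable_funD; exact: measurable_funX.
Qed.

Lemma fejer_bound : exists2 c : R, 0 <= c & forall y, fejer y <= c * (1 + y ^+ 2)^-1.
Proof.
have [c c0' hc] : exists2 c : R, 0 <= c & forall y, normc (unit_hat y) <= c.
  exists (2 * (\int[leb]_t unit_bound t)%R).
    by rewrite mulr_ge0//; apply: Rintegral_ge0 => t _; exact: ler0n.
  move=> y; apply: normc_integralC_le; first exact: integrable_unit_char.
    exact: integrable_unit_bound.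
  exact: normc_unit_char.
exists (c ^+ 2 + 5); first by rewrite addr_ge0// sqr_ge0.
move=> y; rewrite ler_pdivlMr ?ltr_pwDl ?sqr_ge0// mulrDr mulr1 lerD//.
  by rewrite /fejer lerXn2r ?nnegrE ?normc_ge0.
have [->|y0] := eqVneq y 0; first by rewrite expr0n mulr0.
rewrite /fejer normc_sqr unit_hatE//= sqrrN !expr_div_n -mulrDl divfK ?sqrf_eq0//.
have s1 : sin y ^+ 2 <= 1 by rewrite -(cos2Dsin2 y) lerDr sqr_ge0.
have c1 := cos_le1 y; have c2 := cos_geN1 y.
by nra.
Qed.

Lemma integrable_fejer : leb.-integrable setT (EFin \o fejer).
Proof.
have [c c0 hc] := fejer_bound.
apply: (@integrable_le _ _ R leb fejer (fun y : R => c * (1 + y ^+ 2)^-1)).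
- exact: measurable_fejer.
- under eq_fun do rewrite EFinM; apply: integrableZl => //.
  exact: integrable_oneDsqrV.
- by move=> y; rewrite ger0_norm// fejer_ge0.
Qed.

(** On [1, 2] the kernel stays above a positive constant. *)
Lemma integral_fejer_gt0 : 0 < (\int[leb]_y fejer y)%R.
Proof.
pose c := (1 - cos 1) ^+ 2 / 4 : R.
have cos1 : cos 1 < 1 :> R.
  rewrite -[ltRHS]cos0 ltr_cos// in_itv/= ?lexx ?pi_ge0//=.
  by rewrite ler01/= (le_trans _ (@pi_ge2 R))// ler1n.
have c0 : 0 < c by rewrite divr_gt0// exprn_gt0// subr_gt0.
apply: (@lt_le_trans _ _ (\int[leb]_(y in `[1%R, 2%R]) c)%R).
  rewrite Rintegral_cst//= lebesgue_measure_itv/= lte_fin ltr1n/=.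
  by rewrite mulr_gt0//; lra.
rewrite Rintegral_mkcond; apply: le_Rintegral => //.
- rewrite (_ : _ \o _ = (fun x => c%:E * (\1_(`[1%R, 2%R]%classic) x)%:E)%E); last first.
    apply/funext => y; rewrite /patch /= indicE.
    by case: (y \in _); rewrite -EFinM ?mulr1 ?mulr0.
  by apply: integrableZl => //; exact: integrable_indic_itv.
- exact: integrable_fejer.
move=> /= y' _; pose y : R := y'; rewrite -/y /patch mem_setE in_itv/=; case: ifP => [/andP[y1 y2]|_]; last first.
  exact: fejer_ge0.
have y0 : y != 0 by rewrite gt_eqF// (lt_le_trans _ y1).
rewrite /fejer normc_sqr unit_hatE//= sqrrN !expr_div_n -mulrDl.
have cy : cos y <= cos 1.
  rewrite leNgt ltr_cos ?in_itv/= -?leNgt//.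
    by rewrite (le_trans _ y1)//= (le_trans y2)// pi_ge2.
  by rewrite ler01 (le_trans _ (@pi_ge2 R))// ler1n.
rewrite /c ler_pdivrMr// mulrAC ler_pdivlMr ?exprn_even_gt0//=.
have h1 : (1 - cos 1) ^+ 2 <= (1 - cos y) ^+ 2.
  by rewrite lerXn2r ?nnegrE; lra.
have h2 : 0 <= sin y ^+ 2 by exact: sqr_ge0.
have h3 : y ^+ 2 <= 4 by nra.
have h4 : 0 <= (1 - cos 1 : R) ^+ 2 by exact: sqr_ge0.
by nra.
Qed.

Definition box_hat n (v : 'rV[R]_n) : R[i] := \prod_i unit_hat (v ord0 i).

Definition fejerV n (v : 'rV[R]_n) : R := \prod_i fejer (v ord0 i).

Lemma box_hat_sqr n (v : 'rV[R]_n) : (box_hat v)^* * box_hat v = (fejerV v)%:C.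
Proof.
rewrite /box_hat /fejerV rmorph_prod -big_split rmorph_prod /=.
by apply: eq_bigr => i _; rewrite mulc_conj.
Qed.

Lemma integrable_prod_real n (q : R -> R) : leb.-integrable setT (EFin \o q) ->
  (lebV n).-integrable setT (fun x => (\prod_i q (x ord0 i))%:E) /\
  (\int[lebV n]_x \prod_i q (x ord0 i) = (\int[leb]_t q t) ^+ n)%R.
Proof.
move=> iq; have [|[h _] E] := @integralC_prod R n (fun _ t => (q t)%:C).
  by move=> _; split => //=; exact: integrable0.
have rE (x : 'rV[R]_n) : complex.Re (\prod_i (q (x ord0 i))%:C) = \prod_i q (x ord0 i).
  by rewrite -rmorph_prod.
split; first by move: h; under eq_fun do rewrite rE.
have iE : integralC leb setT (fun t => (q t)%:C) = (\int[leb]_t q t)%R%:C.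
  by rewrite /integralC /=; congr (_ +i* _); rewrite /Rintegral integral0.
move: E; rewrite iE prodr_const card_ord -rmorphXn => /(congr1 (@complex.Re R)) /= <-.
by congr fine; congr integral; apply/funext => x; rewrite rE.
Qed.

Lemma integrable_fejerV n : (lebV n).-integrable setT (EFin \o @fejerV n).
Proof. by have [] := integrable_prod_real n integrable_fejer. Qed.

Lemma integral_fejerV_gt0 n : 0 < (\int[lebV n]_v fejerV v)%R.
Proof.
have [_] := integrable_prod_real n integrable_fejer; rewrite /fejerV => ->.
by rewrite exprn_gt0// integral_fejer_gt0.
Qed.

Lemma prod_unit_char n (v t : 'rV[R]_n) : \prod_i unit_char (v ord0 i) (t ord0 i) =
  if [forall i, 0 <= t ord0 i <= 1] then expi (dot v t) else 0.
Proof.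
case: ifPn => [/forallP ht|].
  by rewrite /dot expi_sum; apply: eq_bigr => i _; rewrite /unit_char ht.
rewrite negb_forall => /existsP[i hi]; rewrite (bigD1 i)//= /unit_char.
by rewrite (negbTE hi) mul0r.
Qed.

(** Multiplying by the transform of the indicator of a cube averages the
    Fourier transform over translates of the cube, so a vanishing transform
    stays zero. *)
Lemma fourier_box_hat n (g : 'rV[R]_n -> R[i]) : integrableC (lebV n) setT g ->
  (forall xi, fourier g xi = 0) ->
  integrableC (lebV n) setT (fun v => g v * box_hat v) /\
  forall xi, fourier (fun v => g v * box_hat v) xi = 0.
Proof.
move=> ig g0.
have mg := integrableC_measurable ig.
have [iub _] := integrable_prod_real n (@integrable_unit_bound R).
pose F xi (p : 'rV[R]_n * 'rV[R]_n) : R[i] := g p.1 * expi (dot p.1 xi) *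
  \prod_i unit_char (p.1 ord0 i) (p.2 ord0 i).
have mF xi : measurableC (F xi).
  apply: measurableCM; first apply: measurableCM.
  - by apply: (measurableC_comp mg); exact: measurable_fst.
  - by apply: measurable_expi_dot => //; exact: measurable_fst.
  - apply: measurableC_prod => i; apply: unit_char_measurable.
      by apply: (measurableT_comp (measurable_coord i)); exact: measurable_fst.
    by apply: (measurableT_comp (measurable_coord i)); exact: measurable_snd.
pose G v := `|complex.Re (g v)| + `|complex.Im (g v)|.
pose U (t : 'rV[R]_n) : R := \prod_i unit_bound (t ord0 i).
have F_le xi p : normc (F xi p) <= G p.1 * U p.2.
  rewrite /F !normcM normc_expiE mulr1; apply: ler_pM; rewrite ?normc_ge0//.
    exact: normc_le_ReIm.
  rewrite normc_prod; apply: ler_prod => i _; rewrite normc_ge0/=.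
  exact: normc_unit_char.
have iF xi : integrableC (lebV n \x lebV n)%E setT (F xi).
  apply: (integrableC_le (mF xi) _ (F_le xi)).
  apply: integrable_prod => //.
  - by move=> v; rewrite addr_ge0.
  - by move=> t; apply: prodr_ge0 => i _; rewrite ler0n.
  - exact: integrableC_norm.
have inner (v : 'rV[R]_n) : integralC (lebV n) setT (fun t : 'rV[R]_n =>
    \prod_i unit_char (v ord0 i) (t ord0 i)) = box_hat v.
  have [|_ ->//] := @integralC_prod R n (fun i => unit_char (v ord0 i)).
  by move=> i; exact: integrable_unit_char.
have iinner (v : 'rV[R]_n) : integrableC (lebV n) setT (fun t : 'rV[R]_n =>
    \prod_i unit_char (v ord0 i) (t ord0 i)).
  have [|//] := @integralC_prod R n (fun i => unit_char (v ord0 i)).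
  by move=> i; exact: integrable_unit_char.
have iF1 xi v : integrableC (lebV n) setT (fun t => F xi (v, t)).
  by rewrite /F /=; exact: (integrableCZ _ (iinner v)).
have iF2 xi t : integrableC (lebV n) setT (fun v => F xi (v, t)).
  rewrite (_ : (fun v => _) = fun v => g v * (expi (dot v xi) *
     \prod_i unit_char (v ord0 i) (t ord0 i))); last first.
    by apply/funext => v; rewrite /F mulrA.
  apply: (integrableC_bounded (c := 1)) => //.
    apply: measurableCM; first by apply: measurable_expi_dot.
    apply: measurableC_prod => i.
    by apply: unit_char_measurable => //; exact: measurable_coord.
  move=> v; rewrite normcM normc_expiE mul1r prod_unit_char.
  by case: ifP => _; rewrite ?normc_expiE ?normc0.
have FE xi : (fun v => integralC (lebV n) setT (fun t => F xi (v, t))) =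
    fun v => g v * box_hat v * expi (dot v xi).
  by apply/funext => v; rewrite /F /= (integralCZ _ (iinner v)) inner mulrAC.
split.
  have [+ _] := fubiniC1 (iF 0) (iF1 0); rewrite FE; apply: eq_integrableC => v.
  rewrite (_ : dot v 0 = 0) ?expi0 ?mulr1//.
  by rewrite /dot big1// => i _; rewrite mxE mulr0.
move=> xi; rewrite fourierE.
have [_ E1] := fubiniC1 (iF xi) (iF1 xi); have [_ E2] := fubiniC2 (iF xi) (iF2 xi).
rewrite FE in E1; rewrite -E1 E2 -[RHS](integralC0 (lebV n)).
apply: eq_integralC => t; rewrite /F /=.
case: (boolP [forall i, 0 <= t ord0 i <= 1]) => ht.
  rewrite -(g0 (xi + t)) fourierE; apply: eq_integralC => v.
  by rewrite prod_unit_char ht dotDr expiD mulrA.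
rewrite -[RHS](integralC0 (lebV n)); apply: eq_integralC => v.
by rewrite prod_unit_char (negbTE ht) mulr0.
Qed.

Lemma fourier_conj n (g : 'rV[R]_n -> R[i]) xi : integrableC (lebV n) setT g ->
  fourier (fun v => (g v)^*) xi = (fourier g (- xi))^*.
Proof.
move=> ig; rewrite !fourierE -integralCJ; last first.
  apply: (integrableC_bounded (c := 1)) => //; last by move=> v; rewrite normc_expiE.
  exact: measurable_expi_dot.
apply: eq_integralC => v; rewrite rmorphM; congr (_ * _).
by rewrite dotNr expiN [RHS]conjcK.
Qed.

(** The product of box_hat and its conjugate is the kernel, so the previous
    averaging is applied to g and then to the conjugate of g * box_hat. *)
Lemma fejer_average n (g : 'rV[R]_n -> R[i]) : integrableC (lebV n) setT g ->
  (forall xi, fourier g xi = 0) ->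
  integralC (lebV n) setT (fun v => (g v)^* * (fejerV v)%:C) = 0.
Proof.
move=> ig g0; have [i1 z1] := fourier_box_hat ig g0.
have [|xi|i2 z2] := @fourier_box_hat n (fun v => (g v * box_hat v)^*).
- exact: integrableCJ.
- by rewrite fourier_conj// z1 conjc0.
rewrite -(z2 0) fourierE; apply: eq_integralC => v.
rewrite (_ : dot v 0 = 0); last by rewrite /dot big1// => i _; rewrite mxE mulr0.
by rewrite expi0 mulr1 rmorphM/= -mulrA box_hat_sqr.
Qed.

(** Fourier uniqueness: averaging an integrable function with zero transform
    against ever narrower Fejer kernels gives zero, and by continuity recovers
    its value. *)
Lemma fourier_unique n (h : 'rV[R]_n -> R[i]) (M : R) :
  integrableC (lebV n) setT h ->
  continuous (fun x => complex.Re (h x)) -> continuous (fun x => complex.Im (h x)) ->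
  (forall x, normc (h x) <= M) ->
  (forall xi, fourier h xi = 0) -> forall x, h x = 0.
Proof.
move=> ih cRe cIm hM h0 x.
pose ek (k : nat) : R := k.+1%:R^-1.
have ek0 k : 0 < ek k by rewrite invr_gt0 ltr0n.
pose g k (v : 'rV[R]_n) := h (ek k *: v + x).
have ig k : integrableC (lebV n) setT (g k) by exact: integrableC_affine_rV.
have g0 k xi : fourier (g k) xi = 0.
  pose H (y : 'rV[R]_n) := h y * expi (dot ((ek k)^-1 *: (y - x)) xi).
  have iH : integrableC (lebV n) setT H.
    apply: (integrableC_bounded (c := 1)) => //; last by move=> v; rewrite normc_expiE.
    apply: measurable_expi_dot => //.
    rewrite (_ : (fun y => _) = fun y : 'rV[R]_n => (ek k)^-1 *: y + (- ((ek k)^-1 *: x))).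
      exact: measurable_affine_rV.
    by apply/funext => y; rewrite scalerBr.
  have := integralC_affine_rV x (ek0 k) iH.
  have -> : (fun v => H (ek k *: v + x)) = fun v => g k v * expi (dot v xi).
    by apply/funext => v; rewrite /H addrK scalerA mulVf ?scale1r// gt_eqF.
  rewrite -fourierE => E.
  have : integralC (lebV n) setT H = expi (- (ek k)^-1 * dot x xi) *
     fourier h ((ek k)^-1 *: xi).
    rewrite fourierE -integralCZ; last first.
      apply: (integrableC_bounded (c := 1)) => //; last by move=> v; rewrite normc_expiE.
      exact: measurable_expi_dot.
    apply: eq_integralC => y; rewrite /H mulrCA -expiD; congr (_ * expi _).
    by rewrite dotZl dotZr dotDl dotNl; ring.
  rewrite h0 mulr0 E => /eqP; rewrite mulf_eq0 => /orP[|/eqP//].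
  by rewrite eq_complex/= eqxx andbT expf_eq0 gt_eqF ?ek0// andbF.
have avg k := fejer_average (ig k) (g0 k).
have iW := integrable_fejerV n.
have W0 (v : 'rV[R]_n) : 0 <= fejerV v by apply: prodr_ge0 => i _; exact: fejer_ge0.
have mW : measurable_fun setT (@fejerV n) by apply/measurable_EFinP; exact: measurable_int iW.
have limit (q : 'rV[R]_n -> R) : continuous q -> (forall y, `|q y| <= M) ->
    (forall k, (\int[lebV n]_v (q (ek k *: v + x) * fejerV v) = 0)%R) -> q x = 0.
  move=> cq qM q0.
  have mq := measurable_continuous_rV cq.
  pose fk k (v : 'rV[R]_n) : \bar R := (q (ek k *: v + x) * fejerV v)%:E.
  have mk k : measurable_fun setT (fun v : 'rV[R]_n => q (ek k *: v + x) * fejerV v).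
    apply: measurable_funM => //; apply: (measurableT_comp mq).
    exact: measurable_affine_rV.
  have iB : (lebV n).-integrable setT (fun v => (M * fejerV v)%:E).
    by under eq_fun do rewrite EFinM; exact: integrableZl.
  have bk k (v : 'rV[R]_n) : `|q (ek k *: v + x) * fejerV v| <= M * fejerV v.
    by rewrite normrM (ger0_norm (W0 v)) ler_wpM2r.
  have ik k : (lebV n).-integrable setT (fk k).
    exact: (integrable_le _ iB).
  have [|||||_ _] := @dominated_convergence _ _ R (lebV n) setT measurableT fk
      (fun v => (q x * fejerV v)%:E) (fun v => (M * fejerV v)%:E).
  - by move=> k; exact/measurable_EFinP.
  - by apply/measurable_EFinP; exact: measurable_funM.
  - apply: aeW => v _; apply: cvg_EFin; first by apply: nearW.
    apply: cvgM; last exact: cvg_cst.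
    apply: (@continuous_cvg _ _ _ _ _ (fun k => ek k *: v + x) q); first exact: cq.
    rewrite -[X in _ --> X]add0r; apply: cvgD; last exact: cvg_cst.
    rewrite -(scale0r v); apply: cvgZr_tmp; exact: cvg_harmonic.
  - exact: iB.
  - by apply: aeW => v k _; rewrite lee_fin.
  have -> : [sequence (\int[lebV n]_v fk k v)%E]_k = cst 0%E.
    apply/funext => k /=; have := q0 k; rewrite /Rintegral.
    move/(congr1 (fun r : R => r%:E)); rewrite fineK//.
    exact: integrable_fin_num (ik k).
  move=> lim0; have E : (\int[lebV n]_v (q x * fejerV v)%:E = 0)%E.
    by rewrite -(cvg_lim _ lim0)// lim_cst.
  have : (\int[lebV n]_v (q x * fejerV v) = 0)%R by rewrite /Rintegral E.
  rewrite RintegralZl// => /eqP; rewrite mulf_eq0 => /orP[/eqP//|].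
  by rewrite gt_eqF// integral_fejerV_gt0.
apply/eqP; rewrite eq_complex/=; apply/andP; split; apply/eqP.
- apply: (limit (fun y => complex.Re (h y))) => // [y|k].
    exact: le_trans (Re_le_normc _) (hM y).
  have := congr1 (@complex.Re R) (avg k); rewrite /= => E; rewrite -[RHS]E.
  by congr fine; congr integral; apply/funext => v; rewrite cReM cReJ/= mulr0 subr0.
- apply: (limit (fun y => complex.Im (h y))) => // [y|k].
    exact: le_trans (Im_le_normc _) (hM y).
  have := congr1 (fun z => - complex.Im z) (avg k); rewrite /= oppr0 => E; rewrite -[RHS]E.
  have i1 := integrableC_bounded (ig k).
  rewrite -mulN1r -RintegralZl//.
    congr fine; congr integral; apply/funext => v.
    by rewrite cImM cImJ/= mulr0 add0r mulN1r mulNr opprK.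
  have [c _ hc] := fejer_bound.
  have : integrableC (lebV n) setT (fun v => (g k v)^* * (fejerV v)%:C).
    apply: (@integrableC_le _ _ R (lebV n) _ (fun v => M * fejerV v)).
    - apply: measurableCM; last exact: measurableC_real.
      by apply: measurableCJ; exact: integrableC_measurable (ig k).
    - by under eq_fun do rewrite EFinM; exact: integrableZl.
    - move=> v; rewrite normcM normc_conj normc_real (ger0_norm (W0 v)).
      by apply: ler_wpM2r; [exact: W0|exact: hM].
  by case.
Qed.

End fejer.

(** * Taylor expansion with the coordinates in order *)

Section taylor_line.
Context {R : realType}.

Lemma is_derive_expn n (s : R) :
  is_derive s (1 : R) (fun s => s ^+ n) (n%:R * s ^+ n.-1).
Proof.
have h : is_derive s (1 : R) ((id : R -> R) ^+ n) ((n%:R * s ^+ n.-1) *: 1).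
  exact: is_deriveX.
have E : ((id : R -> R) ^+ n) = (fun s => s ^+ n).
  by apply/funext => u; rewrite exprfctE.
by rewrite E in h; apply: (is_derive_eq h); rewrite /GRing.scale/= mulr1.
Qed.

(** By the mean value theorem z minus the primitive of its bound decreases. *)
Lemma growth_bound (z dz : R -> R) (B t : R) N : 0 <= t ->
  (forall s : R, is_derive s (1:R) z (dz s)) -> z 0 = 0 ->
  (forall s, 0 <= s <= t -> dz s <= B * (s ^+ N / N`!%:R)) ->
  z t <= B * (t ^+ N.+1 / N.+1`!%:R).
Proof.
rewrite le_eqVlt => /predU1P[<-|t0] dzz z0 dzB.
  by rewrite z0 expr0n mul0r mulr0.
pose w s := z s - B * (s ^+ N.+1 / N.+1`!%:R).
pose dw s := dz s - B * (s ^+ N / N`!%:R).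
have fN : (N.+1`!%:R : R) != 0 by rewrite pnatr_eq0 -lt0n fact_gt0.
have fN' : (N`!%:R : R) != 0 by rewrite pnatr_eq0 -lt0n fact_gt0.
have dww (s : R) : is_derive s (1:R) w (dw s).
  have dX : is_derive s (1:R) (fun s => s ^+ N.+1) (N.+1%:R * s ^+ N).
    exact: is_derive_expn.
  have dY : is_derive s (1:R) (fun s => (B / N.+1`!%:R) *: s ^+ N.+1)
      ((B / N.+1`!%:R) *: (N.+1%:R * s ^+ N)) by exact: is_deriveZ.
  have dZ : is_derive s (1:R) (fun s => z s - (B / N.+1`!%:R) *: s ^+ N.+1)
     (dz s - (B / N.+1`!%:R) *: (N.+1%:R * s ^+ N)) by exact: is_deriveB.
  rewrite (_ : w = fun s => z s - (B / N.+1`!%:R) *: s ^+ N.+1); last first.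
    by apply/funext => u; rewrite /w /GRing.scale/=; ring.
  apply: (is_derive_eq dZ); rewrite /dw /GRing.scale/= factS natrM; field.
  by rewrite fN'/= nat1r pnatr_eq0.
have cw : {within `[0, t], continuous w}.
  apply: continuous_subspaceT => s; apply: differentiable_continuous.
  by apply/derivable1_diffP; exact: ex_derive.
have [c] := @MVT R w dw 0 t t0 (fun s _ => dww s) cw.
rewrite in_itv/= => /andP[c0 ct] E.
have w0 : w 0 = 0 by rewrite /w z0 expr0n mul0r mulr0 subrr.
rewrite -subr_le0 -/(w t) -[w t]subr0 -[X in _ - X]w0 E subr0.
by rewrite pmulr_lle0// subr_le0 dzB// !ltW.
Qed.

Lemma taylor_line_pos N (y : nat -> R -> R) (t B : R) : 0 <= t ->
  (forall j (s : R), is_derive s (1:R) (y j) (y j.+1 s)) ->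
  (forall s, 0 <= s <= t -> `|y N s| <= B) ->
  `|y 0%N t - \sum_(j < N) t ^+ j / j`!%:R * y j 0| <= B * (t ^+ N / N`!%:R).
Proof.
elim: N y t => [|N IH] y t t0 dy yB.
  by rewrite big_ord0 subr0 expr0 fact0 divr1 mulr1 yB// lexx t0.
pose z s := y 0%N s - \sum_(j < N.+1) s ^+ j / j`!%:R * y j 0.
pose dz s := y 1%N s - \sum_(j < N) s ^+ j / j`!%:R * y j.+1 0.
have z0 : z 0 = 0.
  rewrite /z big_ord_recl expr0 fact0 divr1 mul1r big1 ?addr0 ?subrr// => i _.
  by rewrite expr0n !mul0r.
have dS (s : R) : is_derive s (1:R) (fun s => \sum_(j < N.+1) s ^+ j / j`!%:R * y j 0)
    (\sum_(j < N) s ^+ j / j`!%:R * y j.+1 0).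
  have -> : (fun s => \sum_(j < N.+1) s ^+ j / j`!%:R * y j 0) =
      \sum_(j < N.+1) (fun s => (y j 0 / j`!%:R) *: s ^+ j).
    apply/funext => u; rewrite fct_sumE; apply: eq_bigr => j _.
    by rewrite /GRing.scale/=; ring.
  have -> : \sum_(j < N) s ^+ j / j`!%:R * y j.+1 0 =
      \sum_(j < N.+1) (y j 0 / j`!%:R) *: (j%:R * s ^+ j.-1).
    rewrite big_ord_recl mul0r scaler0 add0r; apply: eq_bigr => j _.
    rewrite !lift0 /GRing.scale/= factS natrM; field.
    by rewrite ?nat1r !pnatr_eq0 /= -?lt0n ?fact_gt0.
  apply: is_derive_sum => j; apply: is_deriveZ; exact: is_derive_expn.
have dzz (s : R) : is_derive s (1:R) z (dz s) by exact: is_deriveB.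
have bd (s : R) : 0 <= s <= t -> `|dz s| <= B * (s ^+ N / N`!%:R).
  move=> /andP[s0 st]; apply: (IH (fun j => y j.+1)) => // u /andP[u0 us].
  by apply: yB; rewrite u0 (le_trans us).
rewrite -/(z t) ler_norml; apply/andP; split; last first.
  by apply: (growth_bound t0 dzz z0) => s /bd; rewrite ler_norml => /andP[].
rewrite lerNl; apply: (@growth_bound (fun s => - z s) (fun s => - dz s)) => //.
- by rewrite z0 oppr0.
- by move=> s /bd; rewrite ler_norml lerNl => /andP[].
Qed.

(** A negative t is brought back to a positive one by reflecting the line. *)
Lemma taylor_line N (y : nat -> R -> R) (t B : R) :
  (forall j (s : R), is_derive s (1:R) (y j) (y j.+1 s)) ->
  (forall s, `|s| <= `|t| -> `|y N s| <= B) ->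
  `|y 0%N t - \sum_(j < N) t ^+ j / j`!%:R * y j 0| <= B * (`|t| ^+ N / N`!%:R).
Proof.
move=> dy yB; case: (leP 0 t) => t0.
  rewrite (ger0_norm t0); apply: taylor_line_pos => // s /andP[s0 st].
  by apply: yB; rewrite (ger0_norm s0) (ger0_norm t0).
pose u j s := (-1) ^+ j * y j (- s).
have du j (s : R) : is_derive s (1:R) (u j) (u j.+1 s).
  have dN : is_derive s (1:R) (fun s => - s : R) (-1) by exact: is_deriveNid.
  have dy' : is_derive s (1:R) (y j \o (fun s => - s)) (- y j.+1 (- s)).
    by apply: (is_derive_eq (@is_derive1_comp _ (y j) (fun s : R => - s) _ _ _ _ _));
      rewrite mulrN1.
  have := @is_deriveZ _ _ _ _ ((-1) ^+ j) _ _ _ dy'.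
  by move=> h; apply: (is_derive_eq h); rewrite /u exprS /GRing.scale/=; ring.
have := @taylor_line_pos N u (- t) B.
rewrite oppr_ge0 (ltW t0) => /(_ isT du) h.
rewrite (ltr0_norm t0); apply: le_trans (h _); last first.
  move=> s /andP[s0 st]; rewrite /u normrM normrX normrN1 expr1n mul1r.
  by apply: yB; rewrite normrN (ger0_norm s0) (ltr0_norm t0).
rewrite le_eqVlt; apply/orP; left; apply/eqP; congr `|_|.
rewrite /u expr0 mul1r opprK; congr (_ - _); apply: eq_bigr => j _.
rewrite oppr0 -[- t]mulN1r exprMn.
by rewrite [RHS](_ : _ = ((-1) ^+ j * (-1) ^+ j) * (t ^+ j / j`!%:R * y j 0));
  [rewrite -exprMn mulrNN mulr1 expr1n mul1r|ring].
Qed.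

End taylor_line.

Section iterated_derivatives.
Context {R : realType} {n : nat}.
Local Notation V := 'rV[R]_n.
Implicit Types (F : V -> R[i]) (l L : seq 'I_n) (x v : V).

Definition pderives l F : V -> R[i] := foldr pderive F l.

Lemma pderives_cat l l' F : pderives (l ++ l') F = pderives l (pderives l' F).
Proof. by rewrite /pderives foldr_cat. Qed.

Lemma pderives_nseq j i F : pderives (nseq j i) F = iter j (pderive i) F.
Proof. by elim: j => //= j ->. Qed.

Lemma smooth_pderives l F : smooth F -> smooth (pderives l F).
Proof. by move=> sF l'; have := sF (l' ++ l); rewrite foldr_cat. Qed.

Definition axis (i : 'I_n) : V := delta_mx ord0 i.

Lemma is_derive_line (f : V -> R) x v (s : R) : derivable f (x + s *: v) v ->
  is_derive s (1 : R) (fun u => f (x + u *: v)) ('D_v f (x + s *: v)).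
Proof.
move=> df.
have E : (fun h : R => h^-1 *: (((fun u => f (x + u *: v)) \o shift s) (h *: 1) -
    f (x + s *: v))) = (fun h : R => h^-1 *: ((f \o shift (x + s *: v)) (h *: v) -
    f (x + s *: v))).
  apply/funext => h /=; congr (_ *: (f _ - _)).
  by rewrite [h *: 1]mulr1 scalerDl addrCA.
by split; [rewrite /derivable E|rewrite /derive E].
Qed.

Lemma smooth_line_Re F i x (s : R) : smooth F ->
  is_derive s (1 : R) (fun u => complex.Re (F (x + u *: axis i)))
    (complex.Re (pderive i F (x + s *: axis i))).
Proof.
move=> sF; have [_ _ /(_ i (x + s *: axis i)) [d1 d2]] := sF [::].
exact: (is_derive_line d1).
Qed.

Lemma smooth_line_Im F i x (s : R) : smooth F ->
  is_derive s (1 : R) (fun u => complex.Im (F (x + u *: axis i)))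
    (complex.Im (pderive i F (x + s *: axis i))).
Proof.
move=> sF; have [_ _ /(_ i (x + s *: axis i)) [d1 d2]] := sF [::].
exact: (is_derive_line d2).
Qed.

Lemma taylor_axis F i x (t B : R) N : smooth F ->
  (forall s, `|s| <= `|t| -> normc (pderives (nseq N i) F (x + s *: axis i)) <= B) ->
  normc (F (x + t *: axis i) -
    \sum_(j < N) (t ^+ j / j`!%:R)%:C * pderives (nseq j i) F x) <=
  2 * B * (`|t| ^+ N / N`!%:R).
Proof.
move=> sF hB; rewrite -mulrA mulr_natl mulr2n.
apply: (le_trans (normc_le_ReIm _)); apply: lerD.
- have dy j (s : R) : is_derive s (1 : R)
      (fun u => complex.Re (pderives (nseq j i) F (x + u *: axis i)))
      (complex.Re (pderives (nseq j.+1 i) F (x + s *: axis i))).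
    by apply: smooth_line_Re; exact: smooth_pderives.
  have := @taylor_line R N (fun j u => complex.Re (pderives (nseq j i) F (x + u *: axis i)))
    t B dy; rewrite scale0r addr0 => h.
  have := h (fun s hs => le_trans (Re_le_normc _) (hB s hs)).
  rewrite cReD cReN /= (big_morph _ cReD (erefl (complex.Re (0 : R[i])))).
  by under [in X in _ -> X]eq_bigr do rewrite cReM /= mul0r subr0.
- have dy j (s : R) : is_derive s (1 : R)
      (fun u => complex.Im (pderives (nseq j i) F (x + u *: axis i)))
      (complex.Im (pderives (nseq j.+1 i) F (x + s *: axis i))).
    by apply: smooth_line_Im; exact: smooth_pderives.
  have := @taylor_line R N (fun j u => complex.Im (pderives (nseq j i) F (x + u *: axis i)))
    t B dy; rewrite scale0r addr0 => h.
  have := h (fun s hs => le_trans (Im_le_normc _) (hB s hs)).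
  rewrite cImD cImN /= (big_morph _ cImD (erefl (complex.Im (0 : R[i])))).
  by under [in X in _ -> X]eq_bigr do rewrite cImM /= mul0r addr0.
Qed.

(** Taylor polynomial of total degree < N in the coordinates listed in L,
    expanded one coordinate at a time. For a decreasing L the derivatives that
    occur are all taken in the order of the coordinates, the only ones that the
    Gelfand-Shilov norms control. *)
Fixpoint taylor L N F x v : R[i] :=
  if L is i :: L' then
    \sum_(j < N) (v ord0 i ^+ j / j`!%:R)%:C *
      taylor L' (N - j)%N (pderives (nseq j i) F) x v
  else if N is 0%N then 0 else F x.

Definition restr L v : V := \sum_(i <- L) v ord0 i *: axis i.

Definition lei : rel 'I_n := fun i j => (i <= j)%N.
Definition gti : rel 'I_n := fun i j => (j < i)%N.

Lemma lei_trans : transitive lei. Proof. by move=> j i k; exact: leq_trans. Qed.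
Lemma gti_trans : transitive gti. Proof. by move=> j i k ji kj; exact: ltn_trans kj ji. Qed.

Lemma restr_coord L v k : uniq L ->
  restr L v ord0 k = if k \in L then v ord0 k else 0.
Proof.
elim: L => [|i L IH] /=; first by rewrite /restr big_nil mxE.
move=> /andP[iL uL]; rewrite /restr big_cons mxE -/(restr L v) IH// !mxE eqxx/= inE.
have [->|ki] := eqVneq k i; first by rewrite (negbTE iL) addr0 mulr1.
by rewrite mulr0 add0r.
Qed.

(** The first coordinate is expanded by the formula on a line, its coefficients
    by induction; the binomial formula adds up the remainders, which turns n
    coordinates into the factor n ^ N. *)
Lemma taylor_bound L N F x v (B : R) : smooth F -> sorted gti L -> 0 <= B ->
  (forall l, sorted lei l -> {subset l <= L} -> size l = N ->
     forall z, `|z - x| <= `|v| -> normc (pderives l F z) <= B) ->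
  normc (F (x + restr L v) - taylor L N F x v) <=
    2 * B * (((size L)%:R * `|v|) ^+ N / N`!%:R).
Proof.
elim: L N F => [|i L IH] N F sF sL B0 hB.
  rewrite /restr big_nil addr0 /= mul0r; case: N hB => [|N] hB.
    rewrite subr0 expr0 fact0 divr1 mulr1.
    apply: (le_trans (hB [::] _ _ _ _ _)) => //; first by rewrite subrr normr0.
    by rewrite mulr_natl mulr2n lerDl.
  by rewrite subrr normc0 expr0n mul0r mulr0.
have iL : all (gti i) L by exact: (order_path_min gti_trans).
have sL' : sorted gti L by exact: path_sorted sL.
have uL : uniq (i :: L).
  by apply: (sorted_uniq gti_trans) => // j; rewrite /gti ltnn.
have uL' : uniq L by have /andP[] := uL.
have iNL : i \notin L by have /andP[] := uL.
set x' := x + restr L v.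
have xE : x + restr (i :: L) v = x' + v ord0 i *: axis i.
  by rewrite /restr big_cons -/(restr L v) /x' addrA addrAC.
have E1 : normc (F (x' + v ord0 i *: axis i) -
    \sum_(j < N) (v ord0 i ^+ j / j`!%:R)%:C * pderives (nseq j i) F x') <=
    2 * B * (`|v| ^+ N / N`!%:R).
  apply: le_trans (_ : _ <= 2 * B * (`|v ord0 i| ^+ N / N`!%:R)) _.
    apply: taylor_axis => // s hs; apply: hB.
    - rewrite (sorted_pairwise lei_trans); elim: N => //= N IHN.
      by rewrite IHN andbT; apply/allP => j /nseqP[-> _]; exact: leqnn.
    - by move=> j /nseqP[-> _]; rewrite inE eqxx.
    - by rewrite size_nseq.
    - rewrite /x' addrAC [x + _]addrC addrK; apply: norm_le_coord => // k.
      rewrite mxE restr_coord// !mxE eqxx/=.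
      have [->|ki] := eqVneq k i.
        by rewrite (negbTE iNL) add0r mulr1 (le_trans hs)// coord_le_norm.
      by rewrite mulr0 addr0; case: ifP => _; rewrite ?normr0// coord_le_norm.
  rewrite ler_wpM2l ?mulr_ge0// ler_wpM2r ?invr_ge0//.
  by rewrite lerXn2r ?nnegrE// coord_le_norm.
have E2 (j : 'I_N) : normc (pderives (nseq j i) F x' -
    taylor L (N - j)%N (pderives (nseq j i) F) x v) <=
    2 * B * (((size L)%:R * `|v|) ^+ (N - j) / (N - j)%N`!%:R).
  apply: IH => //; first exact: smooth_pderives.
  move=> l sl lL szl z zx; rewrite -pderives_cat; apply: hB => //.
  - rewrite (sorted_pairwise lei_trans) pairwise_cat -!(sorted_pairwise lei_trans) sl.
    rewrite andTb; apply/andP; split.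
      apply/allrelP => k k' /lL kL /nseqP[-> _].
      by apply: ltnW; move/allP : iL => /(_ _ kL).
    rewrite (sorted_pairwise lei_trans); elim: (j : nat) => //= m IHm.
    by rewrite IHm andbT; apply/allP => k /nseqP[-> _]; exact: leqnn.
  - move=> k; rewrite mem_cat => /orP[/lL kL|/nseqP[-> _]].
      by rewrite inE kL orbT.
    by rewrite inE eqxx.
  - by rewrite size_cat size_nseq szl subnK// ltnW.
rewrite xE /=.
pose S := \sum_(j < N) (v ord0 i ^+ j / j`!%:R)%:C * pderives (nseq j i) F x'.
set TT := (X in _ - X).
have -> : F (x' + v ord0 i *: axis i) - TT =
    (F (x' + v ord0 i *: axis i) - S) + (S - TT) by rewrite addrA subrK.
apply: (le_trans (le_normcD _ _)).
have E3 : normc (S - TT) <= \sum_(j < N) (`|v| ^+ j / j`!%:R) *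
    (2 * B * (((size L)%:R * `|v|) ^+ (N - j) / (N - j)%N`!%:R)).
  rewrite /S /TT -sumrB; apply: (le_trans (normc_sum _ _ _)); apply: ler_sum => j _.
  rewrite -mulrBr normcM normc_real; apply: ler_pM => //; first exact: normc_ge0.
    rewrite normrM normrX normfV (ger0_norm (ler0n _ _)).
    by rewrite ler_wpM2r ?invr_ge0// lerXn2r ?nnegrE// coord_le_norm.
apply: (le_trans (lerD E1 E3)).
have -> : \sum_(j < N) (`|v| ^+ j / j`!%:R) *
    (2 * B * (((size L)%:R * `|v|) ^+ (N - j) / (N - j)%N`!%:R)) =
  2 * B / N`!%:R * \sum_(j < N) ((size L)%:R * `|v|) ^+ (N - j) * `|v| ^+ j *+ 'C(N, j).
  rewrite mulr_sumr; apply: eq_bigr => j _.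
  have /(congr1 (fun m => m%:R : R)) := bin_fact (ltnW (ltn_ord j)).
  rewrite !natrM => E; rewrite -E -[in RHS]mulr_natr.
  have f1 : (j`!%:R : R) != 0 by rewrite pnatr_eq0 -lt0n fact_gt0.
  have f2 : ((N - j)%N`!%:R : R) != 0 by rewrite pnatr_eq0 -lt0n fact_gt0.
  have f3 : ('C(N, j)%:R : R) != 0 by rewrite pnatr_eq0 -lt0n bin_gt0 ltnW.
  by field; rewrite f1 f2 f3.
have -> : (size L).+1%:R * `|v| = (size L)%:R * `|v| + `|v|.
  by rewrite -natr1 mulrDl mul1r.
rewrite exprDn big_ord_recr /= subnn expr0 mul1r binn mulr1n.
rewrite le_eqVlt; apply/orP; left; apply/eqP; ring.
Qed.

Lemma monom_mulX v (alpha : {ffun 'I_n -> nat}) i j :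
  monom v alpha * v ord0 i ^+ j =
  monom v [ffun k => (alpha k + (k == i) * j)%N].
Proof.
rewrite /monom [RHS](eq_bigr (fun k => v ord0 k ^+ alpha k *
  v ord0 k ^+ ((k == i) * j))); last by move=> k _; rewrite ffunE exprD.
rewrite big_split /=; congr (_ * _).
rewrite (bigD1 i)//= eqxx mul1n big1 ?mulr1// => k ki.
by rewrite (negbTE ki) mul0n expr0.
Qed.

(** Q stands for a linear class of functions containing the monomials, such as
    those annihilated by a function with vanishing moments. *)
Lemma taylor_polynomial (Q : (V -> R[i]) -> Prop) :
  (forall alpha c, Q (fun v => c * (monom v alpha)%:C)) ->
  (forall P P', Q P -> Q P' -> Q (fun v => P v + P' v)) ->
  (forall c P, Q P -> Q (fun v => c * P v)) ->
  forall L N F x alpha, Q (fun v => (monom v alpha)%:C * taylor L N F x v).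
Proof.
move=> Q1 Q2 Q3; elim => [|i L IH] N F x alpha /=.
  case: N => [|N].
    rewrite (_ : (fun _ => _) = (fun v => 0 * (monom v alpha)%:C)) //.
    by apply/funext => v; rewrite mulr0 mul0r.
  rewrite (_ : (fun _ => _) = (fun v => F x * (monom v alpha)%:C)) //.
  by apply/funext => v; rewrite mulrC.
elim: (index_enum _) => [|j r IHr].
  rewrite (_ : (fun _ => _) = (fun v => 0 * (monom v alpha)%:C)) //.
  by apply/funext => v; rewrite big_nil mulr0 mul0r.
pose al' := [ffun k => (alpha k + (k == i) * j)%N].
rewrite (_ : (fun _ => _) = (fun v => (j`!%:R^-1)%:C * ((monom v al')%:C *
    taylor L (N - j)%N (pderives (nseq j i) F) x v) +
  (monom v alpha)%:C * \sum_(j <- r) (v ord0 i ^+ j / j`!%:R)%:C *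
      taylor L (N - j)%N (pderives (nseq j i) F) x v)).
  by apply: Q2 => //; apply: Q3; exact: IH.
apply/funext => v; rewrite big_cons mulrDr; congr (_ + _).
rewrite /al' -monom_mulX !rmorphM/=; ring.
Qed.

Definition axes : seq 'I_n := rev (enum 'I_n).

Lemma sorted_axes : sorted gti axes.
Proof.
rewrite /axes rev_sorted; have := iota_ltn_sorted 0 n.
by rewrite -val_enum_ord sorted_map.
Qed.

Lemma size_axes : size axes = n.
Proof. by rewrite size_rev size_enum_ord. Qed.

Lemma restr_axes v : restr axes v = v.
Proof.
apply/rowP => k; rewrite restr_coord ?mem_rev ?mem_enum//.
by rewrite rev_uniq enum_uniq.
Qed.

Lemma taylor1 L F x v : taylor L 1 F x v = F x.
Proof.
elim: L F => //= i L IH F.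
by rewrite big_ord_recl big_ord0 addr0 subn0 IH expr0 fact0 divr1 mul1r.
Qed.

Lemma mean_value F x v (B : R) : smooth F -> 0 <= B ->
  (forall i z, `|z - x| <= `|v| -> normc (pderive i F z) <= B) ->
  normc (F (x + v) - F x) <= 2 * B * (n%:R * `|v|).
Proof.
move=> sF B0 hB; have := @taylor_bound axes 1 F x v B sF sorted_axes B0.
rewrite restr_axes taylor1 size_axes expr1 /= divr1; apply.
by case=> [|i [|]]// _ _ _ z zx; exact: hB.
Qed.

End iterated_derivatives.

(** * Operations on smooth functions *)

Section smooth_operations.
Context {R : realType} {n : nat}.
Local Notation V := 'rV[R]_n.
Implicit Types (F G : V -> R[i]) (l : seq 'I_n) (x v : V).

Lemma is_derive_at0 (f : V -> R) x v (d : R) :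
  is_derive (0 : R) (1 : R) (fun u => f (x + u *: v)) d -> is_derive x v f d.
Proof.
move=> [df fd].
have E : (fun h : R => h^-1 *: (((fun u => f (x + u *: v)) \o shift 0) (h *: 1) -
    f (x + 0 *: v))) = (fun h : R => h^-1 *: ((f \o shift x) (h *: v) - f x)).
  apply/funext => h /=; congr (_ *: (f _ - f _)).
    by rewrite addr0 [h *: 1]mulr1 addrC.
  by rewrite scale0r addr0.
by split; [rewrite /derivable -E|rewrite -fd /derive -E].
Qed.

Definition has_pderive i F F' := forall x : V,
  is_derive x (axis i) (fun y => complex.Re (F y)) (complex.Re (F' x)) /\
  is_derive x (axis i) (fun y => complex.Im (F y)) (complex.Im (F' x)).

Lemma has_pderiveP i F F' : has_pderive i F F' -> pderivable i F /\ pderive i F = F'.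
Proof.
move=> h; split; first by move=> x; have [[h1 _] [h2 _]] := h x.
apply/funext => x; have [[_ h1] [_ h2]] := h x.
by apply/eqP; rewrite eq_complex/= h1 h2 !eqxx.
Qed.

Lemma smooth_has_pderive i F : smooth F -> has_pderive i F (pderive i F).
Proof.
move=> sF x; have [_ _ /(_ i x) [d1 d2]] := sF [::].
by split; exact: derivableP.
Qed.

(** Smoothness is proved by exhibiting all the iterated derivatives at once; an
    operation that commutes with the derivatives up to a factor, such as a
    linear combination or a rescaling, provides them. *)
Lemma smooth_coinduction F (T : seq 'I_n -> V -> R[i]) :
  T [::] = F -> (forall l i, has_pderive i (T l) (T (i :: l))) ->
  (forall l, continuous (fun x => complex.Re (T l x)) /\
    continuous (fun x => complex.Im (T l x))) ->
  smooth F /\ forall l, pderives l F = T l.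
Proof.
move=> T0 Td Tc.
have E l : pderives l F = T l.
  elim: l => [|i l IH]; first by rewrite T0.
  by rewrite /= -/(pderives l F) IH; exact: (has_pderiveP (Td l i)).2.
split => // l; rewrite -/(pderives l F) E; split; [exact: (Tc l).1|exact: (Tc l).2|].
by move=> i; exact: (has_pderiveP (Td l i)).1.
Qed.

Lemma smooth_continuous l F : smooth F ->
  continuous (fun x => complex.Re (pderives l F x)) /\
  continuous (fun x => complex.Im (pderives l F x)).
Proof. by move=> /(_ l) []. Qed.

Lemma continuous_comb (a b : R) (f g h : V -> R) : continuous f -> continuous g ->
  continuous h -> continuous (fun x => a * f x + b * g x + h x).
Proof.
move=> cf cg ch x.
exact: (continuousD (continuousD (continuousM (@cst_continuous V R a x) (cf x))
  (continuousM (@cst_continuous V R b x) (cg x))) (ch x)).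
Qed.

Lemma continuous_affine_scale (a r : R) v (f : V -> R) : continuous f ->
  continuous (fun x => a * f (r *: x + v)).
Proof.
move=> cf x; have ca : {for x, continuous (fun x : V => r *: x + v)}.
  have h1 : {for x, continuous (fun y : V => r *: y)} by exact: scaler_continuous.
  exact: (continuousD h1 (@cst_continuous V V v x)).
exact: (continuousM (@cst_continuous V R a x) (continuous_comp ca (cf _))).
Qed.

Lemma smooth_lin (c : R[i]) F G : smooth F -> smooth G ->
  smooth (fun x => c * F x + G x) /\
  forall l, pderives l (fun x => c * F x + G x) =
    fun x => c * pderives l F x + pderives l G x.
Proof.
move=> sF sG; apply: (@smooth_coinduction _
  (fun l x => c * pderives l F x + pderives l G x)) => // [l i x|l].
  have [f1 f2] := smooth_has_pderive i (smooth_pderives l sF) x.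
  have [g1 g2] := smooth_has_pderive i (smooth_pderives l sG) x.
  split.
    have := is_deriveD (is_deriveB (is_deriveZ (complex.Re c) f1)
      (is_deriveZ (complex.Im c) f2)) g1.
    rewrite cReD cReM; congr (is_derive _ _ _ _).
    by apply/funext => y; rewrite cReD cReM.
  have := is_deriveD (is_deriveD (is_deriveZ (complex.Re c) f2)
    (is_deriveZ (complex.Im c) f1)) g2.
  rewrite cImD cImM; congr (is_derive _ _ _ _).
  by apply/funext => y; rewrite cImD cImM.
have [f1 f2] := smooth_continuous l sF; have [g1 g2] := smooth_continuous l sG.
split.
  rewrite (_ : (fun x => _) = (fun x => complex.Re c * complex.Re (pderives l F x) +
    (- complex.Im c) * complex.Im (pderives l F x) + complex.Re (pderives l G x))).
    exact: continuous_comb.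
  by apply/funext => x; rewrite cReD cReM mulNr.
rewrite (_ : (fun x => _) = (fun x => complex.Re c * complex.Im (pderives l F x) +
  complex.Im c * complex.Re (pderives l F x) + complex.Im (pderives l G x))).
  exact: continuous_comb.
by apply/funext => x; rewrite cImD cImM.
Qed.

Lemma smooth0 : smooth (fun _ : V => 0 : R[i]) /\
  forall l, pderives l (fun _ : V => 0 : R[i]) = fun=> 0.
Proof.
apply: (@smooth_coinduction _ (fun l x => 0)) => // [l i x|l].
  by split; exact: is_derive_cst.
by split => x; exact: cst_continuous.
Qed.

Lemma smooth_atom (c r : R) v F : smooth F ->
  smooth (fun x => c%:C * (F (r *: x + v))^*) /\
  forall l, pderives l (fun x => c%:C * (F (r *: x + v))^*) =
    fun x => (c * r ^+ size l)%:C * (pderives l F (r *: x + v))^*.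
Proof.
move=> sF; apply: (@smooth_coinduction _
  (fun l x => (c * r ^+ size l)%:C * (pderives l F (r *: x + v))^*)) => [|l i x|l].
- by apply/funext => x; rewrite expr0 mulr1.
- have comp (f : V -> R) (df k : R) (k' := k * r) :
      is_derive (r *: x + v) (axis i) f df ->
      is_derive x (axis i) (fun y => k * f (r *: y + v)) (k' * df).
    move=> [d1 d2]; apply: is_derive_at0.
    have d1' : derivable f ((r *: x + v) + (0 * r) *: axis i) (axis i).
      by rewrite mul0r scale0r addr0.
    have h1 := is_derive_line d1'.
    have h2 : is_derive (0 : R) (1 : R) (fun u : R => u * r) r.
      have := is_deriveZ r (is_derive_id (0 : R) (1 : R)).
      rewrite /GRing.scale/= mulr1; congr (is_derive _ _ _ _).
      by apply/funext => u /=; rewrite /GRing.scale/= mulrC.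
    have h3 := is_deriveZ k (@is_derive1_comp R
      (fun u => f (r *: x + v + u *: axis i)) (fun u => u * r) 0 _ _ h1 h2).
    move: h3; rewrite mul0r scale0r addr0 d2; congr (is_derive _ _ _ _).
      apply/funext => u /=; congr (_ * f _).
      by rewrite scalerDr addrAC scalerA [u * r]mulrC.
    by rewrite /GRing.scale/= /k'; ring.
  have [f1 f2] := smooth_has_pderive i (smooth_pderives l sF) (r *: x + v).
  split.
    have := comp _ _ (c * r ^+ size l) f1; congr (is_derive _ _ _ _).
      by apply/funext => y; rewrite cReM cReJ /= mul0r subr0.
    by rewrite cReM cReJ /= mul0r subr0 exprSr mulrA.
  have := comp _ _ (- (c * r ^+ size l)) f2; congr (is_derive _ _ _ _).
    by apply/funext => y; rewrite cImM cImJ /= mul0r addr0 mulNr mulrN.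
  by rewrite cImM cImJ /= mul0r addr0 exprSr mulrA !mulNr mulrN.
- have [f1 f2] := smooth_continuous l sF.
  split.
    rewrite (_ : (fun x => _) = (fun x => (c * r ^+ size l) *
      complex.Re (pderives l F (r *: x + v)))); last first.
      by apply/funext => x; rewrite cReM cReJ /= mul0r subr0.
    exact: (continuous_affine_scale (f := fun x => complex.Re (pderives l F x))).
  rewrite (_ : (fun x => _) = (fun x => (- (c * r ^+ size l)) *
    complex.Im (pderives l F (r *: x + v)))); last first.
    by apply/funext => x; rewrite cImM cImJ /= mul0r addr0 mulNr mulrN.
  exact: (continuous_affine_scale (f := fun x => complex.Im (pderives l F x))).
Qed.

End smooth_operations.

(** * Powers of factorials *)

Section factorial_powers.
Context {R : realType}.
Implicit Types (s t : R) (a b m : nat).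

Definition fpow m s : R := (m`!)%:R `^ s.

Lemma fact_ge1 m : (1 : R) <= (m`!)%:R.
Proof. by rewrite ler1n fact_gt0. Qed.

Lemma fpow_gt0 m s : 0 < fpow m s.
Proof. by rewrite powR_gt0// (lt_le_trans _ (fact_ge1 m)). Qed.

Lemma fpow_ge0 m s : 0 <= fpow m s. Proof. exact/ltW/fpow_gt0. Qed.

Lemma fpow0 s : fpow 0 s = 1. Proof. by rewrite /fpow fact0 powR1. Qed.

Lemma fpowD m s t : fpow m (s + t) = fpow m s * fpow m t.
Proof.
have f0 : (m`!%:R : R) != 0 by rewrite gt_eqF// (lt_le_trans _ (fact_ge1 m)).
by rewrite /fpow powRD// f0 implybT.
Qed.

Lemma fpow1 m : fpow m 1 = (m`!)%:R.
Proof. by rewrite /fpow powRr1// ler0n. Qed.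

Lemma fpow_monoR m s t : s <= t -> fpow m s <= fpow m t.
Proof. by move=> st; rewrite ler_powR// fact_ge1. Qed.

Lemma fpow_ge1 m s : 0 <= s -> 1 <= fpow m s.
Proof.
by move=> s0; rewrite (le_trans _ (fpow_monoR m s0))// /fpow powRr0.
Qed.

Lemma fact_leD a b : ((a + b)`! <= 2 ^ (a + b) * (a`! * b`!))%N.
Proof.
rewrite -(bin_fact (leq_addr b a)) addKn leq_mul2r; apply/orP; right.
rewrite (_ : 2 = 1 + 1)%N// expnDn.
rewrite (bigD1 (inord a : 'I_(a + b).+1))//= inordK ?ltnS ?leq_addr//.
by rewrite !exp1n !muln1 leq_addr.
Qed.

Lemma fpow_leD a b s : 0 <= s ->
  fpow (a + b) s <= (2 `^ s) ^+ (a + b) * (fpow a s * fpow b s).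
Proof.
move=> s0; rewrite /fpow -powRM ?ler0n// -powR_mulrn ?powR_ge0//.
rewrite -powRrM [s * _]mulrC powRrM powR_mulrn// -powRM ?mulr_ge0 ?exprn_ge0//.
apply: ge0_ler_powR => //; rewrite ?nnegrE ?mulr_ge0 ?exprn_ge0//.
by rewrite -!natrM -natrX -natrM ler_nat fact_leD.
Qed.

Lemma fact_geM a b : (a`! * b`! <= (a + b)`!)%N.
Proof.
rewrite -(bin_fact (leq_addr b a)) addKn.
by rewrite leq_pmull// bin_gt0 leq_addr.
Qed.

Lemma two_powR_ge1 s : 0 <= s -> 1 <= 2 `^ s :> R.
Proof. by move=> s0; rewrite -[leLHS](powRr0 2) ler_powR// ler1n. Qed.

End factorial_powers.

(** * Gelfand-Shilov estimates with total degrees *)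

Section ordered_derivatives.
Context {R : realType} {n : nat}.
Local Notation V := 'rV[R]_n.
Local Notation midx := {ffun 'I_n -> nat}.
Implicit Types (F : V -> R[i]) (l : seq 'I_n) (alpha beta : midx).

(** The order in which mderive takes its derivatives. *)
Definition midx_list beta : seq 'I_n := flatten [seq nseq (beta i) i | i <- enum 'I_n].

Lemma mderiveE beta F : mderive beta F = pderives (midx_list beta) F.
Proof.
rewrite /mderive /midx_list; elim: (enum 'I_n) => //= i r ->.
by rewrite pderives_cat pderives_nseq.
Qed.

Lemma size_midx_list beta : size (midx_list beta) = mdeg beta.
Proof.
rewrite /midx_list size_flatten /shape -map_comp sumnE big_map.
rewrite /mdeg -[in RHS]big_enum /=; apply: eq_bigr => i _.
by rewrite /= size_nseq.
Qed.

Lemma sorted_enum_lei : sorted lei (enum 'I_n).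
Proof.
have := iota_sorted 0 n; rewrite -val_enum_ord sorted_map.
by apply: sub_sorted => i j.
Qed.

Lemma sorted_midx_list beta : sorted lei (midx_list beta).
Proof.
have := sorted_enum_lei; rewrite /midx_list !(sorted_pairwise (@lei_trans n)).
elim: (enum 'I_n) => //= i r IH /andP[ir pr]; rewrite pairwise_cat IH// andbT.
apply/andP; split.
  apply/allrelP => j k /nseqP[-> _] /flattenP[_ /mapP[k' k'r ->] /nseqP[-> _]].
  by move/allP : ir => /(_ _ k'r).
elim: (beta i) => //= m IHm.
by rewrite IHm andbT; apply/allP => k /nseqP[-> _]; exact: leqnn.
Qed.

Lemma midx_list_count l : sorted lei l ->
  midx_list [ffun i => count_mem i l] = l.
Proof.
move=> sl; apply: (@sorted_eq _ lei) => //.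
- exact: lei_trans.
- by move=> i j ij; apply/val_inj/anti_leq.
- exact: sorted_midx_list.
apply/allP => k _ /=; apply/eqP; rewrite /midx_list count_flatten -map_comp.
rewrite sumnE big_map (bigD1_seq k) ?mem_enum ?enum_uniq//= big1_seq => [|j /andP[jk _]].
  by rewrite count_nseq/= eqxx mul1n addn0 ffunE.
by rewrite count_nseq/= (negbTE jk).
Qed.

Lemma mfact_le alpha : (mfact alpha <= (mdeg alpha)`!)%N.
Proof.
rewrite /mfact /mdeg; elim/big_rec2 : _ => // i a b _ ab.
by apply: leq_trans (fact_geM _ _); rewrite leq_mul2l ab orbT.
Qed.

Lemma mfact_ge alpha : ((mdeg alpha)`! <= (2 ^ n) ^ mdeg alpha * mfact alpha)%N.
Proof.
rewrite /mfact /mdeg.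
have -> : (2 ^ n = 2 ^ size (index_enum 'I_n))%N.
  by congr (_ ^ _)%N; rewrite -[LHS]card_ord cardE enumT.
elim: (index_enum _) => [|i r IH]; first by rewrite !big_nil.
rewrite !big_cons; set m := (\sum_(j <- r) alpha j)%N in IH *.
apply: leq_trans (fact_leD _ _) _.
apply: (@leq_trans (2 ^ (alpha i + m) * ((alpha i)`! *
   ((2 ^ size r) ^ m * \prod_(j <- r) (alpha j)`!)))).
  by rewrite leq_mul2l leq_mul2l IH !orbT.
rewrite /= expnS expnMn -[leqRHS]mulnA leq_mul2l; apply/orP; right.
rewrite [leqLHS]mulnCA leq_mul2r; apply/orP; right.
by rewrite expnD leq_pmull// expn_gt0 expn_gt0.
Qed.

Lemma normc_monom (x : V) alpha : normc (monom x alpha)%:C <= `|x| ^+ mdeg alpha.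
Proof.
rewrite normc_real /monom normr_prod /mdeg -prodrXr; apply: ler_prod => i _.
by rewrite normr_ge0/= normrX lerXn2r ?nnegrE// coord_le_norm.
Qed.

End ordered_derivatives.

Section gelfand_shilov_bounds.
Context {R : realType} {n : nat}.
Local Notation V := 'rV[R]_n.
Local Notation midx := {ffun 'I_n -> nat}.
Implicit Types (F G : V -> R[i]) (l : seq 'I_n) (s t K C D h : R) (c : R[i]).

(** The Gelfand-Shilov estimates with the sup norm and total degrees in place of
    multi-indices; this only changes the radius h by a constant factor. *)
Definition gs_bound s t K C F := forall A l (x : V), sorted lei l ->
  `|x| ^+ A * normc (pderives l F x) <=
  C * K ^+ (A + size l) * (fpow A t * fpow (size l) s).

Lemma gs_bound_mono s t K K' C C' F : 0 <= K <= K' -> 0 <= C <= C' ->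
  gs_bound s t K C F -> gs_bound s t K' C' F.
Proof.
move=> /andP[K0 KK'] /andP[C0 CC'] FB A l x sl; apply: le_trans (FB A l x sl) _.
rewrite ler_wpM2r ?mulr_ge0 ?fpow_ge0// ler_pM ?exprn_ge0//.
by rewrite lerXn2r ?nnegrE// (le_trans K0).
Qed.

(** For x with largest coordinate of index i, the monomial x_i ^ A realizes
    |x| ^ A. *)
Lemma gs_bound_of_norm s t h F : (0 < n)%N -> 0 <= s -> 0 < h ->
  (gs_norm s t h F < +oo)%E ->
  exists K C, [/\ 1 <= K, 0 <= C & gs_bound s t K C F].
Proof.
move=> n0 s0 h0 Foo.
have ub x (alpha beta : midx) : ((h ^+ (mdeg alpha + mdeg beta) /
         ((mfact alpha)%:R `^ t * (mfact beta)%:R `^ s) *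
         normc ((monom x alpha)%:C * mderive beta F x))%:E <= gs_norm s t h F)%E.
  by apply: ereal_sup_ubound; exists x, alpha, beta.
have [M M0 hM] : exists2 M : R, 0 <= M & (gs_norm s t h F <= M%:E)%E.
  have := ub 0 [ffun=> 0%N] [ffun=> 0%N].
  move: Foo; case: (gs_norm s t h F) => [r _ hr|//|].
    by exists `|r| => //; rewrite lee_fin ler_norm.
  by move=> _; rewrite leeNy_eq.
exists (Num.max 1 h^-1), M; split => //; first by rewrite le_max lexx.
move=> A l x sl.
have [i xi] := norm_coordP x n0.
pose alpha : midx := [ffun k => if k == i then A else 0%N].
pose beta : midx := [ffun k => count_mem k l].
have dA : mdeg alpha = A.
  rewrite /mdeg (bigD1 i)//= ffunE eqxx big1 ?addn0// => k ki.
  by rewrite ffunE (negbTE ki).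
have fA : mfact alpha = A`!.
  rewrite /mfact (bigD1 i)//= ffunE eqxx big1 ?muln1// => k ki.
  by rewrite ffunE (negbTE ki).
have mA : normc (monom x alpha)%:C = `|x| ^+ A.
  rewrite normc_real /monom (bigD1 i)//= ffunE eqxx big1 ?mulr1.
    by rewrite normrX xi.
  by move=> k ki; rewrite ffunE (negbTE ki) expr0.
have dB : mdeg beta = size l by rewrite -size_midx_list midx_list_count.
have := le_trans (ub x alpha beta) hM.
rewrite lee_fin dA dB fA mderiveE midx_list_count// normcM mA.
have bB : ((mfact beta)%:R : R) `^ s <= fpow (size l) s.
  apply: ge0_ler_powR => //; rewrite ?nnegrE ?ler0n// ler_nat -dB.
  exact: mfact_le.
have bB0 : 0 < ((mfact beta)%:R : R) `^ s.
  by rewrite powR_gt0// ltr0n /mfact prodn_gt0// => k; exact: fact_gt0.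
set D := `|x| ^+ A * _; rewrite -/(fpow A t) => hD.
have hN0 : 0 < h ^+ (A + size l) by rewrite exprn_gt0.
have P0 : 0 < fpow A t * (mfact beta)%:R `^ s by rewrite mulr_gt0// fpow_gt0.
move: hD; rewrite mulrAC ler_pdivrMr// -ler_pdivlMl// => hD.
apply: le_trans hD _; rewrite [leLHS]mulrCA -[leRHS]mulrA.
apply: ler_wpM2l => //; apply: ler_pM.
- by rewrite invr_ge0 ltW.
- by rewrite ltW.
- by rewrite -exprVn lerXn2r ?nnegrE ?invr_ge0 ?(ltW h0)// ?le_max ?lexx ?orbT// ler01.
- by rewrite ler_pM2l ?fpow_gt0.
Qed.

(** The loss of radius when passing from total degrees to multi-indices. *)
Definition gs_loss s t : R := (2 ^+ n) `^ t * (2 ^+ n) `^ s.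

Lemma gs_loss_ge1 s t : 0 <= s -> 0 <= t -> 1 <= gs_loss s t.
Proof.
have h u : 0 <= u -> 1 <= (2 ^+ n : R) `^ u.
  by move=> u0; rewrite -[leLHS](powRr0 (2 ^+ n)) ler_powR// exprn_ege1// ler1n.
by move=> s0 t0; rewrite -[leLHS]mulr1 ler_pM// h.
Qed.

Lemma gs_norm_le s t K C h F : 0 <= s -> 0 <= t -> 0 < K -> 0 <= C -> 0 < h ->
  h * (K * gs_loss s t) <= 1 -> gs_bound s t K C F -> (gs_norm s t h F <= C%:E)%E.
Proof.
move=> s0 t0 K0 C0 h0 hK FB; apply: ge_ereal_sup => _ [x [alpha [beta ->]]].
rewrite lee_fin mderiveE normcM.
set A := mdeg alpha; set N := mdeg beta; set l := midx_list beta.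
have sN : size l = N by exact: size_midx_list.
have bd := FB A l x (sorted_midx_list beta); rewrite sN in bd.
have frac (gamma : midx) (u : R) : 0 <= u ->
    fpow (mdeg gamma) u <= ((2 ^+ n) `^ u) ^+ mdeg gamma * ((mfact gamma)%:R `^ u).
  move=> u0; rewrite -powR_mulrn ?powR_ge0// -powRrM [u * _]mulrC powRrM powR_mulrn ?exprn_ge0//.
  rewrite -powRM ?exprn_ge0//; apply: ge0_ler_powR => //.
  - by rewrite nnegrE ler0n.
  - by rewrite nnegrE mulr_ge0 ?exprn_ge0.
  - by rewrite -!natrX -natrM ler_nat mfact_ge.
have f0 (gamma : midx) u : 0 < ((mfact gamma)%:R : R) `^ u.
  by rewrite powR_gt0// ltr0n /mfact prodn_gt0// => k; exact: fact_gt0.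
rewrite mulrAC ler_pdivrMr ?mulr_gt0//.
apply: (@le_trans _ _ (h ^+ (A + N) * (C * K ^+ (A + N) * (fpow A t * fpow N s)))).
  rewrite ler_wpM2l ?exprn_ge0 ?(ltW h0)//; apply: le_trans bd.
  by rewrite ler_wpM2r ?normc_ge0// normc_monom.
have g1 (u : R) : 0 <= u -> 1 <= (2 ^+ n : R) `^ u.
  by move=> u0; rewrite -[leLHS](powRr0 (2 ^+ n)) ler_powR// exprn_ege1// ler1n.
have hl : ((2 ^+ n : R) `^ t) ^+ A * ((2 ^+ n) `^ s) ^+ N <= gs_loss s t ^+ (A + N).
  rewrite /gs_loss exprMn; apply: ler_pM; rewrite ?exprn_ge0 ?powR_ge0//.
    by rewrite ler_weXn2l// ?g1// leq_addr.
  by rewrite ler_weXn2l// ?g1// leq_addl.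
have fA := frac alpha t t0; have fN := frac beta s s0.
set a := (mfact alpha)%:R `^ t in fA *; set b := (mfact beta)%:R `^ s in fN *.
have a0 : 0 < a by exact: f0.
have b0 : 0 < b by exact: f0.
apply: (@le_trans _ _ (h ^+ (A + N) * (C * K ^+ (A + N) *
    (gs_loss s t ^+ (A + N) * (a * b))))).
  rewrite ler_wpM2l ?exprn_ge0 ?(ltW h0)// ler_wpM2l ?mulr_ge0 ?exprn_ge0 ?(ltW K0)//.
  apply: (le_trans (ler_pM (fpow_ge0 _ _) (fpow_ge0 _ _) fA fN)).
  by rewrite mulrACA ler_wpM2r// ltW// mulr_gt0.
rewrite [leLHS](_ : _ = (h * (K * gs_loss s t)) ^+ (A + N) * (C * (a * b))); last first.
  by rewrite !exprMn; ring.
rewrite ler_piMl ?mulr_ge0 ?(ltW a0) ?(ltW b0)//.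
rewrite exprn_ile1// mulr_ge0 ?(ltW h0)// mulr_ge0 ?(ltW K0)//.
by rewrite (le_trans ler01)// gs_loss_ge1.
Qed.

Lemma gs_bound_lin s t K C D F G c : smooth F -> smooth G ->
  gs_bound s t K C F -> gs_bound s t K D G ->
  gs_bound s t K (normc c * C + D) (fun x => c * F x + G x).
Proof.
move=> sF sG FB GB A l x sl; rewrite (smooth_lin c sF sG).2.
rewrite [leRHS](_ : _ = normc c * (C * K ^+ (A + size l) * (fpow A t * fpow (size l) s))
  + D * K ^+ (A + size l) * (fpow A t * fpow (size l) s)); last by ring.
apply: (@le_trans _ _ (normc c * (`|x| ^+ A * normc (pderives l F x)) +
  `|x| ^+ A * normc (pderives l G x))).
  rewrite mulrCA -mulrDr ler_wpM2l ?exprn_ge0//.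
  by apply: le_trans (le_normcD _ _) _; rewrite normcM.
by apply: lerD; [rewrite ler_wpM2l ?normc_ge0 ?FB|exact: GB].
Qed.

Lemma gs_bound0 s t K : 0 <= K -> gs_bound s t K 0 (fun=> 0).
Proof.
by move=> K0 A l x sl; rewrite (@smooth0 R n).2 normc0 mulr0 !mul0r.
Qed.

(** As (N + p)! <= 2 ^ (N + p) * N! * p!, a shift of the degree costs a constant
    and a larger radius. *)
Lemma degree_shift u K p : 0 <= u -> 1 <= K ->
  exists K' M : R, [/\ K <= K', 0 <= M & forall D r X : R, 0 <= D ->
    (forall N, r ^+ N * X <= D * K ^+ N * fpow N u) ->
    forall N, r ^+ (N + p) * X <= M * D * K' ^+ N * fpow N u].
Proof.
move=> u0 K1; have K0 : 0 <= K by exact: le_trans ler01 K1.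
have T1 := two_powR_ge1 u0; set T : R := 2 `^ u in T1 *.
have T0 : 0 <= T by exact: le_trans ler01 T1.
exists (K * T), ((K * T) ^+ p * fpow p u); split.
- by rewrite ler_peMr.
- by rewrite mulr_ge0 ?fpow_ge0// exprn_ge0// mulr_ge0.
move=> D r X D0 rX N; apply: le_trans (rX (N + p)%N) _.
apply: (@le_trans _ _ (D * K ^+ (N + p) * (T ^+ (N + p) * (fpow N u * fpow p u)))).
  by rewrite ler_wpM2l ?mulr_ge0 ?exprn_ge0// fpow_leD.
by rewrite le_eqVlt; apply/orP; left; apply/eqP; rewrite !exprMn !exprD; ring.
Qed.

(** A quantity decaying faster than all powers of x, with Gelfand-Shilov
    constants, is dominated by the integrable weight decay x: raise the degree
    by 2n. *)
Lemma decay_absorb u K : 0 <= u -> 1 <= K ->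
  exists K' M : R, [/\ K <= K', 0 <= M & forall (D X : R) (x : V), 0 <= D -> 0 <= X ->
    (forall A, `|x| ^+ A * X <= D * K ^+ A * fpow A u) ->
    forall A, `|x| ^+ A * X <= M * D * K' ^+ A * fpow A u * decay x].
Proof.
move=> u0 K1; have K0 : 0 <= K by exact: le_trans ler01 K1.
have [K' [M [KK' M0 hM]]] := @degree_shift u K (2 * n) u0 K1.
exists K', (2 ^+ n * (1 + M)); split => //; first by rewrite mulr_ge0 ?exprn_ge0 ?addr_ge0.
move=> D X x D0 X0 xX A.
apply: (@le_trans _ _ (`|x| ^+ A * X * (2 ^+ n * (1 + `|x| ^+ (2 * n)) * decay x))).
  by rewrite ler_peMr ?mulr_ge0 ?exprn_ge0// decay_lower.
rewrite mulrA ler_wpM2r ?decay_ge0//.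
rewrite [leLHS](_ : _ = 2 ^+ n * (`|x| ^+ A * X + `|x| ^+ (A + 2 * n) * X)); last first.
  by rewrite exprD; ring.
rewrite -!mulrA ler_wpM2l ?exprn_ge0// mulrDl mul1r; apply: lerD.
  apply: le_trans (xX A) _; rewrite -mulrA ler_wpM2l// ler_wpM2r ?fpow_ge0//.
  by rewrite lerXn2r ?nnegrE// (le_trans K0).
by rewrite !mulrA; exact: hM.
Qed.

Lemma gs_bound_decay s t K : 0 <= s -> 0 <= t -> 1 <= K ->
  exists K' M, [/\ K <= K', 0 <= M & forall C F, 0 <= C -> gs_bound s t K C F ->
    forall A l (x : V), sorted lei l -> `|x| ^+ A * normc (pderives l F x) <=
      M * C * K' ^+ (A + size l) * (fpow A t * fpow (size l) s) * decay x].
Proof.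
move=> s0 t0 K1; have K0 : 0 <= K by exact: le_trans ler01 K1.
have [K' [M [KK' M0 hM]]] := @decay_absorb t K t0 K1.
exists K', M; split => // C F C0 FB A l x sl.
set N := size l.
have D0 : 0 <= C * K ^+ N * fpow N s by rewrite !mulr_ge0 ?exprn_ge0 ?fpow_ge0.
apply: le_trans (hM _ _ x D0 (normc_ge0 _) _ A) _ => [B|].
  apply: le_trans (FB B l x sl) _; rewrite -/N.
  by rewrite le_eqVlt; apply/orP; left; apply/eqP; rewrite exprD; ring.
rewrite ler_wpM2r ?decay_ge0// exprD.
rewrite [leLHS](_ : _ = M * C * (K' ^+ A * K ^+ N) * (fpow A t * fpow N s)); last by ring.
have K'0 : 0 <= K' by exact: le_trans KK'.
rewrite ler_wpM2r ?mulr_ge0 ?fpow_ge0// ler_wpM2l ?mulr_ge0//.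
by rewrite ler_wpM2l ?exprn_ge0// lerXn2r ?nnegrE.
Qed.

End gelfand_shilov_bounds.

(** * The test spaces and their functionals *)

Lemma conjcMr (R : realType) (r : R) (z : R[i]) : (r%:C * z)^* = r%:C * z^*.
Proof.
case: z => a b; apply/eqP; rewrite eq_complex /=.
by apply/andP; split; apply/eqP; ring.
Qed.

Section gs_spaces.
Context {R : realType} {n : nat}.
Hypothesis n0 : (0 < n)%N.
Local Notation V := 'rV[R]_n.
Local Notation midx := {ffun 'I_n -> nat}.
Local Notation leb := (@lebesgue_rV R n).
Implicit Types (f : (V -> R[i]) -> R[i]) (F G w P : V -> R[i]) (s t K C D h : R) (c : R[i]) (x v : V).

Definition gs0 s t F := [/\ smooth F,
  (exists K C, [/\ 1 <= K, 0 <= C & gs_bound s t K C F]) & moments_vanish F].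

Lemma gs0P s t F : 0 <= s -> 0 <= t -> gelfand_shilov0 s t F <-> gs0 s t F.
Proof.
move=> s0 t0; split.
  move=> [[[sF _] [h h0 hF]] mF]; split => //.
  exact: gs_bound_of_norm hF.
move=> [sF [K [C [K1 C0 FB]]] mF].
have K0 : 0 < K by exact: lt_le_trans ltr01 K1.
have L1 := @gs_loss_ge1 R n s t s0 t0.
have KL0 : 0 < K * @gs_loss R n s t by rewrite mulr_gt0// (lt_le_trans _ L1).
split=> //; split.
  split => // alpha beta; exists (C * K ^+ (mdeg alpha + mdeg beta) *
    (fpow (mdeg alpha) t * fpow (mdeg beta) s)) => x.
  have := FB (mdeg alpha) (midx_list beta) x (sorted_midx_list beta).
  rewrite size_midx_list -mderiveE; apply: le_trans.
  by rewrite normcM ler_wpM2r ?normc_ge0// normc_monom.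
exists ((K * @gs_loss R n s t)^-1); first by rewrite invr_gt0.
apply: (@le_lt_trans _ _ C%:E); last by rewrite ltry.
apply: gs_norm_le FB => //; first by rewrite invr_gt0.
by rewrite mulVf// gt_eqF.
Qed.

Lemma gs_bound_exponents s t s' t' K C F : s <= s' -> t <= t' -> 0 <= K -> 0 <= C ->
  gs_bound s t K C F -> gs_bound s' t' K C F.
Proof.
move=> ss tt K0 C0 FB A l x sl; apply: le_trans (FB A l x sl) _.
rewrite ler_wpM2l ?mulr_ge0 ?exprn_ge0// ler_pM ?fpow_ge0//; exact: fpow_monoR.
Qed.

Lemma gs0_mono s t s' t' F : s <= s' -> t <= t' -> gs0 s t F -> gs0 s' t' F.
Proof.
move=> ss tt [sF [K [C [K1 C0 FB]]] mF]; split => //; exists K, C; split => //.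
by apply: gs_bound_exponents FB => //; exact: le_trans ler01 K1.
Qed.

Lemma measurable_smooth F : smooth F -> measurableC F.
Proof.
by move=> sF; have [c1 c2] := smooth_continuous [::] sF;
  exact: measurableC_continuous_rV.
Qed.

Lemma measurable_monom (alpha : midx) : measurableC (fun x : V => (monom x alpha)%:C).
Proof.
rewrite (_ : (fun _ => _) = fun x : V => \prod_i (x ord0 i ^+ alpha i)%:C); last first.
  by apply/funext => x; rewrite /monom rmorph_prod.
apply: measurableC_prod => i; apply: measurableC_real; apply: measurable_funX.
exact: measurable_coord.
Qed.

Lemma gs_bound_integrable_monom s t K C F (alpha : midx) : 0 <= s -> 0 <= t ->
  1 <= K -> 0 <= C -> smooth F -> gs_bound s t K C F ->
  integrableC leb setT (fun x => (monom x alpha)%:C * F x).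
Proof.
move=> s0 t0 K1 C0 sF FB.
have [K' [M [KK' M0 hM]]] := @gs_bound_decay R n s t K s0 t0 K1.
pose c := M * C * K' ^+ (mdeg alpha + 0) * (fpow (mdeg alpha) t * fpow 0 s).
apply: (@integrableC_le _ _ R leb _ (fun x => c * decay x)).
- by apply: measurableCM; [exact: measurable_monom|exact: measurable_smooth].
- by under eq_fun do rewrite EFinM; apply: integrableZl => //; exact: integrable_decay.
- move=> x; rewrite normcM; apply: le_trans (hM C F C0 FB (mdeg alpha) [::] x isT).
  by rewrite ler_wpM2r ?normc_ge0// normc_monom.
Qed.

Definition annihilates w P := integrableC leb setT (fun u => w u * P u) /\
  integralC leb setT (fun u => w u * P u) = 0.

Lemma annihilates_ext w P P' : P =1 P' -> annihilates w P -> annihilates w P'.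
Proof. by move=> /funext ->. Qed.

Lemma annihilatesD w P P' : annihilates w P -> annihilates w P' ->
  annihilates w (fun u => P u + P' u).
Proof.
move=> [i1 z1] [i2 z2]; rewrite /annihilates.
have -> : (fun u => w u * (P u + P' u)) = fun u => w u * P u + w u * P' u.
  by apply/funext => u; rewrite mulrDr.
by split; [exact: integrableCD|rewrite integralCD// z1 z2 addr0].
Qed.

Lemma annihilatesZ w c P : annihilates w P -> annihilates w (fun u => c * P u).
Proof.
move=> [i1 z1]; rewrite /annihilates.
have -> : (fun u => w u * (c * P u)) = fun u => c * (w u * P u).
  by apply/funext => u; rewrite mulrCA.
by split; [exact: integrableCZ|rewrite integralCZ// z1 mulr0].
Qed.

Lemma gs0_annihilates_monom s t w (alpha : midx) c : 0 <= s -> 0 <= t -> gs0 s t w ->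
  annihilates w (fun u => c * (monom u alpha)%:C).
Proof.
move=> s0 t0 [sw [K [C [K1 C0 wB]]] mw]; apply: annihilatesZ.
have E : (fun u => w u * (monom u alpha)%:C) = fun u => (monom u alpha)%:C * w u.
  by apply/funext => u; rewrite mulrC.
split; rewrite E; last exact: mw.
exact: gs_bound_integrable_monom wB.
Qed.

Lemma gs0_lin s t c F G : 0 <= s -> 0 <= t -> gs0 s t F -> gs0 s t G ->
  gs0 s t (fun x => c * F x + G x).
Proof.
move=> s0 t0 gF gG; have [sF [K [C [K1 C0 FB]]] mF] := gF.
have [sG [K' [C' [K1' C0' GB]]] mG] := gG.
have K0 : 0 <= K by exact: le_trans ler01 K1.
have K0' : 0 <= K' by exact: le_trans ler01 K1'.
split; first exact: (smooth_lin c sF sG).1.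
  exists (Num.max K K'), (normc c * C + C'); split.
  - by rewrite le_max K1.
  - by rewrite addr_ge0// mulr_ge0// normc_ge0.
  - apply: gs_bound_lin => //.
      by apply: gs_bound_mono FB; rewrite ?C0 ?lexx ?K0//= le_max lexx.
    by apply: gs_bound_mono GB; rewrite ?C0' ?lexx ?K0'//= le_max lexx orbT.
move=> m.
have E : (fun x => (monom x m)%:C * (c * F x + G x)) =
    fun x => c * ((monom x m)%:C * F x) + (monom x m)%:C * G x.
  by apply/funext => x; ring.
have iF := gs_bound_integrable_monom m s0 t0 K1 C0 sF FB.
have iG := gs_bound_integrable_monom m s0 t0 K1' C0' sG GB.
rewrite E integralCD//; last exact: integrableCZ.
by rewrite integralCZ// mF mG mulr0 addr0.
Qed.

Lemma gs00 s t : gs0 s t (fun=> 0).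
Proof.
split; first exact: (@smooth0 R n).1.
  by exists 1, 0; split => //; exact: gs_bound0.
move=> m; rewrite -[RHS](integralC0 leb); apply: eq_integralC => x.
by rewrite mulr0.
Qed.

Lemma gs0Z s t c F : 0 <= s -> 0 <= t -> gs0 s t F -> gs0 s t (fun x => c * F x).
Proof.
move=> s0 t0 gF; have := gs0_lin c s0 t0 gF (gs00 s t).
by under eq_fun do rewrite addr0.
Qed.

Lemma gs0_sum s t I (r : seq I) (c : I -> R[i]) (F : I -> V -> R[i]) :
  0 <= s -> 0 <= t -> (forall i, gs0 s t (F i)) ->
  gs0 s t (fun x => \sum_(i <- r) c i * F i x).
Proof.
move=> s0 t0 gF; elim: r => [|i r IH].
  by under eq_fun do rewrite big_nil; exact: gs00.
by under eq_fun do rewrite big_cons; exact: gs0_lin.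
Qed.

Lemma gs0_conj s t F : 0 <= s -> 0 <= t -> gs0 s t F -> gs0 s t (fun x => (F x)^*).
Proof.
move=> s0 t0 [sF [K [C [K1 C0 FB]]] mF].
have E : (fun x => (F x)^*) = (fun x => 1%:C * (F (1 *: x + 0))^*).
  by apply/funext => x; rewrite scale1r addr0 mul1r.
have [sJ dJ] := smooth_atom 1 1 0 sF; rewrite -E in sJ dJ.
split => //.
  exists K, C; split => // A l x sl; rewrite dJ expr1n mulr1 normcM normc_real normr1.
  by rewrite mul1r normc_conj scale1r addr0; exact: FB.
move=> m.
have -> : (fun x => (monom x m)%:C * (F x)^*) = fun x => ((monom x m)%:C * F x)^*.
  by apply/funext => x; rewrite conjcMr.
by rewrite integralCJ ?mF ?conjc0//; exact: gs_bound_integrable_monom FB.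
Qed.

(** A neighbourhood of 0 on which f is at most 1 in modulus contains a ball of
    every step of the inductive limit; homogeneity turns this into a bound. *)
Lemma gs0_dual_bound s t f K : 0 <= s -> 0 <= t -> 0 < K -> gs0_dual s t f ->
  exists2 B : R, 0 <= B & forall F C, gs0 s t F -> 0 <= C -> gs_bound s t K C F ->
    normc (f F) <= B * C.
Proof.
move=> s0 t0 K0 [flin fcont].
have zG : gelfand_shilov0 s t (fun _ : V => 0 : R[i]) by apply/gs0P => //; exact: gs00.
have f0 : f (fun=> 0) = 0.
  have := flin _ _ 1 zG zG; under eq_fun do rewrite mulr0 addr0.
  by rewrite mul1r => /eqP; rewrite -subr_eq0 opprD addNKr oppr_eq0 => /eqP.
have fZ c F : gs0 s t F -> f (fun x => c * F x) = c * f F.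
  move=> /(gs0P F s0 t0) gF; have := flin _ _ c gF zG.
  by under eq_fun do rewrite addr0; rewrite f0 addr0.
have [U [_ Uh] hU] := fcont _ zG 1 ltr01.
have KL0 : 0 < K * @gs_loss R n s t.
  by rewrite mulr_gt0// (lt_le_trans ltr01)// gs_loss_ge1.
have [e e0 he] := Uh (K * @gs_loss R n s t)^-1 (eq_ind_r is_true KL0 (invr_gt0 _)).
have unit F C : gs0 s t F -> 0 <= C -> C < e -> gs_bound s t K C F -> normc (f F) <= 1.
  move=> gF C0 Ce FB; have /(gs0P F s0 t0) gF' := gF.
  have := hU F gF'.1; rewrite /= f0 subr0 => h; apply/ltW/h => //.
  rewrite (_ : F \- _ = F); last by apply/funext => x; rewrite /= subr0.
  apply: he; first exact: gF'.1.1.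
  apply: (@le_lt_trans _ _ C%:E); last by rewrite lte_fin.
  apply: gs_norm_le FB => //; first by rewrite invr_gt0.
  by rewrite mulVf// gt_eqF.
exists (2 / e); first by rewrite divr_ge0// ltW.
move=> F C gF C0 FB; apply/ler_addgt0Pl => d d0.
pose C' := C + d * (e / 2).
have de0 : 0 < d * (e / 2) by rewrite mulr_gt0// divr_gt0.
have C'0 : 0 < C' by rewrite /C' ltr_wpDl.
pose r := e / 2 / C'.
have r0 : 0 < r by rewrite !divr_gt0.
have := @unit (fun x => r%:C * F x) (e / 2).
rewrite fZ// normcM normc_real gtr0_norm//.
have -> : d + 2 / e * C = (2 / e) * C'.
  by rewrite /C'; field; rewrite gt_eqF.
move=> h; have : r * normc (f F) <= 1.
  apply: h.
  - exact: gs0Z.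
  - by rewrite divr_ge0// ltW.
  - by rewrite ltr_pdivrMr// ltr_pMr// ltr1n.
  - move=> A l x sl.
    have sF : smooth F by case: gF.
    have E : (fun x => r%:C * F x + 0) = (fun x => r%:C * F x).
      by apply/funext => y; rewrite addr0.
    have := gs_bound_lin r%:C sF (@smooth0 R n).1 FB (gs_bound0 s t (ltW K0)).
    rewrite normc_real gtr0_norm// addr0 E => /(_ A l x sl).
    move=> h'; apply: le_trans h' _.
    rewrite ler_wpM2r ?mulr_ge0 ?fpow_ge0// ler_wpM2r ?exprn_ge0 ?(ltW K0)//.
    rewrite /r mulrAC ler_pdivrMr// ler_wpM2l ?divr_ge0 ?(ltW e0)//.
    by rewrite /C' lerDl ltW.
rewrite -ler_pdivlMl// mulr1 => h'; apply: le_trans h' _.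
have -> : r^-1 = 2 / e * C' by rewrite /r; field; rewrite ?(gt_eqF e0) ?(gt_eqF C'0).
exact: lexx.
Qed.

Lemma gs0_dual_lin s t f c F G : 0 <= s -> 0 <= t -> gs0_dual s t f ->
  gs0 s t F -> gs0 s t G -> f (fun x => c * F x + G x) = c * f F + f G.
Proof.
by move=> s0 t0 [flin _] gF gG; apply: flin; exact/gs0P.
Qed.

Lemma gs0_dual0 s t f : 0 <= s -> 0 <= t -> gs0_dual s t f -> f (fun=> 0) = 0.
Proof.
move=> s0 t0 df; have := gs0_dual_lin 1 s0 t0 df (gs00 s t) (gs00 s t).
under eq_fun do rewrite mulr0 addr0.
by rewrite mul1r => /eqP; rewrite -subr_eq0 opprD addNKr oppr_eq0 => /eqP.
Qed.

Lemma gs0_dualZ s t f c F : 0 <= s -> 0 <= t -> gs0_dual s t f ->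
  gs0 s t F -> f (fun x => c * F x) = c * f F.
Proof.
move=> s0 t0 df gF; have := gs0_dual_lin c s0 t0 df gF (gs00 s t).
by under eq_fun do rewrite addr0; rewrite (gs0_dual0 s0 t0 df) addr0.
Qed.

Lemma gs0_dual_sum s t f I (r : seq I) (c : I -> R[i]) (F : I -> V -> R[i]) :
  0 <= s -> 0 <= t -> gs0_dual s t f -> (forall i, gs0 s t (F i)) ->
  f (fun x => \sum_(i <- r) c i * F i x) = \sum_(i <- r) c i * f (F i).
Proof.
move=> s0 t0 df gF; elim: r => [|i r IH].
  by under eq_fun do rewrite big_nil; rewrite big_nil; exact: gs0_dual0 df.
under eq_fun do rewrite big_cons; rewrite big_cons -IH.
by apply: gs0_dual_lin df _ _ => //; exact: gs0_sum.
Qed.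

End gs_spaces.

(** * Wavelet atoms and the moment estimate *)

Section wavelet_atoms.
Context {R : realType} {n : nat}.
Local Notation V := 'rV[R]_n.
Local Notation midx := {ffun 'I_n -> nat}.
Local Notation leb := (@lebesgue_rV R n).
Implicit Types (F G w P psi : V -> R[i]) (s t K C a : R) (c : R[i]) (x b : V).

Lemma expr_add_le (p q : R) A : 0 <= p -> 0 <= q ->
  (p + q) ^+ A <= 2 ^+ A * (p ^+ A + q ^+ A).
Proof.
move=> p0 q0; wlog pq : p q p0 q0 / p <= q => [h|].
  by case: (leP p q) => [|/ltW] pq; [exact: h|rewrite addrC [p ^+ A + _]addrC; exact: h].
apply: (@le_trans _ _ ((2 * q) ^+ A)).
  by rewrite lerXn2r ?nnegrE ?addr_ge0 ?mulr_ge0// mulr_natl mulr2n lerD2r.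
by rewrite exprMn ler_wpM2l ?exprn_ge0// lerDr exprn_ge0.
Qed.

Lemma wavelet_atomE psi b a : wavelet_atom psi b a =
  fun x => ((a ^+ n)^-1)%:C * (psi (a^-1 *: x + (- (a^-1 *: b))))^*.
Proof. by apply/funext => x; rewrite /wavelet_atom scalerBr. Qed.

Lemma smooth_wavelet_atom psi b a : smooth psi -> smooth (wavelet_atom psi b a).
Proof. by move=> spsi; rewrite wavelet_atomE; exact: (smooth_atom _ _ _ spsi).1. Qed.

Lemma pderives_atom psi b a l x : smooth psi ->
  pderives l (wavelet_atom psi b a) x =
  ((a ^+ n)^-1 * a^-1 ^+ size l)%:C * (pderives l psi (a^-1 *: (x - b)))^*.
Proof.
move=> spsi; rewrite wavelet_atomE (smooth_atom _ _ _ spsi).2.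
by rewrite scalerBr.
Qed.

(** At x = a u + b one has |x| <= a |u| + |b|, whence the two terms. *)
Lemma atom_estimate s t K C psi b a : 0 < a -> smooth psi -> 1 <= K -> 0 <= C ->
  gs_bound s t K C psi -> forall A l x, sorted lei l ->
  `|x| ^+ A * normc (pderives l (wavelet_atom psi b a) x) <=
  C * (2 * K) ^+ (A + size l) * ((a ^+ n)^-1 * a^-1 ^+ size l) *
  (a ^+ A * fpow A t + `|b| ^+ A) * fpow (size l) s.
Proof.
move=> a0 spsi K1 C0 FB A l x sl; rewrite pderives_atom//.
have K0 : 0 <= K by exact: le_trans ler01 K1.
set u := a^-1 *: (x - b); set N := size l; set r : R := (a ^+ n)^-1 * a^-1 ^+ N.
have r0 : 0 <= r by rewrite /r mulr_ge0 ?invr_ge0 ?exprn_ge0 ?invr_ge0 ?(ltW a0).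
rewrite normcM normc_real (ger0_norm r0) normc_conj; set D := normc _.
have D0 : 0 <= D by exact: normc_ge0.
have xu : `|x| <= a * `|u| + `|b|.
  have {1}-> : x = a *: u + b.
    by rewrite /u scalerA mulfV ?gt_eqF// scale1r subrK.
  by apply: le_trans (ler_normD _ _) _; rewrite normrZ gtr0_norm.
have h1 : `|x| ^+ A <= 2 ^+ A * (a ^+ A * `|u| ^+ A + `|b| ^+ A).
  rewrite -exprMn; apply: le_trans (expr_add_le A _ _); rewrite ?mulr_ge0 ?(ltW a0)//.
  by rewrite lerXn2r ?nnegrE ?addr_ge0 ?mulr_ge0 ?(ltW a0).
have h2 : `|u| ^+ A * D <= C * K ^+ (A + N) * (fpow A t * fpow N s) by exact: FB.
have h3 : D <= C * K ^+ (A + N) * fpow N s.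
  have := FB 0%N l u sl; rewrite expr0 mul1r fpow0 mul1r => h; apply: le_trans h _.
  by rewrite ler_wpM2r ?fpow_ge0// ler_wpM2l// ler_weXn2l// leq_add2r.
rewrite mulrCA [leRHS](_ : _ = r * (2 ^+ (A + N) * (C * K ^+ (A + N) *
   (a ^+ A * fpow A t + `|b| ^+ A) * fpow N s))); last by rewrite exprMn; ring.
rewrite ler_wpM2l//.
apply: (@le_trans _ _ (2 ^+ A * (a ^+ A * `|u| ^+ A + `|b| ^+ A) * D)).
  by rewrite ler_wpM2r.
rewrite -mulrA; apply: ler_pM.
- by rewrite exprn_ge0.
- by rewrite mulr_ge0// addr_ge0// ?mulr_ge0 ?exprn_ge0// ltW.
- by rewrite ler_weXn2l ?ler1n// leq_addr.
rewrite mulrDl [leRHS](_ : _ = a ^+ A * (C * K ^+ (A + N) * (fpow A t * fpow N s)) +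
   `|b| ^+ A * (C * K ^+ (A + N) * fpow N s)); last by ring.
apply: lerD; last by rewrite ler_wpM2l// exprn_ge0.
by rewrite -mulrA ler_wpM2l// exprn_ge0// ltW.
Qed.

Lemma annihilates_affine s t w a b (m : midx) : 0 <= s -> 0 <= t -> gs0 s t w ->
  annihilates w (fun u => (monom (a *: u + b) m)%:C).
Proof.
move=> s0 t0 gw.
pose QQ (P : V -> R) := forall beta, annihilates w (fun u => (monom u beta * P u)%:C).
have Q1 : QQ (fun=> 1).
  move=> beta; apply: annihilates_ext (gs0_annihilates_monom beta 1 s0 t0 gw) => u.
  by rewrite mul1r mulr1.
have Qstep i (P : V -> R) : QQ P -> QQ (fun u => (a * u ord0 i + b ord0 i) * P u).
  move=> qP beta; pose beta' := [ffun k => (beta k + (k == i) * 1)%N].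
  apply: annihilates_ext (annihilatesD (annihilatesZ a%:C (qP beta'))
    (annihilatesZ (b ord0 i)%:C (qP beta))) => u.
  by rewrite /beta' -monom_mulX expr1 -!rmorphM -rmorphD; congr (_%:C); ring.
have Qpow i (P : V -> R) k : QQ P -> QQ (fun u => (a * u ord0 i + b ord0 i) ^+ k * P u).
  move=> qP; elim: k => [|k IH].
    by move=> beta; apply: annihilates_ext (qP beta) => u; rewrite expr0 mul1r.
  move=> beta; apply: annihilates_ext (Qstep i _ IH beta) => u.
  by congr (_ * _)%:C; rewrite exprS mulrA.
have Qprod (r : seq 'I_n) : QQ (fun u => \prod_(i <- r) (a * u ord0 i + b ord0 i) ^+ m i).
  elim: r => [|i r IH] beta.
    by apply: annihilates_ext (Q1 beta) => u; rewrite big_nil.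
  by apply: annihilates_ext (Qpow i _ (m i) IH beta) => u; rewrite big_cons.
apply: annihilates_ext (Qprod (index_enum 'I_n) [ffun=> 0%N]) => u.
rewrite /monom big1 ?mul1r => [|i _]; last by rewrite ffunE expr0.
by congr (_%:C); apply: eq_bigr => i _; rewrite !mxE.
Qed.

Lemma gs0_atom s t psi b a : 0 <= s -> 0 <= t -> 0 < a -> gs0 s t psi ->
  gs0 s t (wavelet_atom psi b a).
Proof.
move=> s0 t0 a0 gpsi; have [spsi [K [C [K1 C0 FB]]] mpsi] := gpsi.
have K0 : 0 <= K by exact: le_trans ler01 K1.
pose B := Num.max 1 (Num.max a `|b|); pose r := Num.max 1 a^-1.
have B1 : 1 <= B by rewrite le_max lexx.
have r1 : 1 <= r by rewrite le_max lexx.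
have r0 : 0 <= r by exact: le_trans ler01 r1.
have B0 : 0 <= B by exact: le_trans ler01 B1.
have aB : a <= B by rewrite /B !le_max lexx orbT.
have bB : `|b| <= B by rewrite /B !le_max lexx !orbT.
have ar : a^-1 <= r by rewrite le_max lexx orbT.
have ai0 : 0 <= a^-1 by rewrite invr_ge0 ltW.
have an0 : 0 <= (a ^+ n)^-1 by rewrite invr_ge0 exprn_ge0// ltW.
pose K' := (2 * K) * (r * B); pose C' := C * (a ^+ n)^-1 * 2.
have K'1 : 1 <= K'.
  rewrite /K' -[leLHS]mulr1 ler_pM//; first by rewrite -[leLHS]mulr1 ler_pM// ler1n.
  by rewrite -[leLHS]mulr1 ler_pM.
have C'0 : 0 <= C' by rewrite !mulr_ge0.
have AB : gs_bound s t K' C' (wavelet_atom psi b a).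
  move=> A l x sl; apply: le_trans (atom_estimate b a0 spsi K1 C0 FB A x sl) _.
  set N := size l.
  rewrite [leRHS](_ : _ = C * (2 * K) ^+ (A + N) * ((a ^+ n)^-1 * r ^+ (A + N)) *
     (B ^+ (A + N) * fpow A t * 2) * fpow N s); last first.
    by rewrite /K' /C' !exprMn; ring.
  rewrite ler_wpM2r ?fpow_ge0//; apply: ler_pM.
  - by rewrite !mulr_ge0 ?exprn_ge0 ?mulr_ge0.
  - by rewrite addr_ge0 ?mulr_ge0 ?exprn_ge0 ?fpow_ge0// ltW.
  - rewrite ler_wpM2l ?mulr_ge0 ?exprn_ge0 ?mulr_ge0// ler_wpM2l//.
    apply: (@le_trans _ _ (r ^+ N)); first by rewrite lerXn2r ?nnegrE.
    by rewrite ler_weXn2l// leq_addl.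
  rewrite mulr_natr mulr2n; apply: lerD.
    rewrite ler_wpM2r ?fpow_ge0//; apply: (@le_trans _ _ (B ^+ A)).
      by rewrite lerXn2r ?nnegrE// ltW.
    by rewrite ler_weXn2l// leq_addr.
  apply: (@le_trans _ _ (B ^+ (A + N))); last first.
    by rewrite ler_peMr ?exprn_ge0// fpow_ge1.
  apply: (@le_trans _ _ (B ^+ A)); first by rewrite lerXn2r ?nnegrE.
  by rewrite ler_weXn2l// leq_addr.
have sA := smooth_wavelet_atom b a spsi.
split => //; first by exists K', C'.
move=> m; have iA := gs_bound_integrable_monom m s0 t0 K'1 C'0 sA AB.
have [_ z] := annihilates_affine a b m s0 t0 (gs0_conj s0 t0 gpsi).
rewrite (integralC_affine_rV b a0 iA).
rewrite (_ : (fun u : V => (monom (a *: u + b) m)%:C * wavelet_atom psi b a (a *: u + b)) =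
   fun u => ((a ^+ n)^-1)%:C * ((psi u)^* * (monom (a *: u + b) m)%:C)); last first.
  apply/funext => u; rewrite /wavelet_atom addrK scalerA mulVf ?gt_eqF// scale1r.
  by ring.
have [i _] := annihilates_affine a b m s0 t0 (gs0_conj s0 t0 gpsi).
by rewrite integralCZ// z !mulr0.
Qed.

End wavelet_atoms.

Section wavelet_decay.
Context {R : realType} {n : nat}.
Hypothesis n0 : (0 < n)%N.
Local Notation V := 'rV[R]_n.
Local Notation leb := (@lebesgue_rV R n).
Implicit Types (F w : V -> R[i]) (s t K C a e : R) (x b : V).

Lemma integrable_mul_affine s1 t1 s2 t2 F w x e : 0 <= s2 -> 0 <= t2 ->
  gs0 s1 t1 F -> gs0 s2 t2 w ->
  integrableC leb setT (fun u => w u * F (e *: u + x)).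
Proof.
move=> s20 t20 [sF [K [C [K1 C0 FB]]] _] gw.
have [+ _] := gs0_annihilates_monom [ffun=> 0%N] 1 s20 t20 gw.
rewrite (_ : (fun _ => _) = w); last first.
  apply/funext => u; rewrite mul1r /monom big1 ?mulr1// => i _.
  by rewrite ffunE expr0.
move=> iw; apply: (integrableC_bounded (c := C * (K ^+ 0) * (fpow 0 t1 * fpow 0 s1)) iw).
  apply: (measurableC_comp (measurable_smooth sF)).
  exact: measurable_affine_rV.
by move=> u; have := FB 0%N [::] (e *: u + x) isT; rewrite expr0 mul1r.
Qed.

(** The key estimate: expanding F around x to order N, the Taylor polynomial is
    killed by the vanishing moments of w, and the remainder gains e^N, a factor
    1/N! and one derivative of order N of F against one moment of order N of w.
    The decay in x comes from that of F near x and, when e*u is comparable to x,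
    from that of w. *)
Lemma moment_estimate s1 t1 s2 t2 F w : 0 <= s1 -> 0 <= t1 -> 0 <= s2 -> 0 <= t2 ->
  gs0 s1 t1 F -> gs0 s2 t2 w ->
  exists K M : R, [/\ 1 <= K, 0 <= M & forall x e N M1 M2, 0 < e ->
    (0 < `|x| \/ (M1 = 0 /\ M2 = 0)%N) ->
    normc (integralC leb setT (fun u => w u * F (e *: u + x))) <=
    M * ((K * e) ^+ N * fpow N (s1 + t2 - 1)) *
    ((K / `|x|) ^+ M1 * fpow M1 t1 + (K * e / `|x|) ^+ M2 * fpow M2 t2)].
Proof.
move=> s10 t10 s20 t20 gF gw.
have [sF [K [CF [K1 CF0 FB]]] _] := gF.
have [sw [Kw0 [Cw [Kw1 Cw0 wB]]] _] := gw.
have [Kw [Mw [Kw01 Mw0 hw]]] := @gs_bound_decay R n s2 t2 Kw0 s20 t20 Kw1.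
have {}hw := hw _ _ Cw0 wB.
have K0 : 0 <= K by exact: le_trans ler01 K1.
have Kw1' : 1 <= Kw by exact: le_trans Kw1 Kw01.
have Kw0' : 0 <= Kw by exact: le_trans ler01 Kw1'.
have T1 := @two_powR_ge1 R t2 t20; set T : R := 2 `^ t2 in T1 *.
have T0 : 0 <= T by exact: le_trans ler01 T1.
have n1 : 1 <= n%:R :> R by rewrite ler1n.
have nn0 : 0 <= n%:R :> R by exact: ler0n.
pose KT := Kw * T.
have KT1 : 1 <= KT by rewrite -[leLHS]mulr1 ler_pM.
have KT0 : 0 <= KT by exact: le_trans ler01 KT1.
pose L := 2 * (K * (n%:R * KT)).
pose I := (\int[leb]_u decay u)%R.
have I0 : 0 <= I by apply: Rintegral_ge0 => u _; exact: decay_ge0.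
pose M := 2 * (2 * CF * (Mw * Cw)) * I.
have L1 : 1 <= L.
  rewrite /L -[leLHS]mulr1 ler_pM ?ler1n// -[leLHS]mulr1 ler_pM//.
  by rewrite -[leLHS]mulr1 ler_pM.
exists L, M; split => //; first by rewrite /M !mulr_ge0.
move=> x e N M1 M2 e0 hx.
have e0' := ltW e0.
pose Y := (K * (2 / `|x|)) ^+ M1 * fpow M1 t1.
pose Z := (2 * e / `|x|) ^+ M2.
have x2 : 0 <= 2 / `|x| by rewrite divr_ge0.
have Y0 : 0 <= Y by rewrite mulr_ge0 ?exprn_ge0 ?mulr_ge0 ?fpow_ge0.
have Z0 : 0 <= Z by rewrite exprn_ge0// divr_ge0// mulr_ge0.
pose TT (u : V) := taylor axes N F x (e *: u).
have [iTT zTT] : annihilates w TT.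
  have := @taylor_polynomial R n (fun P => annihilates w (fun u => P (e *: u))).
  move=> h; have {}h := h _ _ _ axes N F x [ffun=> 0%N].
  apply: annihilates_ext (h _ _ _) => [u|al c|P P'|c P]; rewrite /TT.
  - rewrite /monom big1 ?mul1r// => i _; by rewrite ffunE expr0.
  - have := annihilates_affine e 0 al s20 t20 gw; move=> /(annihilatesZ c).
    by apply: annihilates_ext => u; rewrite addr0.
  - exact: annihilatesD.
  - exact: annihilatesZ.
have iwF := integrable_mul_affine x e s20 t20 gF gw.
have -> : integralC leb setT (fun u => w u * F (e *: u + x)) =
    integralC leb setT (fun u => w u * (F (x + e *: u) - TT u)).
  rewrite -[LHS]subr0 -zTT -integralCB//; apply: eq_integralC => u.
  by rewrite [e *: u + x]addrC mulrBr.
pose W := 2 * CF * (Mw * Cw) * ((L * e) ^+ N * fpow N (s1 + t2 - 1)) *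
   ((L / `|x|) ^+ M1 * fpow M1 t1 + (L * e / `|x|) ^+ M2 * fpow M2 t2).
have fN0 : (N`!%:R : R) != 0 by rewrite pnatr_eq0 -lt0n fact_gt0.
have point u : normc (w u * (F (x + e *: u) - TT u)) <= W * decay u.
  have hB l : sorted lei l -> {subset l <= axes} -> size l = N ->
      forall z, `|z - x| <= `|e *: u| -> normc (pderives l F z) <=
      CF * K ^+ N * fpow N s1 * (Y + Z * `|u| ^+ M2).
    move=> sl _ szl z; rewrite normrZ (gtr0_norm e0) => zx.
    have h0 := FB 0%N l z sl; rewrite szl expr0 mul1r fpow0 mul1r in h0.
    case: hx => [x0|[M10 M20]]; last first.
      apply: le_trans h0 _; rewrite ler_peMr ?mulr_ge0 ?exprn_ge0 ?fpow_ge0//.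
      by rewrite /Y /Z M10 M20 !expr0 fpow0 !mulr1 lerDl.
    case: (leP (e * `|u|) (`|x| / 2)) => hu.
      have zx2 : `|x| / 2 <= `|z|.
        have h : `|x| <= `|z| + `|z - x|.
          by rewrite -[X in `|X| <= _](subKr z x); exact: ler_normB.
        have h' := le_trans h (lerD (lexx _) (le_trans zx hu)).
        by move: h'; rewrite -lerBlDr; apply: le_trans; move: `|x| => r; lra.
      have h1 := FB M1 l z sl; rewrite szl in h1.
      have p0 : 0 < (`|x| / 2) ^+ M1 by rewrite exprn_gt0// divr_gt0.
      apply: (@le_trans _ _ (CF * K ^+ N * fpow N s1 * Y)); last first.
        rewrite ler_wpM2l ?mulr_ge0 ?exprn_ge0 ?fpow_ge0//.
        by rewrite lerDl mulr_ge0// exprn_ge0.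
      have -> : CF * K ^+ N * fpow N s1 * Y =
          ((`|x| / 2) ^+ M1)^-1 * (CF * K ^+ (M1 + N) * (fpow M1 t1 * fpow N s1)).
        by rewrite /Y -exprVn invf_div exprMn exprD; ring.
      rewrite ler_pdivlMl//; apply: le_trans h1.
      rewrite ler_wpM2r ?normc_ge0// lerXn2r ?nnegrE//.
    apply: le_trans h0 _; rewrite ler_peMr ?mulr_ge0 ?exprn_ge0 ?fpow_ge0//.
    apply: (@le_trans _ _ (Z * `|u| ^+ M2)); last by rewrite lerDr.
    rewrite /Z -exprMn exprn_ege1// mulrAC ler_pdivlMr// mul1r.
    by move: hu; rewrite ltr_pdivrMr// => /ltW; rewrite mulrC mulrA.
  have BB0 : 0 <= CF * K ^+ N * fpow N s1 * (Y + Z * `|u| ^+ M2).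
    have Zu : 0 <= Z * `|u| ^+ M2 by rewrite mulr_ge0// exprn_ge0.
    by apply: mulr_ge0; [rewrite !mulr_ge0// ?exprn_ge0// fpow_ge0|exact: addr_ge0].
  have := taylor_bound sF (@sorted_axes n) BB0 hB.
  rewrite restr_axes size_axes -/(TT u) normrZ (gtr0_norm e0) => hT.
  rewrite normcM; apply: le_trans (ler_wpM2l (normc_ge0 _) hT) _.
  have w1 := hw N [::] u isT; have w2 := hw (N + M2)%N [::] u isT.
  rewrite /= fpow0 mulr1 addn0 in w1; rewrite /= fpow0 mulr1 addn0 in w2.
  set nw := normc (w u) in w1 w2 *.
  have nw0 : 0 <= nw by exact: normc_ge0.
  set X := CF * K ^+ N * fpow N s1.
  have X0 : 0 <= X by rewrite /X !mulr_ge0 ?exprn_ge0 ?fpow_ge0.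
  have q0 : 0 <= (n%:R * e) ^+ N / N`!%:R by rewrite divr_ge0 ?exprn_ge0 ?mulr_ge0.
  have -> : nw * (2 * (X * (Y + Z * `|u| ^+ M2)) * ((n%:R * (e * `|u|)) ^+ N / N`!%:R)) =
     2 * X * ((n%:R * e) ^+ N / N`!%:R) * (Y * (`|u| ^+ N * nw) + Z * (`|u| ^+ (N + M2) * nw)).
    by rewrite !exprMn exprD; ring.
  apply: (@le_trans _ _ (2 * X * ((n%:R * e) ^+ N / N`!%:R) *
     (Y * (Mw * Cw * Kw ^+ N * fpow N t2 * decay u) +
      Z * (Mw * Cw * Kw ^+ (N + M2) * fpow (N + M2) t2 * decay u)))).
    apply: ler_wpM2l; first by apply: mulr_ge0 q0; exact: mulr_ge0.
    by apply: lerD; exact: ler_wpM2l.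
  have f2 := fpow_leD N M2 t20; rewrite -/T in f2.
  have MC0 : 0 <= Mw * Cw by rewrite mulr_ge0.
  apply: (@le_trans _ _ (2 * X * ((n%:R * e) ^+ N / N`!%:R) *
     (Y * (Mw * Cw * KT ^+ N * fpow N t2 * decay u) +
      Z * (Mw * Cw * KT ^+ (N + M2) * (fpow N t2 * fpow M2 t2) * decay u)))).
    apply: ler_wpM2l; first by apply: mulr_ge0 q0; exact: mulr_ge0.
    apply: lerD; apply: ler_wpM2l => //.
      rewrite ler_wpM2r ?decay_ge0// ler_wpM2r ?fpow_ge0// ler_wpM2l//.
      by rewrite lerXn2r ?nnegrE// ler_peMr.
    rewrite ler_wpM2r ?decay_ge0// /KT exprMn.
    rewrite [leRHS](_ : _ = Mw * Cw * Kw ^+ (N + M2) *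
       (T ^+ (N + M2) * (fpow N t2 * fpow M2 t2))); last by ring.
    by rewrite ler_wpM2l ?mulr_ge0 ?exprn_ge0.
  have fE : fpow N (s1 + t2 - 1) = fpow N s1 * fpow N t2 / N`!%:R.
    have := fpowD N (s1 + t2 - 1) 1; rewrite subrK fpowD fpow1 => ->.
    by rewrite mulfK.
  have -> : 2 * X * ((n%:R * e) ^+ N / N`!%:R) *
     (Y * (Mw * Cw * KT ^+ N * fpow N t2 * decay u) +
      Z * (Mw * Cw * KT ^+ (N + M2) * (fpow N t2 * fpow M2 t2) * decay u)) =
    2 * CF * (Mw * Cw) * ((K * (n%:R * KT) * e) ^+ N * fpow N (s1 + t2 - 1)) *
      (Y + Z * KT ^+ M2 * fpow M2 t2) * decay u.
    by clearbody KT Y Z; rewrite fE /X !exprMn exprD; ring.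
  rewrite ler_wpM2r ?decay_ge0// /W.
  have KL : K * (n%:R * KT) <= L by rewrite /L ler_peMl ?ler1n// !mulr_ge0.
  have P0 : 0 <= K * (n%:R * KT) by rewrite !mulr_ge0.
  have L0 : 0 <= L by exact: le_trans ler01 L1.
  apply: ler_pM.
  - by rewrite !mulr_ge0 ?exprn_ge0 ?mulr_ge0 ?fpow_ge0.
  - by apply: addr_ge0 => //; apply: mulr_ge0; [apply: mulr_ge0 => //; exact: exprn_ge0|exact: fpow_ge0].
  - rewrite ler_wpM2l ?mulr_ge0// ler_wpM2r ?fpow_ge0// lerXn2r ?nnegrE ?mulr_ge0//.
    by rewrite ler_wpM2r.
  apply: lerD.
    rewrite /Y ler_wpM2r ?fpow_ge0// lerXn2r ?nnegrE ?mulr_ge0 ?divr_ge0//.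
    rewrite mulrA ler_wpM2r ?invr_ge0// /L mulrC ler_wpM2l// ler_peMr//.
    by rewrite -[leLHS]mulr1 ler_pM.
  rewrite ler_wpM2r ?fpow_ge0// /Z -exprMn lerXn2r ?nnegrE ?mulr_ge0 ?divr_ge0 ?mulr_ge0//.
  rewrite mulrAC ler_wpM2r ?invr_ge0// mulrAC ler_wpM2r// /L ler_wpM2l//.
  rewrite -[leLHS]mul1r ler_pM// -[leLHS]mul1r ler_pM//.
have iP : integrableC leb setT (fun u => w u * (F (x + e *: u) - TT u)).
  apply: eq_integrableC (integrableCB iwF iTT) => u.
  by rewrite [e *: u + x]addrC mulrBr.
have iW : leb.-integrable setT (fun u : V => (W * decay u)%:E).
  by under eq_fun do rewrite EFinM; apply: integrableZl => //; exact: integrable_decay.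
apply: le_trans (normc_integralC_le iP iW point) _.
rewrite RintegralZl//; last exact: integrable_decay.
rewrite /M /W -/I le_eqVlt; apply/orP; left; apply/eqP; ring.
Qed.

End wavelet_decay.

(** * Decay of the wavelet coefficients *)

Lemma conjc_conjc (R : realType) (z : R[i]) : (z^*)^* = z.
Proof. exact: conjcK. Qed.

Section wavelet_coefficients.
Context {R : realType} {n : nat}.
Hypothesis n0 : (0 < n)%N.
Local Notation V := 'rV[R]_n.
Local Notation leb := (@lebesgue_rV R n).
Implicit Types (F w phi g psi : V -> R[i]) (K C a e : R) (x b : V).

(** The transform of g with respect to the conjugate of phi at (b, a), after the
    substitution x = a u + b; see wavelet_transform_coef. *)
Definition coef phi g a b : R[i] := integralC leb setT (fun u => phi u * g (a *: u + b)).

Lemma coefE s1 t1 s2 t2 phi g a b : 0 < a -> 0 <= s2 -> 0 <= t2 -> gs0 s1 t1 phi -> gs0 s2 t2 g ->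
  integralC leb setT (fun x => g x * phi (a^-1 *: (x - b))) = (a ^+ n)%:C * coef phi g a b.
Proof.
move=> a0 s20 t20 gphi gg.
have E : (fun x : V => g x * phi (a^-1 *: (x - b))) =
    fun x => g x * phi (a^-1 *: x + - (a^-1 *: b)).
  by apply/funext => x; rewrite scalerBr.
rewrite E (integralC_affine_rV b a0 (integrable_mul_affine _ _ s20 t20 gphi gg)).
congr (_ * _); apply: eq_integralC => u.
by rewrite -scalerBr addrK scalerA mulVf ?gt_eqF// scale1r mulrC.
Qed.

Lemma wavelet_transform_coef s1 t1 s2 t2 phi g a b : 0 < a -> 0 <= s2 -> 0 <= t2 ->
  gs0 s1 t1 phi -> gs0 s2 t2 g ->
  wavelet_transform (fun x => (phi x)^*) (pairing g) b a = coef phi g a b.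
Proof.
move=> a0 s20 t20 gphi gg; rewrite /wavelet_transform /pairing.
have -> : (fun x : V => g x * wavelet_atom (fun x => (phi x)^*) b a x) =
    fun x => ((a ^+ n)^-1)%:C * (g x * phi (a^-1 *: (x - b))).
  apply/funext => x; rewrite mulrCA; congr (_ * (_ * _)); exact: conjc_conjc.
rewrite integralCZ ?(coefE b a0 s20 t20 gphi gg); last first.
  have := integrable_mul_affine (- (a^-1 *: b)) a^-1 s20 t20 gphi gg.
  by apply: eq_integrableC => x; rewrite scalerBr.
by rewrite mulrA -rmorphM mulVf ?mul1r// gt_eqF// exprn_gt0.
Qed.

Lemma coef_swap s1 t1 s2 t2 phi g a b : 0 < a -> 0 <= s2 -> 0 <= t2 -> gs0 s1 t1 phi -> gs0 s2 t2 g ->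
  normc (coef phi g a b) = (a ^+ n)^-1 * normc (coef g phi a^-1 (- (a^-1 *: b))).
Proof.
move=> a0 s20 t20 gphi gg; rewrite [in RHS]/coef.
have -> : (fun u : V => g u * phi (a^-1 *: u - a^-1 *: b)) = fun x => g x * phi (a^-1 *: (x - b)).
  by apply/funext => x; rewrite scalerBr.
have an0 : 0 < a ^+ n by rewrite exprn_gt0.
by rewrite (coefE b a0 s20 t20 gphi gg) normcM normc_real gtr0_norm// mulKf// gt_eqF.
Qed.

Lemma expr_div_le (r q : R) M : 0 <= r -> 0 <= q -> r ^+ M * (q / r) ^+ M <= q ^+ M.
Proof.
move=> r0 q0; rewrite -exprMn; have [->|rn0] := eqVneq r 0.
  by rewrite mul0r; case: M => [|M]; rewrite ?expr0// expr0n exprn_ge0.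
by rewrite mulrCA mulfV// mulr1.
Qed.

Section estimates.
Variables (rho1 rho2 s t : R).
Hypotheses (h1 : 0 < rho1) (h2 : 1 < rho2) (ht : rho1 + rho2 < t) (hs : rho1 + rho2 - 1 < s).
Local Notation sigma := (rho1 + rho2 - 1).
Variables phi g : V -> R[i].
Hypotheses (gphi : gs0 rho1 rho2 phi) (gg : gs0 (s - sigma) (t - sigma) g).

Let s10 : 0 <= s - sigma. Proof. by rewrite subr_ge0 ltW. Qed.
Let t10 : 0 <= t - sigma. Proof. by move: h1 h2 ht => ? ? ?; lra. Qed.
Let sigma_le : t - sigma <= t. Proof. by move: h1 h2 => ? ?; lra. Qed.
Let rho2_le : rho2 <= t. Proof. by move: h1 ht => ? ?; lra. Qed.
Let s20 : 0 <= rho1. Proof. exact: ltW. Qed.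
Let t20 : 0 <= rho2. Proof. by rewrite (le_trans ler01)// ltW. Qed.

(** At small scales N derivatives of g cost N! ^ (s - sigma), N moments of phi
    cost N! ^ rho2, and the remainder gains 1 / N!; the exponents add up to
    s - rho1. *)
Lemma coef_small_scale : exists K C : R, [/\ 1 <= K, 0 <= C & forall a b N M, 0 < a -> a <= 1 ->
  a^-1 ^+ N * (`|b| ^+ M * normc (coef phi g a b)) <=
  C * K ^+ (N + M) * (fpow N (s - rho1) * fpow M t)].
Proof.
have [K [M0 [K1 M00 hM]]] := moment_estimate n0 s10 t10 s20 t20 gg gphi.
have K0 : 0 <= K by exact: le_trans ler01 K1.
exists K, (2 * M0); split => //; first by rewrite mulr_ge0.
move=> a b N M a0 a1; have a0' := ltW a0.
have [b0|b0] := boolP ((0 < `|b|) || (M == 0%N)); last first.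
  move: b0; rewrite negb_or -leNgt => /andP[b0 Mn0].
  have -> : `|b| = 0 by apply/le_anti; rewrite b0 normr_ge0.
  rewrite expr0n (negbTE Mn0) mul0r mulr0.
  by rewrite !mulr_ge0 ?exprn_ge0 ?fpow_ge0.
have {b0}b0 : 0 < `|b| \/ (M = 0 /\ M = 0)%N by case/orP: b0 => [|/eqP]; [left|right].
have := hM b a N M M a0 b0; rewrite -/(coef phi g a b).
have -> : s - sigma + rho2 - 1 = s - rho1 by ring.
set f := fpow N _ => h.
have ai0 : 0 <= a^-1 by rewrite invr_ge0.
apply: (@le_trans _ _ (a^-1 ^+ N * (`|b| ^+ M * (M0 * ((K * a) ^+ N * f) *
   ((K / `|b|) ^+ M * fpow M (t - sigma) + (K * a / `|b|) ^+ M * fpow M rho2))))).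
  by rewrite ler_wpM2l ?exprn_ge0// ler_wpM2l ?exprn_ge0.
have f0 : 0 <= f by exact: fpow_ge0.
have Ea : a^-1 ^+ N * (K * a) ^+ N = K ^+ N.
  by rewrite -exprMn mulrCA mulVf ?mulr1// gt_eqF.
rewrite [leLHS](_ : _ = M0 * ((a^-1 ^+ N * (K * a) ^+ N) * f) *
   ((`|b| ^+ M * (K / `|b|) ^+ M) * fpow M (t - sigma) +
    (`|b| ^+ M * (K * a / `|b|) ^+ M) * fpow M rho2)); last by ring.
rewrite Ea [leRHS](_ : _ = M0 * (K ^+ N * f) * (K ^+ M * fpow M t + K ^+ M * fpow M t)); last first.
  by rewrite exprD; ring.
rewrite ler_wpM2l ?mulr_ge0 ?exprn_ge0//; apply: lerD; apply: ler_pM.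
- by rewrite mulr_ge0 ?exprn_ge0 ?divr_ge0.
- exact: fpow_ge0.
- exact: expr_div_le.
- exact: fpow_monoR.
- by rewrite mulr_ge0 ?exprn_ge0 ?divr_ge0 ?mulr_ge0.
- exact: fpow_ge0.
- apply: le_trans (expr_div_le _ _ _) _; rewrite ?mulr_ge0//.
  by rewrite lerXn2r ?nnegrE ?mulr_ge0// ler_piMr.
- exact: fpow_monoR.
Qed.

(** At large scales the roles of phi and g are exchanged. The moment estimate is
    used to order N and to order N + M: the first controls the contribution of
    the decay of g, the second that of the decay of phi. *)
Lemma coef_large_scale : exists K C : R, [/\ 1 <= K, 0 <= C & forall a b N M, 1 <= a ->
  a ^+ N * (`|b| ^+ M * normc (coef phi g a b)) <=
  C * K ^+ (N + M) * (fpow N (t - rho2) * fpow M t)].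
Proof.
have [K [M0 [K1 M00 hM]]] := moment_estimate n0 s20 t20 s10 t10 gphi gg.
have K0 : 0 <= K by exact: le_trans ler01 K1.
have tr0 : 0 <= t - rho2 by rewrite subr_ge0.
have T1 := two_powR_ge1 tr0; set T : R := 2 `^ (t - rho2) in T1 *.
have T0 : 0 <= T by exact: le_trans ler01 T1.
pose L := K * K * T.
have KL : K <= L.
  rewrite /L -mulrA ler_peMr//; by rewrite -[leLHS]mulr1 ler_pM.
have L1 : 1 <= L by exact: le_trans KL.
have L0 : 0 <= L by exact: le_trans ler01 L1.
exists L, (2 * M0); split => //; first by rewrite mulr_ge0.
move=> a b N M a1; have a0 : 0 < a by exact: lt_le_trans a1.
have a0' := ltW a0; have ai0 : 0 <= a^-1 by rewrite invr_ge0.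
have [b0|b0] := boolP ((0 < `|b|) || (M == 0%N)); last first.
  move: b0; rewrite negb_or -leNgt => /andP[b0 Mn0].
  have -> : `|b| = 0 by apply/le_anti; rewrite b0 normr_ge0.
  rewrite expr0n (negbTE Mn0) mul0r mulr0.
  by rewrite !mulr_ge0 ?exprn_ge0 ?fpow_ge0.
rewrite (coef_swap b a0 s10 t10 gphi gg).
set x := - (a^-1 *: b).
have xE : `|x| = a^-1 * `|b| by rewrite /x normrN normrZ ger0_norm.
have x0 : 0 < `|x| \/ (M = 0 /\ M = 0)%N.
  by case/orP: b0 => [b0|/eqP]; [left; rewrite xE mulr_gt0// invr_gt0|right].
have h N' := hM x a^-1 N' M M (eq_ind_r is_true a0 (invr_gt0 a)) x0.
have E1 : K / `|x| = a * (K / `|b|).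
  by rewrite xE invfM invrK mulrCA mulrA.
have E2 : K * a^-1 / `|x| = K / `|b|.
  by rewrite mulrAC E1 mulrAC mulfV ?gt_eqF// mul1r.
rewrite E1 E2 -/(coef g phi a^-1 x) (_ : rho1 + (t - sigma) - 1 = t - rho2) in h; last first.
  by ring.
set y := normc _ in h *.
pose A N' := (K * a^-1) ^+ N' * fpow N' (t - rho2).
pose X1 := (a * (K / `|b|)) ^+ M * fpow M rho2.
pose X2 := (K / `|b|) ^+ M * fpow M (t - sigma).
have kb0 : 0 <= K / `|b| by rewrite divr_ge0.
have X10 : 0 <= X1 by rewrite /X1 mulr_ge0 ?fpow_ge0// exprn_ge0// mulr_ge0.
have X20 : 0 <= X2 by rewrite /X2 mulr_ge0 ?fpow_ge0// exprn_ge0.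
have y1 : y <= M0 * (A (N + M)%N * X1 + A N * X2).
  have [AA|AA] := leP (A N) (A (N + M)%N).
    apply: le_trans (h N) _; rewrite -/(A N) -/X1 -/X2 -mulrA ler_wpM2l// mulrDr lerD2r.
    by rewrite ler_wpM2r.
  apply: le_trans (h (N + M)%N) _; rewrite -/(A _) -/X1 -/X2 -mulrA ler_wpM2l// mulrDr lerD2l.
  by rewrite ler_wpM2r// ltW.
have y0 : 0 <= y by exact: normc_ge0.
apply: (@le_trans _ _ (a ^+ N * (`|b| ^+ M * y))).
  rewrite ler_wpM2l ?exprn_ge0// ler_wpM2l ?exprn_ge0//.
  by rewrite ler_piMl// invf_le1 ?exprn_gt0// exprn_ege1.
apply: (@le_trans _ _ (a ^+ N * (`|b| ^+ M * (M0 * (A (N + M)%N * X1 + A N * X2))))).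
  by rewrite ler_wpM2l ?exprn_ge0// ler_wpM2l ?exprn_ge0.
have ea N' : a ^+ N' * a^-1 ^+ N' = 1 by rewrite -exprMn mulfV ?expr1n// gt_eqF.
have bq : `|b| ^+ M * (K / `|b|) ^+ M <= K ^+ M by exact: expr_div_le.
have bq0 : 0 <= `|b| ^+ M * (K / `|b|) ^+ M by rewrite mulr_ge0 ?exprn_ge0.
set q := `|b| ^+ M * _ in bq bq0.
have -> : a ^+ N * (`|b| ^+ M * (M0 * (A (N + M)%N * X1 + A N * X2))) =
   M0 * (K ^+ (N + M) * q * (fpow (N + M) (t - rho2) * fpow M rho2) *
     ((a ^+ N * a^-1 ^+ N) * (a ^+ M * a^-1 ^+ M)) +
    K ^+ N * q * (fpow N (t - rho2) * fpow M (t - sigma)) * (a ^+ N * a^-1 ^+ N)).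
  by rewrite /A /X1 /X2 /q !exprMn !exprD; ring.
rewrite !ea !mulr1 [leRHS](_ : _ = M0 * (L ^+ (N + M) * (fpow N (t - rho2) * fpow M t) +
   L ^+ (N + M) * (fpow N (t - rho2) * fpow M t))); last by ring.
rewrite ler_wpM2l//; apply: lerD.
  have f2 := fpow_leD N M tr0; rewrite -/T in f2.
  have -> : fpow M t = fpow M (t - rho2) * fpow M rho2 by rewrite -fpowD subrK.
  apply: (@le_trans _ _ (K ^+ (N + M) * K ^+ (N + M) * (T ^+ (N + M) *
     (fpow N (t - rho2) * fpow M (t - rho2)) * fpow M rho2))); last first.
    by rewrite le_eqVlt; apply/orP; left; apply/eqP; rewrite /L !exprMn; ring.
  apply: ler_pM.
  - by rewrite mulr_ge0// exprn_ge0.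
  - by rewrite mulr_ge0 ?fpow_ge0.
  - rewrite ler_wpM2l ?exprn_ge0//; apply: le_trans bq _.
    by rewrite ler_weXn2l// leq_addl.
  - by rewrite ler_wpM2r ?fpow_ge0.
apply: ler_pM.
- by rewrite mulr_ge0// exprn_ge0.
- by rewrite mulr_ge0 ?fpow_ge0.
- apply: (@le_trans _ _ (K ^+ (N + M))); first by rewrite exprD ler_wpM2l ?exprn_ge0.
  by rewrite lerXn2r ?nnegrE.
- by rewrite ler_wpM2l ?fpow_ge0// fpow_monoR.
Qed.

End estimates.

End wavelet_coefficients.

(** * The reconstruction integrand as a family of test functions *)

Section wavelet_field.
Context {R : realType} {n : nat}.
Hypothesis n0 : (0 < n)%N.
Local Notation V := 'rV[R]_n.
Local Notation leb := (@lebesgue_rV R n).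
Implicit Types (F phi g psi : V -> R[i]) (K C a : R) (x b : V) (w : R * V).

(** The integrand of the reconstruction formula, as a function of (a, b) with
    values in the test functions. It is extended by 0 to a <= 0, so that the
    integrals run over the product R * R^n. *)
Definition field psi phi g w : V -> R[i] :=
  if 0 < w.1 then fun x => (w.1^-1)%:C * coef phi g w.1 w.2 * wavelet_atom psi w.2 w.1 x
  else fun=> 0.

Definition env w : R := (1 + w.1 ^+ 2)^-1 * decay w.2.

Lemma env_gt0 w : 0 < env w.
Proof. by rewrite mulr_gt0 ?decay_gt0// invr_gt0 ltr_pwDl// sqr_ge0. Qed.

Lemma pderivesZ (c : R[i]) F l x : smooth F ->
  pderives l (fun x => c * F x) x = c * pderives l F x.
Proof.
move=> sF; have := (smooth_lin c sF (@smooth0 R n).1).2 l.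
have -> : (fun x => c * F x + 0) = fun x => c * F x by apply/funext => y; rewrite addr0.
by move=> ->; rewrite (@smooth0 R n).2 addr0.
Qed.

Section estimates.
Variables (rho1 rho2 s t : R).
Hypotheses (h1 : 0 < rho1) (h2 : 1 < rho2) (ht : rho1 + rho2 < t) (hs : rho1 + rho2 - 1 < s).
Local Notation sigma := (rho1 + rho2 - 1).
Variables psi phi g : V -> R[i].
Hypotheses (gpsi : gs0 rho1 rho2 psi) (gphi : gs0 rho1 rho2 phi)
  (gg : gs0 (s - sigma) (t - sigma) g).

Let t0 : 0 <= t. Proof. by move: h1 h2 ht => ? ? ?; lra. Qed.
Let sr0 : 0 <= s - rho1. Proof. by move: h1 h2 hs => ? ? ?; lra. Qed.
Let tr0 : 0 <= t - rho2. Proof. by move: h1 ht => ? ?; lra. Qed.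
Let rho2_le : rho2 <= t. Proof. by move: h1 ht => ? ?; lra. Qed.

Lemma decay_absorb2 K C : 1 <= K -> 0 <= C -> exists K' C' : R, [/\ 1 <= K', 0 <= C' &
  forall X b N f, 0 <= X -> 0 <= f ->
  (forall M, `|b| ^+ M * X <= C * K ^+ (N + M) * (f * fpow M t)) ->
  forall M, `|b| ^+ M * X <= C' * K' ^+ (N + M) * (f * fpow M t) * decay b].
Proof.
move=> K1 C0; have K0 : 0 <= K by exact: le_trans ler01 K1.
have [K' [M0 [KK' M00 hM]]] := @decay_absorb R n t K t0 K1.
have K'0 : 0 <= K' by exact: le_trans KK'.
exists K', (M0 * C); split; rewrite ?mulr_ge0 ?(le_trans K1)// => X b N f X0 f0 h M.
have D0 : 0 <= C * K ^+ N * f by rewrite !mulr_ge0 ?exprn_ge0.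
apply: le_trans (hM _ _ b D0 X0 _ M) _ => [A|].
  by apply: le_trans (h A) _; rewrite le_eqVlt; apply/orP; left; apply/eqP; rewrite exprD; ring.
rewrite ler_wpM2r ?decay_ge0// exprD.
rewrite [leLHS](_ : _ = M0 * C * (K ^+ N * K' ^+ M) * (f * fpow M t)); last by ring.
rewrite ler_wpM2r ?mulr_ge0 ?fpow_ge0// ler_wpM2l ?mulr_ge0//.
by rewrite ler_wpM2r ?exprn_ge0// lerXn2r ?nnegrE.
Qed.

Lemma coef_small_decay : exists K C : R, [/\ 1 <= K, 0 <= C & forall a b N M, 0 < a -> a <= 1 ->
  a^-1 ^+ (N + n.+1) * (`|b| ^+ M * normc (coef phi g a b)) <=
  C * K ^+ (N + M) * (fpow N (s - rho1) * fpow M t) * env (a, b)].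
Proof.
have [K [C [K1 C0 h]]] := coef_small_scale n0 h1 h2 ht hs gphi gg.
have [K' [C' [K'1 C'0 h']]] := decay_absorb2 K1 C0.
have K'0 : 0 <= K' by exact: le_trans ler01 K'1.
have [L [M0 [KL M00 hM]]] := @degree_shift R (s - rho1) K' n.+1 sr0 K'1.
have L1 : 1 <= L by exact: le_trans KL.
have L0 : 0 <= L by exact: le_trans ler01 L1.
exists L, (2 * (M0 * C')); split; rewrite ?mulr_ge0// => a b N M a0 a1.
have ai0 : 0 <= a^-1 by rewrite invr_ge0 ltW.
have D0 : 0 <= C' * K' ^+ M * fpow M t * decay b.
  by rewrite !mulr_ge0 ?exprn_ge0 ?fpow_ge0 ?decay_ge0.
apply: le_trans (hM _ a^-1 (`|b| ^+ M * normc (coef phi g a b)) D0 _ N) _ => [N'|].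
  have : 0 <= a^-1 ^+ N' * normc (coef phi g a b) by rewrite mulr_ge0 ?normc_ge0 ?exprn_ge0.
  move=> /h' /(_ (fpow_ge0 N' (s - rho1))) => h''.
  have {h''} := h'' b N' _ M; rewrite mulrCA => h''; apply: le_trans (h'' _) _ => [M'|].
    by rewrite mulrCA; apply: h.
  by rewrite le_eqVlt; apply/orP; left; apply/eqP; rewrite exprD; ring.
have e2 : decay b <= 2 * env (a, b).
  rewrite /env /= mulrA ler_peMl ?decay_ge0// ler_pdivlMr ?mul1r; last first.
    by rewrite ltr_pwDl// sqr_ge0.
  by rewrite (_ : 2 = 1 + 1)// lerD2l expr_le1// ltW.
rewrite [leLHS](_ : _ = M0 * C' * (L ^+ N * K' ^+ M) * (fpow N (s - rho1) * fpow M t) * decay b); last by ring.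
rewrite [leRHS](_ : _ = M0 * C' * L ^+ (N + M) * (fpow N (s - rho1) * fpow M t) * (2 * env (a, b))); last by ring.
apply: ler_pM => //.
- by rewrite !mulr_ge0 ?exprn_ge0 ?fpow_ge0.
- exact: decay_ge0.
rewrite ler_wpM2r ?mulr_ge0 ?fpow_ge0// ler_wpM2l ?mulr_ge0// exprD.
by rewrite ler_wpM2l ?exprn_ge0// lerXn2r ?nnegrE.
Qed.

Lemma coef_large_decay : exists K C : R, [/\ 1 <= K, 0 <= C & forall a b N M, 1 <= a ->
  a ^+ N * (`|b| ^+ M * normc (coef phi g a b)) <=
  C * K ^+ (N + M) * (fpow N (t - rho2) * fpow M t) * env (a, b)].
Proof.
have [K [C [K1 C0 h]]] := coef_large_scale n0 h1 h2 ht hs gphi gg.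
have [K' [C' [K'1 C'0 h']]] := decay_absorb2 K1 C0.
have K'0 : 0 <= K' by exact: le_trans ler01 K'1.
have [L [M0 [KL M00 hM]]] := @degree_shift R (t - rho2) K' 2 tr0 K'1.
have L1 : 1 <= L by exact: le_trans KL.
have L0 : 0 <= L by exact: le_trans ler01 L1.
exists L, (2 * (M0 * C')); split; rewrite ?mulr_ge0// => a b N M a1.
have a0 : 0 <= a by exact: le_trans a1.
have D0 : 0 <= C' * K' ^+ M * fpow M t * decay b.
  by rewrite !mulr_ge0 ?exprn_ge0 ?fpow_ge0 ?decay_ge0.
have : a ^+ (N + 2) * (`|b| ^+ M * normc (coef phi g a b)) <=
    M0 * (C' * K' ^+ M * fpow M t * decay b) * L ^+ N * fpow N (t - rho2).
  apply: hM => // N'.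
  have : 0 <= a ^+ N' * normc (coef phi g a b) by rewrite mulr_ge0 ?normc_ge0 ?exprn_ge0.
  move=> /h' /(_ (fpow_ge0 N' (t - rho2))) => h''.
  have {h''} := h'' b N' _ M; rewrite mulrCA => h''; apply: le_trans (h'' _) _ => [M'|].
    by rewrite mulrCA; apply: h.
  by rewrite le_eqVlt; apply/orP; left; apply/eqP; rewrite exprD; ring.
set X := `|b| ^+ M * _ => hX.
have X0 : 0 <= X by rewrite mulr_ge0 ?normc_ge0 ?exprn_ge0.
have q0 : 0 < 1 + a ^+ 2 by rewrite ltr_pwDl// sqr_ge0.
rewrite /env /= [leRHS]mulrA [leRHS]mulrAC ler_pdivlMr//.
apply: (@le_trans _ _ (2 * (a ^+ (N + 2) * X))).
  rewrite exprD [leRHS](_ : _ = a ^+ N * X * (a ^+ 2 + a ^+ 2)); last by ring.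
  apply: ler_wpM2l; first by apply: mulr_ge0 => //; exact: exprn_ge0.
  by rewrite lerD2r exprn_ege1.
rewrite [leRHS](_ : _ = 2 * (M0 * C' * L ^+ (N + M) * (fpow N (t - rho2) * fpow M t) * decay b)); last by ring.
rewrite ler_wpM2l//; apply: le_trans hX _.
rewrite [leLHS](_ : _ = M0 * C' * (L ^+ N * K' ^+ M) * (fpow N (t - rho2) * fpow M t) * decay b); last by ring.
rewrite ler_wpM2r ?decay_ge0//.
rewrite ler_wpM2r ?mulr_ge0 ?fpow_ge0// ler_wpM2l ?mulr_ge0// exprD.
by rewrite ler_wpM2l ?exprn_ge0// lerXn2r ?nnegrE.
Qed.

(** The atom costs a ^ (- n - N) at small scales and a ^ A at large ones. Both are
    absorbed by the decay of the coefficient, and the exponents match: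
    N! ^ rho1 * N! ^ (s - rho1) = N! ^ s and A! ^ rho2 * A! ^ (t - rho2) = A! ^ t. *)
Lemma field_bound : exists K C : R, [/\ 1 <= K, 0 <= C &
  forall w, gs_bound s t K (C * env w) (field psi phi g w)].
Proof.
have [spsi [Kp [Cp [Kp1 Cp0 pB]]] _] := gpsi.
have [K1 [C1 [K11 C10 hS]]] := coef_small_decay.
have [K2 [C2 [K21 C20 hL]]] := coef_large_decay.
have Kp0 : 0 <= Kp by exact: le_trans ler01 Kp1.
have K10 : 0 <= K1 by exact: le_trans ler01 K11.
have K20 : 0 <= K2 by exact: le_trans ler01 K21.
pose K := (2 * Kp) * (K1 * K2); pose C := Cp * (2 * (C1 + C2)).
have kk1 : K1 <= K1 * K2 by rewrite ler_peMr.
have kk2 : K2 <= K1 * K2 by rewrite ler_peMl.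
have K12 : 0 <= K1 * K2 by rewrite mulr_ge0.
have P1 : 1 <= K.
  rewrite /K -[leLHS]mulr1 ler_pM//; last exact: le_trans kk1.
  by rewrite -[leLHS]mulr1 ler_pM// ler1n.
have C0 : 0 <= C by rewrite /C !mulr_ge0// addr_ge0.
exists K, C; split => //.
case=> a b A l x sl; have K0 : 0 <= K by exact: le_trans ler01 P1.
have E0 := ltW (env_gt0 (a, b)).
rewrite /field /=; case: ifPn => [a0|_]; last first.
  rewrite (@smooth0 R n).2 normc0 mulr0; apply: mulr_ge0.
    by apply: mulr_ge0; [exact: mulr_ge0|exact: exprn_ge0].
  by apply: mulr_ge0; exact: fpow_ge0.
have ai0 : 0 <= a^-1 by rewrite invr_ge0 ltW.
rewrite (pderivesZ _ _ _ (smooth_wavelet_atom b a spsi)) !normcM normc_real ger0_norm//.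
set N := size l; set G := normc _.
have G0 : 0 <= G by exact: normc_ge0.
have := atom_estimate b a0 spsi Kp1 Cp0 pB A x sl; rewrite -/N => hA.
rewrite mulrCA; apply: le_trans (ler_wpM2l (mulr_ge0 ai0 G0) hA) _.
have -> : a^-1 * G * (Cp * (2 * Kp) ^+ (A + N) * (a ^- n * a^-1 ^+ N) *
    (a ^+ A * fpow A rho2 + `|b| ^+ A) * fpow N rho1) =
  Cp * (2 * Kp) ^+ (A + N) * fpow N rho1 * (a^-1 ^+ (N + n.+1) *
    (a ^+ A * fpow A rho2 * G + `|b| ^+ A * G)).
  by rewrite (exprD a^-1) exprS -exprVn; ring.
have fs : fpow N s = fpow N rho1 * fpow N (s - rho1).
  by rewrite -fpowD; congr (fpow _ _); ring.
have -> : C * env (a, b) * K ^+ (A + N) * (fpow A t * fpow N s) =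
  Cp * (2 * Kp) ^+ (A + N) * fpow N rho1 *
   ((C1 + C2) * (K1 * K2) ^+ (A + N) * (fpow N (s - rho1) * fpow A t) * env (a, b) +
    (C1 + C2) * (K1 * K2) ^+ (A + N) * (fpow N (s - rho1) * fpow A t) * env (a, b)).
  by rewrite fs /C /K exprMn; ring.
rewrite ler_wpM2l ?mulr_ge0 ?exprn_ge0 ?fpow_ge0 ?mulr_ge0//.
set W := (C1 + C2) * _ * _ * _.
have powle (C' L : R) m : 0 <= C' -> 1 <= L -> C' <= C1 + C2 -> L <= K1 * K2 -> (m <= A + N)%N ->
   C' * L ^+ m <= (C1 + C2) * (K1 * K2) ^+ (A + N).
  move=> C'0 L1 CC LL mA; have L0 : 0 <= L by exact: le_trans ler01 L1.
  apply: ler_pM => //; first exact: exprn_ge0.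
  apply: (@le_trans _ _ (L ^+ (A + N))); first by rewrite ler_weXn2l.
  by rewrite lerXn2r ?nnegrE.
have cc1 : C1 <= C1 + C2 by rewrite lerDl.
have cc2 : C2 <= C1 + C2 by rewrite lerDr.
have f0N := fpow_ge0 N (s - rho1); have f0A := fpow_ge0 A t.
have f1A := fpow_ge1 A t0; have f1N := fpow_ge1 N sr0.
have C12 : 0 <= C1 + C2 by rewrite addr_ge0.
have KK0 : 0 <= (K1 * K2) ^+ (A + N) by rewrite exprn_ge0.
have [a1|a1] := leP a 1.
  have s1 := hS a b N 0%N a0 a1; have s2 := hS a b N A a0 a1.
  rewrite -/G expr0 mul1r fpow0 mulr1 addn0 in s1; rewrite -/G in s2.
  rewrite mulrDr; apply: lerD.
    apply: (@le_trans _ _ (fpow A t * (a^-1 ^+ (N + n.+1) * G))).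
      rewrite [leRHS]mulrCA; apply: ler_wpM2l; first exact: exprn_ge0.
      apply: ler_wpM2r => //.
      rewrite -[leRHS]mul1r ler_pM ?exprn_ge0 ?fpow_ge0 ?(ltW a0)//.
        by rewrite exprn_ile1// ltW.
      exact: fpow_monoR.
    apply: le_trans (ler_wpM2l f0A s1) _.
    rewrite /W [leLHS](_ : _ = C1 * K1 ^+ N * (fpow N (s - rho1) * fpow A t) * env (a, b)); last by ring.
    rewrite ler_wpM2r// ler_wpM2r ?mulr_ge0//; apply: powle => //; exact: leq_addl.
  apply: le_trans s2 _; rewrite /W ler_wpM2r// ler_wpM2r ?mulr_ge0//; apply: powle => //.
  by rewrite addnC.
have a1' := ltW a1.
have l1 := hL a b A 0%N a1'; have l2 := hL a b 0%N A a1'.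
rewrite -/G expr0 mul1r fpow0 mulr1 addn0 in l1; rewrite -/G expr0 mul1r add0n fpow0 mul1r in l2.
apply: (@le_trans _ _ (fpow A rho2 * (a ^+ A * G) + `|b| ^+ A * G)).
  rewrite (_ : a ^+ A * fpow A rho2 * G = fpow A rho2 * (a ^+ A * G)); last by ring.
  rewrite ler_piMl ?exprn_ile1 ?invf_le1//.
  by rewrite addr_ge0 ?mulr_ge0 ?exprn_ge0 ?fpow_ge0// ltW.
apply: lerD.
  apply: le_trans (ler_wpM2l (fpow_ge0 _ _) l1) _.
  have ft : fpow A t = fpow A rho2 * fpow A (t - rho2).
    by rewrite -fpowD; congr (fpow _ _); ring.
  rewrite [leLHS](_ : _ = C2 * K2 ^+ A * (1 * fpow A t) * env (a, b)); last first.
    by rewrite ft; ring.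
  rewrite /W ler_wpM2r//; apply: ler_pM.
  - by rewrite mulr_ge0 ?exprn_ge0.
  - by rewrite mul1r.
  - by apply: powle => //; exact: leq_addr.
  - by rewrite ler_wpM2r.
apply: le_trans l2 _; rewrite /W ler_wpM2r//; apply: ler_pM => //.
- by rewrite mulr_ge0 ?exprn_ge0.
- by apply: powle => //; exact: leq_addr.
- by rewrite ler_peMl.
Qed.

End estimates.

End wavelet_field.

(** * Uniform continuity of the family *)

Section uniform_continuity.
Context {R : realType} {n : nat}.
Local Notation V := 'rV[R]_n.
Implicit Types (h : V -> R[i]).

Lemma continuous_dist_real (f : V -> R) x (e : R) : continuous f -> 0 < e ->
  exists2 d : R, 0 < d & forall y : V, `|x - y| < d -> `|f x - f y| <= e.
Proof.
move=> cf e0; have /cvgrPdist_le /(_ e e0) : f @ x --> f x by exact: cf.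
move=> /nbhs_ballP[d /= d0 D]; exists d => // y xy.
by apply: D; rewrite -ball_normE.
Qed.

Lemma continuous_dist h x (e : R) : continuous (fun x : V => complex.Re (h x)) ->
  continuous (fun x : V => complex.Im (h x)) -> 0 < e ->
  exists2 d : R, 0 < d & forall y : V, `|x - y| < d -> normc (h x - h y) <= e.
Proof.
move=> c1 c2 e0; have e2 : 0 < e / 2 by rewrite divr_gt0.
have [d1 d10 D1] := continuous_dist_real x c1 e2.
have [d2 d20 D2] := continuous_dist_real x c2 e2.
exists (Num.min d1 d2); first by rewrite lt_min d10.
move=> y; rewrite lt_min => /andP[/D1 y1 /D2 y2].
apply: le_trans (normc_le_ReIm _) _; rewrite cReD cImD cReN cImN.
by rewrite [leRHS](splitr e) lerD.
Qed.

(** Heine's theorem on the ball; y may lie outside it. *)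
Lemma ucont_ball h (r e : R) : continuous (fun x : V => complex.Re (h x)) ->
  continuous (fun x : V => complex.Im (h x)) -> 0 < r -> 0 < e ->
  exists2 d : R, 0 < d & forall x y : V, `|x| <= r -> `|x - y| <= d -> normc (h x - h y) <= e.
Proof.
move=> c1 c2 r0 e0; have e2 : 0 < e / 2 by rewrite divr_gt0.
have cB : compact [set x : V | `|x| <= r].
  apply: bounded_closed_compact.
    by exists r; split; rewrite ?num_real// => M rM x /= xr; exact: le_trans (ltW rM).
  have := @closed_ball_closed R V 0 r; rewrite closed_ballE//.
  congr closed; apply/seteqP; split => x /=; by rewrite /closed_ball_/= sub0r normrN.
have /compact_near_coveringP cover := cB.
have : \forall d \near 0^'+, [set x : V | `|x| <= r] `<=`
    (fun x => forall y, `|x - y| <= d -> normc (h x - h y) <= e).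
  apply: cover => x _.
  have [d d0 D] := continuous_dist x c1 c2 e2.
  have d2 : 0 < d / 2 by rewrite divr_gt0.
  exists ([set z : V | `|x - z| < d / 2], [set t : R | t < d / 2]) => /=.
    split; first exact: (@cvgr_dist_lt _ _ _ (nbhs x) _ id x (@cvg_id _ _) _ d2).
    exact: nbhs_right_lt.
  move=> [z t] /= [xz td] y zy.
  have hz : normc (h x - h z) <= e / 2 by apply: D; apply: lt_trans xz _; rewrite ltr_pdivrMr// ltr_pMr// ltr1n.
  have hy : normc (h x - h y) <= e / 2.
    apply: D; rewrite (_ : x - y = (x - z) + (z - y)); last by rewrite addrA subrK.
    apply: le_lt_trans (ler_normD _ _) _; rewrite [ltRHS](splitr d).
    by apply: ltr_leD => //; apply: le_trans zy (ltW td).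
  rewrite (_ : h z - h y = (h x - h y) - (h x - h z)); last by ring.
  apply: le_trans (le_normcD _ _) _; rewrite normcN.
  by rewrite [leRHS](splitr e) lerD.
move=> hh; have [d [hd d0]] := filter_ex (filterI hh (nbhs_right_gt (0 : R))).
by exists d => // x y xr; exact: hd.
Qed.

Lemma ucont_vanishing h (c e : R) : continuous (fun x : V => complex.Re (h x)) ->
  continuous (fun x : V => complex.Im (h x)) ->
  (forall x, `|x| * normc (h x) <= c) -> 0 < e ->
  exists2 d : R, 0 < d & forall x y : V, `|x - y| <= d -> normc (h x - h y) <= e.
Proof.
move=> c1 c2 hc e0; have c0 : 0 <= c.
  by apply: le_trans (hc 0); rewrite mulr_ge0 ?normc_ge0.
pose r := 2 * c / e + 1.
have r0 : 0 < r by rewrite ltr_wpDl// divr_ge0 ?mulr_ge0// ltW.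
have r1 : 0 < r + 1 by rewrite ltr_wpDr.
have [d d0 hd] := ucont_ball c1 c2 r1 e0.
exists (Num.min d 1); first by rewrite lt_min d0 ltr01.
move=> x y; rewrite le_min => /andP[xd x1].
have [xr|xr] := leP `|x| (r + 1); first exact: hd.
have yr : r <= `|y|.
  have : `|x| <= `|y| + `|x - y|.
    by rewrite -[X in `|X| <= _](subrK y x) addrC; exact: ler_normD.
  move=> h1; have {h1} := le_trans (ltW xr) (le_trans h1 (lerD (lexx _) x1)).
  by rewrite lerD2r.
have far z : r <= `|z| -> normc (h z) <= e / 2.
  move=> rz; have z0 : 0 < `|z| by exact: lt_le_trans rz.
  rewrite -(ler_pM2l z0); apply: le_trans (hc z) _.
  have : 2 * c / e <= `|z| by apply: le_trans rz; rewrite lerDl.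
  rewrite ler_pdivrMr// => h1; rewrite mulrA ler_pdivlMr//.
  by rewrite mulrC.
apply: le_trans (le_normcD _ _) _.
rewrite normcN [leRHS](splitr e); apply: lerD; apply: far => //.
by apply: le_trans (ltW xr); rewrite lerDl.
Qed.

(** Functions bounded and uniformly continuous on D, for closeness measured by
    nr; they form an algebra. *)
Definition bucont (Z : Type) (D : Z -> Prop) (nr : R -> Z -> Z -> Prop) (f : Z -> R[i]) :=
  (exists2 B : R, 0 <= B & forall z, D z -> normc (f z) <= B) /\
  (forall e : R, 0 < e -> exists2 d : R, 0 < d &
     forall z z', D z -> D z' -> nr d z z' -> normc (f z - f z') <= e).

Lemma bucontM (Z : Type) (D : Z -> Prop) (nr : R -> Z -> Z -> Prop) (f g : Z -> R[i]) :
  (forall d d' z z', d <= d' -> nr d z z' -> nr d' z z') ->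
  bucont D nr f -> bucont D nr g -> bucont D nr (fun z => f z * g z).
Proof.
move=> mono [[B B0 fB] fc] [[B' B'0 gB] gc]; split.
  exists (B * B'); first exact: mulr_ge0.
  by move=> z Dz; rewrite normcM ler_pM ?normc_ge0 ?fB ?gB.
move=> e e0; pose e' := e / 2 / (B + B' + 1).
have q0 : 0 < B + B' + 1 by rewrite ltr_wpDl ?addr_ge0.
have e'0 : 0 < e' by rewrite !divr_gt0.
have [d1 d10 h1] := fc e' e'0; have [d2 d20 h2] := gc e' e'0.
exists (Num.min d1 d2); first by rewrite lt_min d10.
move=> z z' Dz Dz' zz.
have z1 : normc (f z - f z') <= e'.
  by apply: h1 => //; apply: mono zz; rewrite ge_min lexx.
have z2 : normc (g z - g z') <= e'.
  by apply: h2 => //; apply: mono zz; rewrite ge_min lexx orbT.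
rewrite (_ : f z * g z - f z' * g z' = (f z - f z') * g z + f z' * (g z - g z')); last by ring.
apply: le_trans (le_normcD _ _) _; rewrite !normcM [leRHS](splitr e).
have ee : e' * (B + B' + 1) = e / 2 by rewrite /e' divfK// gt_eqF.
apply: lerD; rewrite -ee.
  apply: ler_pM; rewrite ?normc_ge0//; apply: le_trans (gB z Dz) _.
  by rewrite -addrA addrCA lerDl addr_ge0.
rewrite mulrC; apply: ler_pM; rewrite ?normc_ge0//; apply: le_trans (fB z' Dz') _.
by rewrite -addrA lerDl addr_ge0.
Qed.

Lemma bucontX (Z : Type) (D : Z -> Prop) (nr : R -> Z -> Z -> Prop) (f : Z -> R[i]) k :
  (forall d d' z z', d <= d' -> nr d z z' -> nr d' z z') ->
  bucont D nr f -> bucont D nr (fun z => f z ^+ k).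
Proof.
move=> mono fb; elim: k => [|k IH].
  split; first by exists 1 => // z _; rewrite expr0 normc1.
  by move=> e e0; exists 1 => // z z' _ _ _; rewrite !expr0 subrr normc0 ltW.
have -> : (fun z => f z ^+ k.+1) = fun z => f z * f z ^+ k.
  by apply/funext => z; rewrite exprS.
exact: bucontM.
Qed.

End uniform_continuity.

Section field_continuity.
Context {R : realType} {n : nat}.
Hypothesis n0 : (0 < n)%N.
Local Notation V := 'rV[R]_n.
Local Notation leb := (@lebesgue_rV R n).
Implicit Types (F phi g psi : V -> R[i]) (K C a : R) (x b : V) (w : R * V).

(** The derivatives of g are bounded and phi has a first moment. *)
Lemma coef_lipschitz s1 t1 s2 t2 phi g : 0 <= s1 -> 0 <= t1 -> 0 <= s2 -> 0 <= t2 ->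
  gs0 s1 t1 phi -> gs0 s2 t2 g -> exists2 L : R, 0 <= L & forall a b a' b',
  normc (coef phi g a b - coef phi g a' b') <= L * (`|a - a'| + `|b - b'|).
Proof.
move=> s10 t10 s20 t20 gphi gg.
have [sg [Kg [Cg [Kg1 Cg0 gB]]] _] := gg.
have [sp [Kp [Cp [Kp1 Cp0 pB]]] _] := gphi.
have [K [M [KK M0 hM]]] := @gs_bound_decay R n s1 t1 Kp s10 t10 Kp1.
have {}hM := hM _ _ Cp0 pB.
pose B := Cg * Kg ^+ 1 * (fpow 0 t2 * fpow 1 s2).
have Kg0 : 0 <= Kg by exact: le_trans ler01 Kg1.
have K0 : 0 <= K by apply: le_trans KK; exact: le_trans ler01 Kp1.
have B0 : 0 <= B by rewrite /B !mulr_ge0 ?exprn_ge0 ?fpow_ge0.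
pose Q0 := M * Cp * K ^+ 0 * (fpow 0 t1 * fpow 0 s1).
pose Q1 := M * Cp * K ^+ 1 * (fpow 1 t1 * fpow 0 s1).
have Q00 : 0 <= Q0 by rewrite /Q0 !mulr_ge0 ?exprn_ge0 ?fpow_ge0.
have Q10 : 0 <= Q1 by rewrite /Q1 !mulr_ge0 ?exprn_ge0 ?fpow_ge0.
pose I := (\int[leb]_u decay u)%R.
have I0 : 0 <= I by apply: Rintegral_ge0 => u _; exact: decay_ge0.
exists (2 * (2 * B * n%:R * (Q0 + Q1)) * I).
  by rewrite mulr_ge0// mulr_ge0// mulr_ge0 ?addr_ge0// mulr_ge0// mulr_ge0.
move=> a b a' b'; rewrite /coef.
have i1 := integrable_mul_affine b a s10 t10 gg gphi.
have i2 := integrable_mul_affine b' a' s10 t10 gg gphi.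
rewrite -integralCB//.
set d := `|a - a'| + `|b - b'|; have d0 : 0 <= d by rewrite addr_ge0.
pose W := 2 * B * n%:R * (Q0 + Q1) * d.
have iW : leb.-integrable setT (fun u : V => (W * decay u)%:E).
  by under eq_fun do rewrite EFinM; apply: integrableZl => //; exact: integrable_decay.
have pt (u : V) : normc (phi u * g (a *: u + b) - phi u * g (a' *: u + b')) <= W * decay u.
  rewrite -mulrBr normcM.
  set v := (a - a') *: u + (b - b').
  have E : a *: u + b = (a' *: u + b') + v.
    by rewrite /v scalerBl addrACA [a' *: u + _]addrC subrK [b' + _]addrC subrK.
  have hv : `|v| <= d * (1 + `|u|).
    apply: le_trans (ler_normD _ _) _; rewrite normrZ /d.
    rewrite [leRHS](_ : _ = `|a - a'| * `|u| + `|b - b'| + (`|a - a'| + `|b - b'| * `|u|)).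
      by rewrite lerDl addr_ge0// mulr_ge0.
    by ring.
  have := @mean_value R n g (a' *: u + b') v B sg B0.
  rewrite -E => mv; have {mv} : normc (g (a *: u + b) - g (a' *: u + b')) <= 2 * B * (n%:R * `|v|).
    apply: mv => i z _; have := gB 0%N [:: i] z isT; rewrite expr0 mul1r.
    exact.
  move=> mv.
  have p0 := hM 0%N [::] u isT; have p1 := hM 1%N [::] u isT.
  rewrite expr0 mul1r -/Q0 in p0; rewrite expr1 -/Q1 in p1.
  apply: (@le_trans _ _ (normc (phi u) * (2 * B * (n%:R * (d * (1 + `|u|)))))).
    rewrite ler_wpM2l ?normc_ge0//; apply: le_trans mv _.
    by apply: ler_wpM2l; [exact: mulr_ge0|exact: ler_wpM2l].
  rewrite [leLHS](_ : _ = 2 * B * n%:R * d * (normc (phi u) + `|u| * normc (phi u))); last by ring.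
  rewrite /W [leRHS](_ : _ = 2 * B * n%:R * d * (Q0 * decay u + Q1 * decay u)); last by ring.
  apply: ler_wpM2l; last exact: lerD.
  by apply: mulr_ge0 d0; apply: mulr_ge0 => //; exact: mulr_ge0.
have iD := integrableCB i1 i2.
apply: le_trans (normc_integralC_le iD iW pt) _.
rewrite RintegralZl//; last exact: integrable_decay.
by rewrite /W -/I le_eqVlt; apply/orP; left; apply/eqP; ring.
Qed.

Lemma field_pderives psi phi g w l x : smooth psi -> 0 < w.1 ->
  pderives l (field psi phi g w) x = coef phi g w.1 w.2 *
   ((w.1^-1)%:C ^+ (n + size l).+1 * (pderives l psi (w.1^-1 *: (x - w.2)))^*).
Proof.
move=> sp w0; rewrite /field w0 (pderivesZ _ _ _ (smooth_wavelet_atom _ _ sp)) pderives_atom//.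
rewrite -exprVn -exprD rmorphXn/= exprS; ring.
Qed.

Section estimates.
Variables (rho1 rho2 s t : R).
Hypotheses (h1 : 0 < rho1) (h2 : 1 < rho2) (ht : rho1 + rho2 < t) (hs : rho1 + rho2 - 1 < s).
Local Notation sigma := (rho1 + rho2 - 1).
Variables psi phi g : V -> R[i].
Hypotheses (gpsi : gs0 rho1 rho2 psi) (gphi : gs0 rho1 rho2 phi)
  (gg : gs0 (s - sigma) (t - sigma) g).

Let s0 : 0 <= s. Proof. by move: h1 h2 hs => ? ? ?; lra. Qed.
Let t0 : 0 <= t. Proof. by move: h1 h2 ht => ? ? ?; lra. Qed.
Let r10 : 0 <= rho1. Proof. exact: ltW. Qed.
Let r20 : 0 <= rho2. Proof. by move: h2 => ?; lra. Qed.
Let rho1_le : rho1 <= s. Proof. by move: h2 hs => ? ?; lra. Qed.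
Let rho2_le : rho2 <= t. Proof. by move: h1 ht => ? ?; lra. Qed.
Let s10 : 0 <= s - sigma. Proof. by rewrite subr_ge0 ltW. Qed.
Let t10 : 0 <= t - sigma. Proof. by move: h1 h2 ht => ? ? ?; lra. Qed.

Lemma gs0_field w : gs0 s t (field psi phi g w).
Proof.
rewrite /field; case: ifPn => [w0|_]; last exact: gs00.
apply: gs0Z => //; apply: gs0_mono (gs0_atom _ _ _ w0 gpsi) => //.
Qed.

(** The compact subsets of the upper half-space that exhaust it. *)
Definition slab (m : R) : set (R * V) := [set w | m^-1 <= w.1 <= m /\ `|w.2| <= m].

(** Each derivative of the family is a product of powers of 1 / a, the coefficient
    and a derivative of psi at (x - b) / a, which vanishes at infinity and is
    therefore uniformly continuous. *)
Lemma bucont_field (m r : R) l : 0 < m -> 0 <= r -> sorted lei l ->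
  bucont (fun z : (R * V) * V => slab m z.1 /\ `|z.2| <= r)
   (fun (d : R) z z' => [/\ `|z.1.1 - z'.1.1| <= d, `|z.1.2 - z'.1.2| <= d & z.2 = z'.2])
   (fun z => pderives l (field psi phi g z.1) z.2).
Proof.
move=> m0 r0 sl; set D := fun z : (R * V) * V => _; set nr := fun d : R => _.
have mono (d d' : R) z z' : d <= d' -> nr d z z' -> nr d' z z'.
  by move=> dd [x1 x2 x3]; split => //; exact: le_trans dd.
have [sp [Kp [Cp [Kp1 Cp0 pB]]] _] := gpsi.
have mi0 : 0 < m^-1 by rewrite invr_gt0.
have pos (z : (R * V) * V) : D z -> [/\ 0 < z.1.1, z.1.1^-1 <= m & 0 <= z.1.1^-1].
  move=> [[/andP[z1 _] _] _]; have z0 := lt_le_trans mi0 z1; split => //.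
    by rewrite -[m]invrK lef_pV2// posrE.
  by rewrite invr_ge0 ltW.
have invd (z z' : (R * V) * V) : D z -> D z' -> `|z.1.1^-1 - z'.1.1^-1| <= m ^+ 2 * `|z.1.1 - z'.1.1|.
  move=> /pos[a0 am ai] /pos[a0' am' ai'].
  rewrite (_ : z.1.1^-1 - z'.1.1^-1 = (z.1.1^-1 * z'.1.1^-1) * (z'.1.1 - z.1.1)); last first.
    by field; rewrite !gt_eqF.
  rewrite normrM distrC ler_wpM2r// ger0_norm ?mulr_ge0// expr2.
  exact: ler_pM.
have b1 : bucont D nr (fun z => (z.1.1^-1)%:C).
  split.
    by exists m => [|z /pos[_ am ai]]; rewrite ?(ltW m0)// normc_real ger0_norm.
  move=> e e0; exists (e / m ^+ 2); first by rewrite divr_gt0// exprn_gt0.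
  move=> z z' Dz Dz' [zz _ _]; rewrite -rmorphB normc_real.
  apply: le_trans (invd z z' Dz Dz') _.
  by rewrite -ler_pdivlMl ?exprn_gt0// mulrC.
have [L L0 hL] := coef_lipschitz r10 r20 s10 t10 gphi gg.
have b2 : bucont D nr (fun z => coef phi g z.1.1 z.1.2).
  split.
    exists (normc (coef phi g 0 0) + L * (m + m)).
      by rewrite addr_ge0 ?normc_ge0// mulr_ge0// addr_ge0// ltW.
    move=> z Dz; have [a0 _ _] := pos z Dz; have [[/andP[_ zm] zm'] _] := Dz.
    rewrite -[coef phi g z.1.1 z.1.2](subrK (coef phi g 0 0)) addrC.
    apply: le_trans (le_normcD _ _) _; rewrite lerD2l; apply: le_trans (hL _ _ _ _) _.
    by rewrite ler_wpM2l// !subr0 lerD// gtr0_norm.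
  move=> e e0; exists (e / 2 / (L + 1)); first by rewrite !divr_gt0// ltr_wpDl.
  move=> z z' Dz Dz' [zz1 zz2 _]; apply: le_trans (hL _ _ _ _) _.
  apply: (@le_trans _ _ ((L + 1) * (e / 2 / (L + 1) + e / 2 / (L + 1)))).
    by apply: ler_pM; [|exact: addr_ge0|rewrite lerDl|exact: lerD].
  rewrite le_eqVlt; apply/orP; left; apply/eqP; field.
  by rewrite gt_eqF// ltr_wpDl.
have b3 : bucont D nr (fun z => (pderives l psi (z.1.1^-1 *: (z.2 - z.1.2)))^*).
  pose h := pderives l psi.
  have [c1 c2] := smooth_continuous l sp.
  have hB x : `|x| * normc (h x) <= Cp * Kp ^+ (1 + size l) * (fpow 1 rho2 * fpow (size l) rho1).
    by have := pB 1%N l x sl; rewrite expr1.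
  split.
    exists (Cp * Kp ^+ (0 + size l) * (fpow 0 rho2 * fpow (size l) rho1)).
      rewrite !mulr_ge0 ?exprn_ge0 ?fpow_ge0//; exact: le_trans ler01 Kp1.
    by move=> z _; rewrite normc_conj; have := pB 0%N l (z.1.1^-1 *: (z.2 - z.1.2)) sl; rewrite expr0 mul1r.
  move=> e e0; have [d d0 hd] := ucont_vanishing c1 c2 hB e0.
  pose q := m ^+ 2 * (r + m) + m.
  have q0 : 0 < q by rewrite ltr_wpDl// mulr_ge0 ?exprn_ge0 ?addr_ge0// ltW.
  exists (d / q); first by rewrite divr_gt0.
  move=> z z' Dz Dz' [zz1 zz2 zz3].
  rewrite -rmorphB normc_conj; apply: hd.
  have [a0 am ai] := pos z Dz; have [a0' am' ai'] := pos z' Dz'.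
  have -> : z.1.1^-1 *: (z.2 - z.1.2) - z'.1.1^-1 *: (z'.2 - z'.1.2) =
     (z.1.1^-1 - z'.1.1^-1) *: (z.2 - z.1.2) - z'.1.1^-1 *: (z.1.2 - z'.1.2).
    rewrite -zz3 scalerBl -addrA; congr (_ + _); rewrite -opprD -scalerDr.
    by rewrite addrA subrK.
  apply: le_trans (ler_normB _ _) _; rewrite !normrZ (ger0_norm ai').
  have dq : d = m ^+ 2 * (d / q) * (r + m) + m * (d / q).
    by rewrite /q; field; rewrite gt_eqF// /q.
  rewrite [leRHS]dq; apply: lerD.
    apply: ler_pM => //.
      by apply: le_trans (invd z z' Dz Dz') _; rewrite ler_wpM2l ?exprn_ge0// ltW.
    apply: le_trans (ler_normB _ _) _; case: Dz => [[_ ?] ?]; exact: lerD.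
  by apply: ler_pM.
have b4 := bucontM mono b2 (bucontM mono (bucontX (n + size l).+1 mono b1) b3).
have [[B B0 hB] hU] := b4; split.
  exists B => // z Dz; have [a0 _ _] := pos _ Dz; rewrite field_pderives//.
  exact: hB.
move=> e /hU[d d0 hd]; exists d => // z z' Dz Dz' zz.
have [a0 _ _] := pos _ Dz; have [a0' _ _] := pos _ Dz'.
rewrite !field_pderives//; exact: hd.
Qed.

End estimates.

End field_continuity.

(** * Functionals commute with the integral of the family *)

Section partition.
Context {R : realType} {n : nat}.
Local Notation V := 'rV[R]_n.

Lemma cells_finite k (m : R) : 0 < m -> exists r : seq (int * {ffun 'I_n -> int}),
  uniq r /\ forall w : R * V, slab m w -> cellp k w \in r.
Proof.
move=> m0; pose N := (Num.truncn (k.+1%:R * m)).+1.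
pose shift (i : 'I_(N + N).+1) : int := (i : nat)%:Z - N%:Z.
pose mk (z : 'I_(N + N).+1 * {ffun 'I_n -> 'I_(N + N).+1}) : int * {ffun 'I_n -> int} :=
  (shift z.1, [ffun i => shift (z.2 i)]).
exists (undup [seq mk z | z <- enum {: 'I_(N + N).+1 * {ffun 'I_n -> 'I_(N + N).+1}}]).
split; first exact: undup_uniq.
move=> [a b] [/= /andP[a1 am] bm]; rewrite mem_undup.
have key (y : R) : `|y| <= m -> exists i, Num.floor (k.+1%:R * y) = shift i.
  move=> ym; set z := Num.floor _.
  have k0 : 0 < k.+1%:R :> R by rewrite ltr0n.
  have yN : `|k.+1%:R * y| <= N%:R.
    rewrite normrM (gtr0_norm k0); apply: (@le_trans _ _ (k.+1%:R * m)).
      by rewrite ler_pM2l.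
    by apply/ltW; exact: truncnS_gt.
  move: yN; rewrite ler_norml => /andP[y1 y2].
  have z1 : - N%:Z <= z.
    by rewrite /z floor_ge_int rmorphN.
  have z2 : z <= N%:Z.
    by rewrite -(ler_int R); apply: le_trans y2; exact: floor_le.
  have zN : (absz (z + N%:Z)%R < (N + N).+1)%N.
    rewrite ltnS -lez_nat gez0_abs; last by rewrite -lerBlDr sub0r.
    by rewrite PoszD lerD2r.
  exists (Ordinal zN); rewrite /shift /= gez0_abs ?addrK//.
  by rewrite -lerBlDr sub0r.
have a0 : `|a| <= m by rewrite ger0_norm// (le_trans _ a1)// invr_ge0 ltW.
have [i ai] := key a a0.
have kb j : exists i, Num.floor (k.+1%:R * b ord0 j) = shift i.
  by apply: key; apply: le_trans (coord_le_norm _ _) bm.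
pose c : {ffun 'I_n -> 'I_(N + N).+1} := [ffun j => projT1 (cid (kb j))].
apply/mapP; exists (i, c); first by rewrite mem_enum.
rewrite /cellp /mk /= ai; congr (_, _); apply/ffunP => j; rewrite !ffunE.
by case: cid.
Qed.

End partition.

Section family.
Context {R : realType} {n : nat}.
Hypothesis n0 : (0 < n)%N.
Local Notation V := 'rV[R]_n.
Local Notation mu := (@lebesgue_measure R \x @lebesgue_rV R n)%E.
Variables (s t K C : R) (F : R * V -> V -> R[i]).
Hypotheses (s0 : 0 <= s) (t0 : 0 <= t) (K1 : 1 <= K) (C0 : 0 <= C).
Hypothesis gF : forall w, gs0 s t (F w).
Hypothesis FB : forall w, gs_bound s t K (C * env w) (F w).
Hypothesis F0 : forall w, w.1 <= 0 -> F w = fun=> 0.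
Hypothesis cF : forall (m r : R) l, 0 < m -> 0 <= r -> sorted lei l ->
  bucont (fun z : (R * V) * V => slab m z.1 /\ `|z.2| <= r)
   (fun (d : R) z z' => [/\ `|z.1.1 - z'.1.1| <= d, `|z.1.2 - z'.1.2| <= d & z.2 = z'.2])
   (fun z => pderives l (F z.1) z.2).

Let K0 : 0 <= K. Proof. exact: le_trans ler01 K1. Qed.
Let sF w : smooth (F w). Proof. by case: (gF w). Qed.

Lemma common_radius (T : finType) (P : T -> R -> Prop) :
  (forall x d d', d <= d' -> P x d' -> P x d) ->
  (forall x, exists2 d, 0 < d & P x d) -> exists2 d, 0 < d & forall x, P x d.
Proof.
move=> mono hP.
suff [d d0 hd] : exists2 d : R, 0 < d & forall x, x \in enum T -> P x d.
  by exists d => // x; apply: hd; rewrite mem_enum.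
elim: (enum T) => [|x r [d d0 hd]]; first by exists 1.
have [d' d'0 hd'] := hP x; exists (Num.min d d'); first by rewrite lt_min d0.
move=> y; rewrite inE => /orP[/eqP->|/hd].
  by apply: mono hd'; rewrite ge_min lexx orbT.
by apply: mono; rewrite ge_min lexx.
Qed.

Lemma env_le1 (w : R * V) : env w <= 1.
Proof.
rewrite /env mulr_ile1//.
- by rewrite invr_ge0 addr_ge0// sqr_ge0.
- exact: decay_ge0.
- by rewrite invf_le1 ?lerDl ?sqr_ge0// ltr_pwDl// sqr_ge0.
apply: prodr_ile1 => i _; apply/andP; split.
  by rewrite invr_ge0 addr_ge0// sqr_ge0.
by rewrite invf_le1 ?lerDl ?sqr_ge0// ltr_pwDl// sqr_ge0.
Qed.

Lemma pderivesB w w' l x : pderives l (fun x => F w x - F w' x) x =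
  pderives l (F w) x - pderives l (F w') x.
Proof.
have E : (fun x => F w x - F w' x) = fun x => (-1) * F w' x + F w x.
  by apply/funext => y; rewrite mulN1r addrC.
by rewrite E (smooth_lin (-1) (sF w') (sF w)).2 mulN1r addrC.
Qed.

(** Weighted derivatives of high total order are small because the radius is
    doubled; the finitely many remaining ones are uniformly continuous in w,
    for large x by decay and for bounded x by hypothesis. *)
Lemma family_ucont (m e : R) : 0 < m -> 0 < e -> exists2 d : R, 0 < d &
  forall w w', slab m w -> slab m w' -> `|w.1 - w'.1| <= d -> `|w.2 - w'.2| <= d ->
  gs_bound s t (2 * K) e (fun x => F w x - F w' x).
Proof.
move=> m0 e0.
have FB' w : gs_bound s t K C (F w).
  apply: gs_bound_mono (FB w); first by rewrite K0/=.
  by rewrite mulr_ge0 ?(ltW (env_gt0 _))//= ler_piMr// env_le1.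
have diff w w' A l x : sorted lei l ->
    `|x| ^+ A * normc (pderives l (F w) x - pderives l (F w') x) <=
    2 * C * K ^+ (A + size l) * (fpow A t * fpow (size l) s).
  move=> sl; have b1 := FB' w A l x sl; have b2 := FB' w' A l x sl.
  apply: (@le_trans _ _ (`|x| ^+ A * (normc (pderives l (F w) x) + normc (pderives l (F w') x)))).
    rewrite ler_wpM2l ?exprn_ge0//; apply: le_trans (le_normcD _ _) _.
    by rewrite normcN.
  rewrite mulrDr [leRHS](_ : _ = C * K ^+ (A + size l) * (fpow A t * fpow (size l) s) +
    C * K ^+ (A + size l) * (fpow A t * fpow (size l) s)); last by ring.
  exact: lerD.
have [L hL] : exists L : nat, 2 * C <= e * 2 ^+ L.
  exists (Num.truncn (2 * C / e)).+1.
  rewrite [leRHS]mulrC -ler_pdivrMr//; apply: le_trans (ltW (truncnS_gt _)) _.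
  by rewrite -natrX ler_nat ltnW// ltn_expl.
have small A l (w w' : R * V) x : sorted lei l -> (L <= A + size l)%N ->
    `|x| ^+ A * normc (pderives l (F w) x - pderives l (F w') x) <=
    e * (2 * K) ^+ (A + size l) * (fpow A t * fpow (size l) s).
  move=> sl LA; apply: le_trans (diff w w' A l x sl) _.
  rewrite ler_wpM2r ?mulr_ge0 ?fpow_ge0// exprMn mulrA ler_wpM2r ?exprn_ge0//.
  by apply: le_trans hL _; rewrite ler_wpM2l ?(ltW e0)// ler_weXn2l// ler1n.
have one A l : sorted lei l -> exists2 d : R, 0 < d &
    forall w w', slab m w -> slab m w' -> `|w.1 - w'.1| <= d -> `|w.2 - w'.2| <= d ->
    forall x, `|x| ^+ A * normc (pderives l (F w) x - pderives l (F w') x) <= e.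
  move=> sl; pose c := 2 * C * K ^+ (A.+1 + size l) * (fpow A.+1 t * fpow (size l) s).
  have c0 : 0 <= c by rewrite /c !mulr_ge0 ?exprn_ge0 ?fpow_ge0.
  pose r := c / e + 1.
  have r1 : 1 <= r by rewrite lerDr divr_ge0// ltW.
  have r0 : 0 < r by exact: lt_le_trans r1.
  have [_ /(_ (e / r ^+ A))] := cF m0 (ltW r0) sl.
  move=> []; first by rewrite divr_gt0// exprn_gt0.
  move=> d d0 hd; exists d => // w w' sw sw' w1 w2 x.
  have [xr|xr] := leP `|x| r.
    have := hd (w, x) (w', x) (conj sw xr) (conj sw' xr); rewrite /= => {}hd.
    apply: (@le_trans _ _ (r ^+ A * (e / r ^+ A))); last first.
      by rewrite mulrCA mulfV ?mulr1// gt_eqF// exprn_gt0.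
    apply: ler_pM; rewrite ?exprn_ge0 ?normc_ge0//; last exact: hd.
    by rewrite lerXn2r ?nnegrE// ltW.
  have x0 : 0 < `|x| by exact: lt_trans xr.
  rewrite -(ler_pM2l x0) mulrA -exprS; apply: le_trans (diff w w' A.+1 l x sl) _.
  rewrite -/c -ler_pdivrMr//; apply: le_trans (ltW xr).
  by rewrite lerDl.
have [d d0 hd] : exists2 d : R, 0 < d & forall z : 'I_L * (L.-bseq 'I_n), sorted lei z.2 ->
    forall w w', slab m w -> slab m w' -> `|w.1 - w'.1| <= d -> `|w.2 - w'.2| <= d ->
    forall x, `|x| ^+ z.1 * normc (pderives z.2 (F w) x - pderives z.2 (F w') x) <= e.
  apply: common_radius => [z d d' dd h sz w w' sw sw' w1 w2|z].
    by apply: h => //; [exact: le_trans dd|exact: le_trans dd].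
  have [sz|sz] := boolP (sorted lei z.2); last by exists 1.
  by have [d d0 hd] := one z.1 z.2 sz; exists d.
exists d => // w w' sw sw' w1 w2 A l x sl; rewrite pderivesB.
have [LA|LA] := leqP L (A + size l); first exact: small.
have AL : (A < L)%N by apply: leq_ltn_trans LA; exact: leq_addr.
have lL : (size l <= L)%N by apply: ltnW; apply: leq_ltn_trans LA; exact: leq_addl.
have := hd (Ordinal AL, Bseq lL) sl w w' sw sw' w1 w2 x; rewrite /= => h.
apply: le_trans h _; rewrite -[leLHS]mulr1 -mulrA ler_wpM2l ?(ltW e0)//.
rewrite -[leLHS]mulr1 ler_pM//; first by rewrite exprn_ege1// -[leLHS]mulr1 ler_pM// ler1n.
by rewrite -[leLHS]mulr1 ler_pM ?fpow_ge1.
Qed.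

Lemma slab_neighbourhood (p : R * V) : 0 < p.1 -> exists m d : R, [/\ 0 < m, 0 < d &
  forall q : R * V, `|q.1 - p.1| <= d -> `|q.2 - p.2| <= d -> slab m q].
Proof.
move=> p0; have p2 : 0 < p.1 / 2 by rewrite divr_gt0.
pose m := (p.1 / 2)^-1 + (p.1 + p.1 / 2) + `|p.2|.
have i0 : 0 < (p.1 / 2)^-1 by rewrite invr_gt0.
have m1 : (p.1 / 2)^-1 <= m by rewrite /m -addrA lerDl addr_ge0// addr_ge0 ?ltW.
have m0 : 0 < m by exact: lt_le_trans m1.
exists m, (p.1 / 2); split => // q; rewrite ler_distl => /andP[q1 q2] q3.
split; first (apply/andP; split).
- apply: (@le_trans _ _ (p.1 / 2)); first by rewrite -[leRHS]invrK lef_pV2.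
  by apply: le_trans q1; rewrite {2}(splitr p.1) addrK.
- apply: le_trans q2 _; rewrite /m addrAC lerDr addr_ge0// ltW//.
have -> : q.2 = (q.2 - p.2) + p.2 by rewrite subrK.
apply: le_trans (ler_normD _ _) _; rewrite /m lerD2r; apply: le_trans q3 _.
by rewrite addrA lerDr addr_ge0// ltW.
Qed.

Lemma dual_family_bound f : gs0_dual s t f -> exists2 B : R, 0 <= B &
  (forall w, normc (f (F w)) <= B * (C * env w)) /\
  (forall H e, gs0 s t H -> 0 <= e -> gs_bound s t (2 * K) e H -> normc (f H) <= B * e).
Proof.
move=> df; have K20 : 0 < 2 * K by rewrite mulr_gt0// (lt_le_trans ltr01).
have [B B0 hB] := gs0_dual_bound n0 s0 t0 K20 df; exists B => //; split; last first.
  by move=> H e gH e0; exact: hB.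
move=> w; apply: hB => //; first by rewrite mulr_ge0// ltW// env_gt0.
apply: gs_bound_mono (FB w); first by rewrite K0 ler_peMl// ler1n.
by rewrite lexx mulr_ge0// ltW// env_gt0.
Qed.

Lemma gs0B (H G : V -> R[i]) : gs0 s t H -> gs0 s t G -> gs0 s t (fun x => H x - G x).
Proof.
move=> gH gG; have := gs0_lin (-1) s0 t0 gG gH.
have -> // : (fun x => H x - G x) = fun x => -1 * G x + H x.
by apply/funext => x; rewrite mulN1r addrC.
Qed.

Lemma gs0_dualB f (H G : V -> R[i]) : gs0_dual s t f -> gs0 s t H -> gs0 s t G ->
  f (fun x => H x - G x) = f H - f G.
Proof.
move=> df gH gG; have := gs0_dual_lin n0 (-1) s0 t0 df gG gH.
rewrite mulN1r [- f G + _]addrC => <-; congr f.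
by apply/funext => x; rewrite mulN1r addrC.
Qed.

Lemma measurable_dual_family f : gs0_dual s t f -> measurableC (fun w => f (F w)).
Proof.
move=> df; have [B B0 [hB hB']] := dual_family_bound df.
apply: measurableC_halfspace => [p p0|p p0 e e0].
  by rewrite F0//; exact: gs0_dual0 df.
have [m [d1 [m0 d10 hm]]] := slab_neighbourhood p0.
have e'0 : 0 < e / (B + 1) by rewrite divr_gt0// ltr_wpDl.
have [d2 d20 hd] := family_ucont m0 e'0.
exists (Num.min d1 d2); first by rewrite lt_min d10.
move=> q q0; rewrite !le_min => /andP[a1 a2] /andP[b1 b2].
rewrite -gs0_dualB//; apply: le_trans (hB' _ (e / (B + 1)) _ _ _) _.
- exact: gs0B.
- exact: ltW.
- by apply: hd => //; apply: hm => //; rewrite subrr normr0 ltW.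
by rewrite mulrCA ler_piMr ?(ltW e0)// ler_pdivrMr ?mul1r ?lerDl// ltr_wpDl.
Qed.

Lemma measurable_pderives_family l x : sorted lei l -> measurableC (fun w => pderives l (F w) x).
Proof.
move=> sl; apply: measurableC_halfspace => [p p0|p p0 e e0].
  by rewrite F0// (@smooth0 R n).2.
have [m [d1 [m0 d10 hm]]] := slab_neighbourhood p0.
have [_ /(_ e e0)[d2 d20 hd]] := cF m0 (normr_ge0 x) sl.
exists (Num.min d1 d2); first by rewrite lt_min d10.
move=> q q0; rewrite !le_min => /andP[a1 a2] /andP[b1 b2].
apply: (hd (q, x) (p, x)) => //; split => //; first exact: hm.
by apply: hm; rewrite subrr normr0 ltW.
Qed.

Lemma integrable_env : mu.-integrable setT (fun w : R * V => (env w)%:E).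
Proof.
have := @integrable_prod _ _ _ _ R (@lebesgue_measure R) (@lebesgue_rV R n)
  (fun a : R => (1 + a ^+ 2)^-1) (@decay R n).
apply => //.
- by move=> a; rewrite invr_ge0 addr_ge0// sqr_ge0.
- exact: decay_ge0.
- exact: integrable_oneDsqrV.
- exact: integrable_decay.
Qed.

Lemma measurable_slab (m : R) : measurable (slab m : set (R * V)).
Proof.
rewrite (_ : slab m = (fst @^-1` [set` `[m^-1, m]]) `&`
    ((fun w : R * V => `|w.2|) @^-1` [set` `]-oo, m]])); last first.
  by apply/seteqP; split => w /=; rewrite !in_itv/=.
have mn : measurable_fun setT (fun w : R * V => `|w.2|).
  apply: (measurableT_comp (f := fun x : V => `|x|)); last exact: measurable_snd.
  by apply: measurable_continuous_rV => x; exact: norm_continuous.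
apply: measurableI.
  by rewrite -[X in measurable X]setTI; apply: measurable_fst.
by rewrite -[X in measurable X]setTI; apply: mn.
Qed.

Definition tail (m : R) (w : R * V) : R :=
  env w * \1_([set w : R * V | 0 < w.1] `\` slab m) w.

Lemma measurable_env : measurable_fun setT (@env R n).
Proof. by apply/measurable_EFinP; exact: (measurable_int _ integrable_env). Qed.

Lemma tail_le m w : 0 <= tail m w <= env w.
Proof.
have e0 := ltW (env_gt0 w); rewrite /tail indicE; case: (_ \in _).
  by rewrite mulr1 e0 lexx.
by rewrite mulr0 lexx.
Qed.

Lemma measurable_tail m : measurable_fun setT (tail m).
Proof.
apply: measurable_funM; first exact: measurable_env.
apply: measurable_indic; apply: measurableD; last exact: measurable_slab.
rewrite (_ : [set _ | _] = fst @^-1` [set` `]0, +oo[]); last first.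
  by apply/seteqP; split => w /=; rewrite in_itv/= andbT.
by rewrite -[X in measurable X]setTI; apply: measurable_fst.
Qed.

Lemma integrable_tail m : mu.-integrable setT (fun w => (tail m w)%:E).
Proof.
apply: (@integrable_le _ _ R mu (tail m) (@env R n)).
- exact: measurable_tail.
- exact: integrable_env.
- by move=> w; have /andP[q1 q2] := tail_le m w; rewrite ger0_norm.
Qed.

Lemma tail_vanishes (e : R) : 0 < e -> exists2 m : R, 0 < m & (\int[mu]_w tail m w)%R <= e.
Proof.
move=> e0.
have cv w : (fun k => (tail k.+1%:R w)%:E) @ \oo --> 0%E.
  apply: cvg_near_cst; exists (Num.truncn (w.1^-1 + w.1 + `|w.2|)) => // k /= hk.
  rewrite /tail indicE; case: (boolP (_ \in _)); rewrite ?mulr0//.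
  rewrite inE => -[/= w0 hw]; exfalso; apply: hw.
  have km : w.1^-1 + w.1 + `|w.2| <= k.+1%:R.
    by apply: le_trans (ltW (truncnS_gt _)) _; rewrite ler_nat.
  have i0 : 0 < w.1^-1 by rewrite invr_gt0.
  split; first (apply/andP; split).
  - rewrite -[leRHS]invrK lef_pV2 ?posrE ?ltr0n//; apply: le_trans km.
    by rewrite -addrA lerDl addr_ge0// ltW.
  - by apply: le_trans km; rewrite addrAC lerDr addr_ge0// ltW.
  - by apply: le_trans km; rewrite lerDr addr_ge0// ltW.
have := @dominated_cvg _ _ R mu setT measurableT
  (fun k w => (tail k.+1%:R w)%:E) (fun=> 0%E) (fun w => (env w)%:E).
move=> /(_ (fun k => (measurable_EFinP _ _).2 (measurable_tail _)) (fun w _ => cv w)).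
move=> /(_ (fun _ _ => isT) integrable_env).
have h k w : setT w -> (`|(tail k.+1%:R w)%:E| <= (env w)%:E)%E.
  by move=> _; have /andP[q1 q2] := tail_le k.+1%:R w; rewrite lee_fin ger0_norm.
move=> /(_ h); rewrite integral0 => /fine_cvgP[_ /cvgrPdist_le/(_ e e0)].
move=> [k _ /(_ k (leqnn k))] /=; rewrite sub0r normrN => hk.
exists k.+1%:R => //; apply: le_trans hk; exact: ler_norm.
Qed.

Lemma slab_le_env m : 0 < m -> exists2 c : R, 0 <= c & forall w : R * V, slab m w -> 1 <= c * env w.
Proof.
move=> m0; pose c := (1 + m ^+ 2) * \prod_(i < n) (1 + m ^+ 2).
have q0 : 0 < 1 + m ^+ 2 by rewrite ltr_pwDl// sqr_ge0.
have c0 : 0 < c by rewrite mulr_gt0// prodr_gt0.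
exists c; first exact: ltW.
move=> w [/andP[w1 w2] w3].
have a0 : 0 <= w.1 by apply: le_trans w1; rewrite invr_ge0 ltW.
have key (y : R) : `|y| <= m -> (1 + m ^+ 2)^-1 <= (1 + y ^+ 2)^-1.
  move=> ym; rewrite lef_pV2 ?posrE// ?ltr_pwDl ?sqr_ge0// lerD2l.
  by rewrite -[leLHS]real_normK ?num_real// lerXn2r ?nnegrE// ltW.
rewrite -ler_pdivrMl// mulr1 /env /c invfM; apply: ler_pM.
- by rewrite invr_ge0 ltW.
- by rewrite invr_ge0 ltW// prodr_gt0.
- by apply: key; rewrite ger0_norm.
rewrite -prodfV; apply: ler_prod => i _; rewrite invr_ge0 ltW//=.
by apply: key; apply: le_trans (coord_le_norm _ _) w3.
Qed.

(** The slab is cut into the finitely many grid cells that it meets, of diameter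
    below the modulus of continuity of F, and F is frozen on each of them. *)
Lemma step_partition (m e : R) : 0 < m -> 0 < e ->
  exists (I : eqType) (r : seq I) (E : I -> set (R * V)) (rep : I -> R * V),
  [/\ forall z, measurable (E z), forall z, E z `<=` slab m &
    forall w, slab m w -> exists2 z0,
      (forall X : I -> R[i], \sum_(z <- r) (\1_(E z) w : R)%:C * X z = X z0) &
      gs_bound s t (2 * K) e (fun x => F w x - F (rep z0) x)].
Proof.
move=> m0 e0; have [d d0 hd] := family_ucont m0 e0.
have [k hk] : exists k : nat, k.+1%:R^-1 <= d / 2.
  have d2 : 0 < d / 2 by rewrite divr_gt0.
  exists (Num.truncn (d / 2)^-1); rewrite -[leRHS]invrK lef_pV2 ?posrE ?ltr0n ?invr_gt0//.
  by apply/ltW; exact: truncnS_gt.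
have [r [ur hr]] := @cells_finite R n k m m0.
pose E (z : int * {ffun 'I_n -> int}) : set (R * V) := slab m `&` (cellp k @^-1` [set z]).
pose rep z : R * V := xget (0, 0) (E z).
exists (int * {ffun 'I_n -> int})%type, r, E, rep; split.
- by move=> z; apply: measurableI; [exact: measurable_slab|exact: measurable_cellp].
- by move=> z w [].
move=> w sw; exists (cellp k w).
  move=> X; rewrite (bigD1_seq (cellp k w)) ?hr//= big1 ?addr0.
    by rewrite indicE mem_set ?mul1r.
  move=> z zw; rewrite indicE memNset ?mul0r// => -[_ /= h].
  by rewrite h eqxx in zw.
have Er : E (cellp k w) (rep (cellp k w)) by apply: (@xgetPex _ (0, 0) (E (cellp k w))); exists w; split.
case: Er => sr /= cr; apply: hd => //.
  have e1 := floor_approx_dist k w.1; have e2 := floor_approx_dist k (rep (cellp k w)).1.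
  have : (cellp k (rep (cellp k w))).1 = (cellp k w).1 by rewrite cr.
  rewrite /= => E1; rewrite E1 in e2; set q := _ / _ in e1 e2.
  rewrite (_ : w.1 - (rep (cellp k w)).1 = (q - (rep (cellp k w)).1) - (q - w.1)); last by ring.
  apply: le_trans (ler_normB _ _) _; rewrite (splitr d) lerD//.
  - exact: le_trans e2 hk.
  - exact: le_trans e1 hk.
have e1 := dist_corner k w.2; have e2 := dist_corner k (rep (cellp k w)).2.
have : (cellp k (rep (cellp k w))).2 = (cellp k w).2 by rewrite cr.
rewrite /= => E1; rewrite E1 in e2; set q := corner _ _ in e1 e2.
rewrite (_ : w.2 - (rep (cellp k w)).2 = (q - (rep (cellp k w)).2) - (q - w.2)); last first.
  by rewrite opprB [RHS]addrC addrA subrK.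
apply: le_trans (ler_normB _ _) _; rewrite (splitr d) lerD//.
- exact: le_trans e2 hk.
- exact: le_trans e1 hk.
Qed.

Lemma pderives_sum (I : Type) (r : seq I) (c : I -> R[i]) (G : I -> V -> R[i]) l x :
  (forall i, smooth (G i)) ->
  smooth (fun x => \sum_(i <- r) c i * G i x) /\
  pderives l (fun x => \sum_(i <- r) c i * G i x) x = \sum_(i <- r) c i * pderives l (G i) x.
Proof.
move=> sG; elim: r => [|i r [IHs IH]].
  rewrite big_nil (_ : (fun _ => _) = fun=> 0); last by apply/funext => y; rewrite big_nil.
  by split; [exact: (@smooth0 R n).1|rewrite (@smooth0 R n).2].
rewrite big_cons -IH (_ : (fun _ => _) = fun x => c i * G i x + \sum_(j <- r) c j * G j x); last first.
  by apply/funext => y; rewrite big_cons.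
by have [q1 q2] := smooth_lin (c i) (sG i) IHs; split; rewrite ?q2.
Qed.

(** The Bochner integral of F exists in the Gelfand-Shilov space: H is the limit
    of Riemann sums in the topology of a single step, so functionals commute
    with the integral. *)
Lemma dual_integral f H : gs0_dual s t f -> gs0 s t H ->
  (forall l x, sorted lei l ->
     pderives l H x = integralC mu setT (fun w => pderives l (F w) x)) ->
  integrableC mu setT (fun w => f (F w)) /\
  f H = integralC mu setT (fun w => f (F w)).
Proof.
move=> df gH hH; have [B B0 [fB fB']] := dual_family_bound df.
have mf := measurable_dual_family df.
have imeas (y : R * V -> R[i]) b : 0 <= b -> measurableC y ->
    (forall w, normc (y w) <= b * (C * env w)) -> integrableC mu setT y.
  move=> b0 my yb; apply: (@integrableC_le _ _ R mu y (fun w => b * C * env w)) => //.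
    by under eq_fun do rewrite EFinM; apply: integrableZl => //; exact: integrable_env.
  by move=> w; rewrite -mulrA.
have ifF := imeas _ B B0 mf fB.
split=> //; apply/eqP; rewrite -subr_eq0; apply/eqP/normc_le_eq0 => eta eta0.
pose J := (\int[mu]_w env w)%R.
have J0 : 0 <= J by apply: Rintegral_ge0 => w _; exact/ltW/env_gt0.
(* the error is at most 4 B times the integral Q of the weight q below, where
   the slab and its complement contribute at most h each to Q *)
pose h := eta / (8 * (B + 1)).
have B1 : 0 < B + 1 by rewrite ltr_wpDl.
have hpos : 0 < h by rewrite divr_gt0// mulr_gt0.
have C1 : 0 < C + 1 by rewrite ltr_wpDl.
have [|m m0 hm] := @tail_vanishes (h / (C + 1)); first by rewrite divr_gt0.
have [cm cm0 hcm] := slab_le_env m0.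
have cJ : 0 < cm * J + 1 by rewrite ltr_wpDl// mulr_ge0.
pose e := h / (cm * J + 1).
have e0 : 0 < e by rewrite divr_gt0.
have [I [r [E [rep [mE sE hE]]]]] := step_partition m0 e0.
pose c z : R[i] := integralC mu setT (fun w => (\1_(E z) w : R)%:C).
pose q w := e * (cm * env w) + C * tail m w.
have i1 : mu.-integrable setT (fun w : R * V => (e * cm * env w)%:E).
  by under eq_fun do rewrite EFinM; apply: integrableZl => //; exact: integrable_env.
have i2 : mu.-integrable setT (fun w : R * V => (C * tail m w)%:E).
  by under eq_fun do rewrite EFinM; apply: integrableZl => //; exact: integrable_tail.
have iq : mu.-integrable setT (fun w => (q w)%:E).
  rewrite (_ : (fun _ => _) = (fun w => (e * cm * env w)%:E + (C * tail m w)%:E)%E).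
    exact: integrableD.
  by apply/funext => w; rewrite /q mulrA.
pose Q := (\int[mu]_w q w)%R.
have Q0 : 0 <= Q.
  apply: Rintegral_ge0 => w _; rewrite /q addr_ge0//.
    by rewrite mulr_ge0 ?(ltW e0)// mulr_ge0// ltW// env_gt0.
  by rewrite mulr_ge0//; case/andP: (tail_le m w).
have Qh : Q <= 2 * h.
  rewrite /Q /q.
  have -> : (\int[mu]_w (e * (cm * env w) + C * tail m w))%R =
      e * cm * J + C * (\int[mu]_w tail m w)%R.
    have -> : (fun w : R * V => e * (cm * env w) + C * tail m w) =
        fun w => e * cm * env w + C * tail m w by apply/funext => w; rewrite mulrA.
    rewrite RintegralD//= RintegralZl//; last exact: integrable_env.
    by rewrite RintegralZl//; exact: integrable_tail.
  rewrite mulr_natl mulr2n; apply: lerD.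
    rewrite /e -mulrA mulrAC ler_pdivrMr// ler_wpM2l ?(ltW hpos)//.
    by rewrite lerDl.
  apply: (@le_trans _ _ (C * (h / (C + 1)))); first by rewrite ler_wpM2l.
  by rewrite mulrCA ler_piMr ?(ltW hpos)// ler_pdivrMr ?mul1r ?lerDl.
have icE z : integrableC mu setT (fun w => (\1_(E z) w : R)%:C).
  apply: (@integrableC_le _ _ R mu _ (fun w => cm * env w)).
  - by apply: measurableC_real; apply: measurable_indic; exact: mE.
  - by under eq_fun do rewrite EFinM; apply: integrableZl => //; exact: integrable_env.
  move=> w; rewrite normc_real indicE; case: (boolP (w \in E z)) => [|_].
    by rewrite inE => /sE sw; rewrite normr1; exact: hcm.
  by rewrite normr0 mulr_ge0// ltW// env_gt0.
have key (b : R) (y : R * V -> R[i]) (Y : I -> R[i]) : 0 <= b -> measurableC y ->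
    (forall w, normc (y w) <= b * (C * env w)) -> (forall w, w.1 <= 0 -> y w = 0) ->
    (forall w z0, gs_bound s t (2 * K) e (fun x => F w x - F (rep z0) x) ->
       normc (y w - Y z0) <= b * e) ->
    normc (integralC mu setT y - \sum_(z <- r) c z * Y z) <= 2 * (b * Q).
  move=> b0 my yb y0 yY; have iy := imeas y b b0 my yb.
  have iS : integrableC mu setT (fun w => \sum_(z <- r) (\1_(E z) w : R)%:C * Y z).
    apply: integrableC_sum => z; apply: eq_integrableC (integrableCZ (Y z) (icE z)) => w.
    by rewrite mulrC.
  have -> : \sum_(z <- r) c z * Y z =
      integralC mu setT (fun w => \sum_(z <- r) (\1_(E z) w : R)%:C * Y z).
    rewrite integralC_sum => [|z]; last first.
      by apply: eq_integrableC (integrableCZ (Y z) (icE z)) => w; rewrite mulrC.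
    apply: eq_bigr => z _; rewrite mulrC -integralCZ//.
    by apply: eq_integralC => w; rewrite mulrC.
  rewrite -integralCB//.
  have ib : mu.-integrable setT (fun w => (b * q w)%:E).
    by under eq_fun do rewrite EFinM; apply: integrableZl.
  apply: le_trans (normc_integralC_le (integrableCB iy iS) ib _) _; last first.
    by rewrite RintegralZl.
  move=> w; have [sw|sw] := pselect (slab m w).
    have [z0 z1 z2] := hE w sw; rewrite z1; apply: le_trans (yY w z0 z2) _.
    rewrite ler_wpM2l// /q; apply: (@le_trans _ _ (e * (cm * env w))).
      by rewrite ler_peMr ?(ltW e0)// hcm.
    by rewrite lerDl mulr_ge0//; case/andP: (tail_le m w).
  rewrite big1 ?subr0 => [|z _]; last first.
    by rewrite indicE memNset ?mul0r// => /sE.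
  have [w0|w0] := leP w.1 0.
    rewrite y0// normc0 mulr_ge0// addr_ge0//.
      by rewrite mulr_ge0 ?(ltW e0)// mulr_ge0// ltW// env_gt0.
    by rewrite mulr_ge0//; case/andP: (tail_le m w).
  apply: le_trans (yb w) _; rewrite ler_wpM2l// /q.
  rewrite /tail indicE mem_set ?mulr1 ?lerDr//.
  by rewrite mulr_ge0 ?(ltW e0)// mulr_ge0// ltW// env_gt0.
pose S := fun x => \sum_(z <- r) c z * F (rep z) x.
have gS : gs0 s t S by exact: gs0_sum.
have sH : smooth H by case: gH.
have K20 : 0 <= 2 * K by rewrite mulr_ge0.
have bHS : gs_bound s t (2 * K) (2 * Q) (fun x => H x - S x).
  move=> A l x sl.
  have -> : pderives l (fun x => H x - S x) x = pderives l H x - pderives l S x.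
    have -> : (fun x => H x - S x) = fun x => (-1) * S x + H x.
      by apply/funext => y; rewrite mulN1r addrC.
    have sS : smooth S by case: gS.
    by rewrite (smooth_lin (-1) sS sH).2 mulN1r addrC.
  rewrite hH// (pderives_sum r c l x (fun z => sF (rep z))).2.
  have bw A' w : `|x| ^+ A' * normc (pderives l (F w) x) <=
      (2 * K) ^+ (A' + size l) * (fpow A' t * fpow (size l) s) * (C * env w).
    apply: le_trans (FB w A' x sl) _; rewrite [leRHS](_ : _ = C * env w * (2 * K) ^+ (A' + size l) *
      (fpow A' t * fpow (size l) s)); last by ring.
    have CE : 0 <= C * env w by rewrite mulr_ge0// ltW// env_gt0.
    rewrite ler_wpM2r ?mulr_ge0 ?fpow_ge0//; apply: ler_wpM2l => //.
    by rewrite lerXn2r ?nnegrE// ler_peMl// ler1n.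
  have bpos A' : 0 <= (2 * K) ^+ (A' + size l) * (fpow A' t * fpow (size l) s).
    by rewrite mulr_ge0 ?exprn_ge0// mulr_ge0 ?fpow_ge0.
  have my := measurable_pderives_family x sl.
  have iP : integrableC mu setT (fun w => pderives l (F w) x).
    apply: imeas (bpos 0%N) my _ => w.
    by have := bw 0%N w; rewrite expr0 mul1r.
  set b := (2 * K) ^+ (A + size l) * (fpow A t * fpow (size l) s).
  have xA : 0 <= `|x| ^+ A by rewrite exprn_ge0.
  have := key b (fun w => (`|x| ^+ A)%:C * pderives l (F w) x)
    (fun z => (`|x| ^+ A)%:C * pderives l (F (rep z)) x) (bpos A).
  have -> : integralC mu setT (fun w => (`|x| ^+ A)%:C * pderives l (F w) x) -
     \sum_(z <- r) c z * ((`|x| ^+ A)%:C * pderives l (F (rep z)) x) =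
     (`|x| ^+ A)%:C * (integralC mu setT (fun w => pderives l (F w) x) -
     \sum_(z <- r) c z * pderives l (F (rep z)) x).
    rewrite integralCZ// mulrBr mulr_sumr; congr (_ - _).
    by apply: eq_bigr => z _; rewrite mulrCA.
  rewrite normcM normc_real ger0_norm// => h'; apply: le_trans (h' _ _ _ _) _.
  - by apply: measurableCM => //; exact: measurableC_cst.
  - by move=> w; rewrite normcM normc_real ger0_norm//; exact: bw.
  - by move=> w w0; rewrite F0// (@smooth0 R n).2 mulr0.
  - move=> w z0 h2; have := h2 A l x sl; rewrite pderivesB -mulrBr normcM normc_real ger0_norm//.
    by rewrite -mulrA [_ * e]mulrC.
  by rewrite le_eqVlt; apply/orP; left; apply/eqP; rewrite /b; ring.
have fHS : normc (f H - f S) <= B * (2 * Q).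
  rewrite -gs0_dualB//; apply: fB' => //; first exact: gs0B.
  by rewrite mulr_ge0.
have fSF : normc (integralC mu setT (fun w => f (F w)) - f S) <= 2 * (B * Q).
  rewrite /S (gs0_dual_sum n0 r c s0 t0 df (fun z => gF (rep z))).
  apply: key => // [w w0|w z0 h2]; first by rewrite F0//; exact: gs0_dual0 df.
  rewrite -gs0_dualB//; apply: fB' => //; first exact: gs0B.
  exact: ltW.
rewrite (_ : f H - _ = (f H - f S) - (integralC mu setT (fun w => f (F w)) - f S)); last by ring.
apply: le_trans (le_normcD _ _) _; rewrite normcN; apply: le_trans (lerD fHS fSF) _.
apply: (@le_trans _ _ (4 * (B * (2 * h)))).
  rewrite [leLHS](_ : _ = 4 * (B * Q)); last by ring.
  by rewrite ler_wpM2l// ler_wpM2l.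
rewrite [leLHS](_ : _ = eta * (B / (B + 1))); last by rewrite /h; field; rewrite gt_eqF.
by rewrite ler_piMr ?(ltW eta0)// ler_pdivrMr ?mul1r ?lerDl.
Qed.

End family.

(** * Fourier transforms of atoms and coefficients *)

Section one_dimensional.
Context {R : realType}.
Local Notation leb := (@lebesgue_measure R).

Lemma integrable_scale (a : R) (f : R -> R) : 0 < a -> leb.-integrable setT (EFin \o f) ->
  leb.-integrable setT (fun x => (f (a * x))%:E).
Proof.
move=> a0 /integrableP[mf foo].
have E : (fun x => (f (a * x))%:E) = (EFin \o f) \o (fun x => a * x + 0).
  by apply/funext => x /=; rewrite addr0.
have mfa : measurable_fun setT (fun x => (f (a * x))%:E).
  by rewrite E; apply: measurableT_comp => //; exact: measurable_affine.
apply/integrableP; split => //.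
move: foo; rewrite (ge0_integral_affine 0 a0)//; last exact: measurableT_comp.
rewrite /= -lte_pdivlMl// => h; apply: le_lt_trans (lt_le_trans h (leey _)).
by under eq_integral do rewrite -[X in f X]addr0.
Qed.

Lemma Rintegral_scale (a : R) (f : R -> R) : 0 < a -> leb.-integrable setT (EFin \o f) ->
  (\int[leb]_x f x = a * \int[leb]_x f (a * x))%R.
Proof.
move=> a0 fi; have fai := integrable_scale a0 fi.
have mf := measurable_int _ fi.
pose T (x : R) : R := a * x.
have T0 F : F \o T = fun x => F (a * x + 0) :> \bar R.
  by apply/funext => x /=; rewrite addr0.
have E : (integral leb setT (EFin \o f) =
    a%:E * integral leb setT ((EFin \o f) \o T))%E.
  rewrite [LHS]integralE [X in (_ * X)%E]integralE.
  rewrite (funepos_comp (EFin \o f) T) (funeneg_comp (EFin \o f) T) !T0.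
  rewrite (ge0_integral_affine 0 a0)//; last exact: measurable_funepos.
  rewrite [X in (_ - X)%E](ge0_integral_affine 0 a0)//; last first.
    exact: measurable_funeneg.
  rewrite -muleBr// fin_num_adde_defl// fin_numN.
  have := integrable_neg_fin_num measurableT fai.
  by rewrite [X in funeneg X](_ : _ = (EFin \o f) \o T)// funeneg_comp T0.
by rewrite /Rintegral E fineM//; exact: integrable_fin_num.
Qed.

Lemma integralC_scale (a : R) (F : R -> R[i]) : 0 < a -> integrableC leb setT F ->
  integrableC leb setT (fun x => F (a * x)) /\
  integralC leb setT F = a%:C * integralC leb setT (fun x => F (a * x)).
Proof.
move=> a0 [F1 F2]; split.
  by split; [exact: (integrable_scale a0 F1)|exact: (integrable_scale a0 F2)].
apply/eqP; rewrite eq_complex cReM cImM/= !mul0r subr0 addr0.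
by rewrite (Rintegral_scale a0 F1) (Rintegral_scale a0 F2) !eqxx.
Qed.

Lemma integrableC_halfline (F : R -> R[i]) : integrableC leb `]0, +oo[%classic F <->
  integrableC leb setT (fun r => if 0 < r then F r else 0).
Proof.
have E (G : R[i] -> R) : G 0 = 0 -> (fun r : R => (G (if 0 < r then F r else 0))%:E) =
    (fun r => (G (F r))%:E) \_ (`]0, +oo[%classic).
  move=> G0; apply/funext => r; rewrite patchE.
  have -> : (r \in (`]0, +oo[%classic : set R)) = (0 < r).
    by apply/idP/idP; rewrite inE /= in_itv/= andbT.
  by case: ifP => //; rewrite G0.
rewrite /integrableC !(E _ erefl); split => -[i1 i2]; split.
- by apply/(integrable_mkcond _ _).1.
- by apply/(integrable_mkcond _ _).1.
- by apply/(integrable_mkcond _ _).2.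
- by apply/(integrable_mkcond _ _).2.
Qed.

Lemma integralC_halfline (F : R -> R[i]) : integralC leb `]0, +oo[%classic F =
  integralC leb setT (fun r => if 0 < r then F r else 0).
Proof.
have E (G : R[i] -> R) : G 0 = 0 -> (\int[leb]_(x in `]0%R, +oo[) G (F x) =
    \int[leb]_x G (if 0 < x then F x else 0))%R.
  move=> G0; rewrite Rintegral_mkcond; apply: eq_Rintegral => r _; rewrite patchE.
  have -> : (r \in (`]0, +oo[%classic : set R)) = (0 < r).
    by apply/idP/idP; rewrite inE /= in_itv/= andbT.
  by case: ifP => //; rewrite G0.
by rewrite /integralC !(E _ erefl).
Qed.

End one_dimensional.

Lemma conjc_mulr (R : realType) (z w : R[i]) : conjc (z * conjc w) = conjc z * w.
Proof.
case: z w => [a b] [a' b']; apply/eqP; rewrite eq_complex /=.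
by apply/andP; split; apply/eqP; ring.
Qed.

Section fourier_computations.
Context {R : realType} {n : nat}.
Local Notation V := 'rV[R]_n.
Local Notation leb := (@lebesgue_rV R n).
Implicit Types (phi g psi : V -> R[i]) (a : R) (b xi : V).

Lemma gs0_integrable s t g : 0 <= s -> 0 <= t -> gs0 s t g -> integrableC leb setT g.
Proof.
move=> s0 t0 gg; have [+ _] := gs0_annihilates_monom [ffun=> 0%N] 1 s0 t0 gg.
apply: eq_integrableC => u; rewrite mul1r /monom big1 ?mulr1// => i _.
by rewrite ffunE expr0.
Qed.

Lemma integrable_expi (F : V -> R[i]) xi : integrableC leb setT F ->
  integrableC leb setT (fun x => F x * expi (dot x xi)).
Proof.
move=> iF; apply: (integrableC_bounded (c := 1) iF).
  by apply: measurable_expi_dot; [exact: measurable_id|exact: measurable_cst].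
by move=> x; rewrite normc_expiE.
Qed.

Lemma fourier_atom s t psi b a xi : 0 <= s -> 0 <= t -> 0 < a -> gs0 s t psi ->
  fourier (wavelet_atom psi b a) xi = expi (dot b xi) * conjc (fourier psi (- (a *: xi))).
Proof.
move=> s0 t0 a0 gpsi; have iA := gs0_integrable s0 t0 (gs0_atom b s0 t0 a0 gpsi).
rewrite fourierE (integralC_affine_rV b a0 (integrable_expi xi iA)) fourierE.
have ip := integrable_expi (- (a *: xi)) (gs0_integrable s0 t0 gpsi).
rewrite -integralCJ// -[in RHS]integralCZ; last exact: integrableCJ.
have q u : wavelet_atom psi b a (a *: u + b) * expi (dot (a *: u + b) xi) =
    ((a ^+ n)^-1)%:C * (expi (dot b xi) * conjc (psi u * expi (dot u (- (a *: xi))))).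
  have -> : expi (dot u (- (a *: xi))) = conjc (expi (a * dot u xi)).
    by rewrite dotNr dotZr; exact: expiN.
  rewrite conjc_mulr dotDl expiD dotZl /wavelet_atom addrK scalerA mulVf ?gt_eqF// scale1r.
  by rewrite -mulrA; congr (_ * _); rewrite [RHS]mulrCA; congr (_ * _); exact: mulrC.
have iJ := integrableCZ (expi (dot b xi)) (integrableCJ ip).
rewrite (eq_integralC _ q) (integralCZ _ iJ).
by rewrite mulrA -rmorphM mulfV ?mul1r// gt_eqF// exprn_gt0.
Qed.

(** Since |b| <= |a u + b| + |a| |u|, the decay of g in a u + b and that of phi in u
    together give decay in b. *)
Lemma coef_product_bound s1 t1 s2 t2 phi g a : 0 <= s1 -> 0 <= t1 -> gs0 s1 t1 phi -> gs0 s2 t2 g ->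
  exists2 C : R, 0 <= C & forall u b, normc (phi u * g (a *: u + b)) <= C * (decay u * decay b).
Proof.
move=> s10 t10 [sp [Kp [Cp [Kp1 Cp0 pB]]] _] [sg [Kg [Cg [Kg1 Cg0 gB]]] _].
have [K [M [KK M0 hM]]] := @gs_bound_decay R n s1 t1 Kp s10 t10 Kp1.
have {}hM := hM _ _ Cp0 pB.
have K0 : 0 <= K by apply: le_trans KK; exact: le_trans ler01 Kp1.
have Kg0 : 0 <= Kg by exact: le_trans ler01 Kg1.
pose P A := M * Cp * K ^+ (A + 0) * (fpow A t1 * fpow 0 s1).
pose G A := Cg * Kg ^+ (A + 0) * (fpow A t2 * fpow 0 s2).
have P0 A : 0 <= P A by rewrite /P !mulr_ge0 ?exprn_ge0 ?fpow_ge0.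
have G0 A : 0 <= G A by rewrite /G !mulr_ge0 ?exprn_ge0 ?fpow_ge0.
have pp A u : `|u| ^+ A * normc (phi u) <= P A * decay u by exact: (hM A [::] u isT).
have gp A y : `|y| ^+ A * normc (g y) <= G A by exact: (gB A [::] y isT).
clearbody P G.
pose m := (2 * n)%N.
pose C := 2 ^+ n * (P 0%N * G 0%N + 2 ^+ m * (P 0%N * G m + `|a| ^+ m * (P m * G 0%N))).
exists C.
  by rewrite mulr_ge0 ?exprn_ge0// addr_ge0 ?mulr_ge0 ?exprn_ge0// addr_ge0// !mulr_ge0 ?exprn_ge0.
move=> u b; rewrite normcM; set y := a *: u + b.
have b1 : `|b| <= `|y| + `|a| * `|u|.
  rewrite -normrZ; have {1}-> : b = y - a *: u by rewrite /y addrC addKr.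
  exact: ler_normB.
have b2 : `|b| ^+ m <= 2 ^+ m * (`|y| ^+ m + (`|a| * `|u|) ^+ m).
  apply: le_trans (expr_add_le m _ _); rewrite ?mulr_ge0//.
  by rewrite lerXn2r ?nnegrE ?addr_ge0 ?mulr_ge0.
set pu := normc (phi u); set gy := normc (g y).
have pu0 : 0 <= pu by exact: normc_ge0.
have gy0 : 0 <= gy by exact: normc_ge0.
have d0 := decay_ge0 u.
have p0 : pu <= P 0%N * decay u by have := pp 0%N u; rewrite expr0 mul1r.
have g0 : gy <= G 0%N by have := gp 0%N y; rewrite expr0 mul1r.
have pm : `|u| ^+ m * pu <= P m * decay u by exact: pp.
have gm : `|y| ^+ m * gy <= G m by exact: gp.
apply: (@le_trans _ _ (pu * gy * (2 ^+ n * (1 + `|b| ^+ m) * decay b))).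
  by rewrite ler_peMr ?mulr_ge0// decay_lower.
rewrite [leRHS]mulrA mulrA ler_wpM2r ?decay_ge0//.
apply: (@le_trans _ _ (2 ^+ n * (pu * gy + 2 ^+ m * (pu * (`|y| ^+ m * gy) + `|a| ^+ m * ((`|u| ^+ m * pu) * gy))))).
  rewrite mulrCA ler_wpM2l ?exprn_ge0// mulrDr mulr1 lerD2l.
  apply: le_trans (ler_wpM2l (mulr_ge0 pu0 gy0) b2) _.
  by rewrite exprMn le_eqVlt; apply/orP; left; apply/eqP; ring.
rewrite /C -[leRHS]mulrA ler_wpM2l ?exprn_ge0// [leRHS]mulrDl; apply: lerD.
  by rewrite [leRHS]mulrAC; apply: ler_pM.
rewrite -[leRHS]mulrA ler_wpM2l ?exprn_ge0// [leRHS]mulrDl; apply: lerD.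
  by rewrite [leRHS]mulrAC; apply: ler_pM => //; rewrite mulr_ge0// exprn_ge0.
rewrite -[leRHS]mulrA ler_wpM2l ?exprn_ge0// [leRHS]mulrAC; apply: ler_pM => //.
by rewrite mulr_ge0// exprn_ge0.
Qed.

(** For fixed a the coefficient is a correlation of phi, dilated, with g, so its
    transform in b is a product. *)
Lemma fourier_coef s1 t1 s2 t2 phi g a xi : 0 <= s1 -> 0 <= t1 -> 0 <= s2 -> 0 <= t2 -> 0 < a ->
  gs0 s1 t1 phi -> gs0 s2 t2 g ->
  integrableC leb setT (fun b => coef phi g a b * expi (dot b xi)) /\
  integralC leb setT (fun b => coef phi g a b * expi (dot b xi)) =
  fourier phi (- (a *: xi)) * fourier g xi.
Proof.
move=> s10 t10 s20 t20 a0 gphi gg.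
have [C C0 hC] := coef_product_bound a s10 t10 gphi gg.
pose F (p : V * V) := phi p.1 * g (a *: p.1 + p.2) * expi (dot p.2 xi).
have mp : measurableC phi by apply: measurable_smooth; case: gphi.
have mg : measurableC g by apply: measurable_smooth; case: gg.
have mF : measurableC F.
  apply: measurableCM; first apply: measurableCM.
  - exact: (measurableC_comp mp measurable_fst).
  - apply: (measurableC_comp mg); apply: measurable_affine_rV; first exact: measurable_cst.
      exact: measurable_fst.
    exact: measurable_snd.
  - by apply: measurable_expi_dot; [exact: measurable_snd|exact: measurable_cst].
have iF : integrableC (leb \x leb)%E setT F.
  apply: (@integrableC_le _ _ R _ F (fun p => C * (decay p.1 * decay p.2))) => //.
    under eq_fun do rewrite EFinM; apply: integrableZl => //.
    apply: (@integrable_prod _ _ _ _ R leb leb (@decay R n) (@decay R n));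
      [exact: decay_ge0|exact: decay_ge0|exact: integrable_decay|exact: integrable_decay].
  by move=> [u b]; rewrite /F /= normcM normc_expiE mulr1.
have ig := gs0_integrable s20 t20 gg.
have iF1 u : integrableC leb setT (fun b => F (u, b)).
  have := integrableC_affine_rV (a *: u) ltr01 ig.
  move=> /(integrable_expi xi) /(integrableCZ (phi u)).
  by apply: eq_integrableC => b; rewrite /F /= scale1r mulrA [b + _]addrC.
have iF2 b : integrableC leb setT (fun u => F (u, b)).
  have := integrable_mul_affine b a s10 t10 gg gphi.
  move=> /(integrableCZ (expi (dot b xi))).
  by apply: eq_integrableC => u; rewrite /F mulrC.
have [_ e1] := fubiniC1 iF iF1; have [i2 e2] := fubiniC2 iF iF2.
have cE b : integralC leb setT (fun u => F (u, b)) = coef phi g a b * expi (dot b xi).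
  rewrite mulrC /coef -integralCZ; last exact: (integrable_mul_affine b a s10 t10 gg gphi).
  by apply: eq_integralC => u; rewrite /F mulrC.
split; first by apply: eq_integrableC i2.
rewrite -(eq_integralC _ cE) -e2 e1 fourierE.
have inner u : integralC leb setT (fun b => F (u, b)) =
    fourier g xi * (phi u * expi (dot u (- (a *: xi)))).
  have ie := integrable_expi xi ig.
  rewrite fourierE (integralC_affine_rV (a *: u) ltr01 ie) expr1n mul1r.
  rewrite mulrC -integralCZ; last exact: (integrableC_affine_rV _ ltr01 ie).
  apply: eq_integralC => b; rewrite /F /= scale1r [b + _]addrC dotDl expiD.
  rewrite dotZl.
  have q : expi (dot u (- (a *: xi))) * expi (a * dot u xi) = 1.
    by rewrite -expiD dotNr dotZr addNr expi0.
  by rewrite -[LHS]mul1r -{1}q; ring.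
rewrite (eq_integralC _ inner) integralCZ 1?mulrC//.
exact: integrable_expi (gs0_integrable s10 t10 gphi).
Qed.

End fourier_computations.

(** * The reconstruction formula for test functions *)

(** The product of Lebesgue measures as a sigma-finite measure, so that it can
    itself be a factor of a product. *)
Section half_space_measure.
Context {R : realType} {n : nat}.

Definition scale_space := (@lebesgue_measure R \x @lebesgue_rV R n)%E.

HB.instance Definition _ := Measure.on scale_space.

Lemma scale_space_sigma_finite : sigma_finite setT scale_space.
Proof.
have /sigma_finiteP[F [TF ndF Foo]] := sigma_finiteT (@lebesgue_measure R).
have /sigma_finiteP[G [TG ndG Goo]] := sigma_finiteT (@lebesgue_rV R n).
exists (fun k => F k `*` G k).
  rewrite -setXTT TF TG predeqE => -[x y]; split.
    move=> [/= [k _ Fkx] [l _ Gly]]; exists (maxn k l) => //; split.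
    - by move: x Fkx; exact/subsetPset/ndF/leq_maxl.
    - by move: y Gly; exact/subsetPset/ndG/leq_maxr.
  by move=> [k _ []/= ? ?]; split; exists k.
move=> k; have [? ?] := Foo k; have [? ?] := Goo k.
split; first exact: measurableX.
by rewrite /scale_space product_measure1E// lte_mul_pinfty// ge0_fin_numE.
Qed.

HB.instance Definition _ := Measure_isSigmaFinite.Build _ _ _ scale_space
  scale_space_sigma_finite.

End half_space_measure.

Section lipschitz.
Context {R : realType} {n : nat}.
Local Notation V := 'rV[R]_n.
Implicit Types (h F : V -> R[i]).

Lemma lipschitz_continuous h (L : R) : 0 <= L ->
  (forall x y : V, normc (h y - h x) <= L * `|y - x|) ->
  continuous (fun x : V => complex.Re (h x)) /\ continuous (fun x : V => complex.Im (h x)).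
Proof.
move=> L0 hL.
have key (G : R[i] -> R) : (forall z w, G z - G w = G (z - w)) -> (forall z, `|G z| <= normc z) ->
    continuous (fun x : V => G (h x)).
  move=> GB Gn x; suff : (fun x : V => G (h x)) @ x --> G (h x) by [].
  apply/(@cvgrPdist_le _ _ _ (nbhs x) (nbhs_filter x)) => e e0.
  apply: (nbhs_ballP _ _).2.
  exists (e / (L + 1)) => /=; first by rewrite divr_gt0// ltr_wpDl.
  move=> y; rewrite -ball_normE /= => xy; rewrite GB; apply: le_trans (Gn _) _.
  apply: le_trans (hL _ _) _; apply: (@le_trans _ _ ((L + 1) * (e / (L + 1)))).
    by apply: ler_pM => //; [rewrite lerDl|exact: ltW].
  by rewrite mulrCA mulfV ?mulr1// gt_eqF// ltr_wpDl.
split; apply: key.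
- by move=> z w; rewrite cReD cReN.
- exact: Re_le_normc.
- by move=> z w; rewrite cImD cImN.
- exact: Im_le_normc.
Qed.

Lemma gs_lipschitz s t K C F : 0 <= K -> 0 <= C -> smooth F -> gs_bound s t K C F ->
  forall x y : V, normc (F y - F x) <= 2 * (C * (K * fpow 1 s * n%:R)) * `|y - x|.
Proof.
move=> K0 C0 sF FB x y.
have B0 : 0 <= C * K ^+ 1 * (fpow 0 t * fpow 1 s) by rewrite !mulr_ge0 ?exprn_ge0 ?fpow_ge0.
have := @mean_value R n F x (y - x) _ sF B0; rewrite [x + _]addrC subrK => h.
apply: le_trans (h _) _ => [i z _|].
  by have := FB 0%N [:: i] z isT; rewrite expr0 mul1r.
by rewrite fpow0 expr1 le_eqVlt; apply/orP; left; apply/eqP; ring.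
Qed.

End lipschitz.

Section reproducing.
Context {R : realType} {n : nat}.
Hypothesis n0 : (0 < n)%N.
Local Notation V := 'rV[R]_n.
Local Notation leb := (@lebesgue_rV R n).
Local Notation leb1 := (@lebesgue_measure R).
Local Notation mu := (@lebesgue_measure R \x @lebesgue_rV R n)%E.
Variables (rho1 rho2 s t : R).
Hypotheses (h1 : 0 < rho1) (h2 : 1 < rho2) (ht : rho1 + rho2 < t) (hs : rho1 + rho2 - 1 < s).
Local Notation sigma := (rho1 + rho2 - 1).
Variables (psi phi g : V -> R[i]) (c : R[i]).
Hypotheses (gpsi : gs0 rho1 rho2 psi) (gphi : gs0 rho1 rho2 phi)
  (gg : gs0 (s - sigma) (t - sigma) g).
Hypothesis adm : forall w, sphere w ->
  integrableC leb1 `]0, +oo[%classic (admissibility_integrand psi phi w) /\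
  integralC leb1 `]0, +oo[%classic (admissibility_integrand psi phi w) = c.
Local Notation F := (field psi phi g).

Let s0 : 0 <= s. Proof. by move: h1 h2 hs => ? ? ?; lra. Qed.
Let t0 : 0 <= t. Proof. by move: h1 h2 ht => ? ? ?; lra. Qed.
Let r10 : 0 <= rho1. Proof. exact: ltW. Qed.
Let r20 : 0 <= rho2. Proof. by move: h2 => ?; lra. Qed.
Let s10 : 0 <= s - sigma. Proof. by rewrite subr_ge0 ltW. Qed.
Let t10 : 0 <= t - sigma. Proof. by move: h1 h2 ht => ? ? ?; lra. Qed.

Lemma measurable_field : measurableC (fun p : V * (R * V) => F p.2 p.1).
Proof.
pose ck (w : R * V) := if 0 < w.1 then coef phi g w.1 w.2 else 0.
have [L L0 hL] := coef_lipschitz r10 r20 s10 t10 gphi gg.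
have mck : measurableC ck.
  apply: measurableC_halfspace => [p p0|p p0 e e0]; first by rewrite /ck ltNge p0.
  exists (e / 2 / (L + 1)); first by rewrite !divr_gt0// ltr_wpDl.
  move=> q q0 q1 q2; rewrite /ck p0 q0; apply: le_trans (hL _ _ _ _) _.
  apply: (@le_trans _ _ ((L + 1) * (e / 2 / (L + 1) + e / 2 / (L + 1)))).
    by apply: ler_pM; [|exact: addr_ge0|rewrite lerDl|exact: lerD].
  rewrite le_eqVlt; apply/orP; left; apply/eqP; field.
  by rewrite gt_eqF// ltr_wpDl.
have E : (fun p : V * (R * V) => F p.2 p.1) = fun p =>
    ck p.2 * ((p.2.1^-1)%:C ^+ n.+1 * conjc (psi (p.2.1^-1 *: p.1 + - (p.2.1^-1 *: p.2.2)))).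
  apply/funext => -[x [a b]]; rewrite /field /ck /=; case: ifPn => [a0|_]; last by rewrite mul0r.
  have -> : wavelet_atom psi b a x = (a^-1)%:C ^+ n * conjc (psi (a^-1 *: x + - (a^-1 *: b))).
    by rewrite wavelet_atomE -exprVn rmorphXn.
  by rewrite exprS; ring.
have ms : measurable_fun setT (fun p : V * (R * V) => p.2.1).
  by apply: (measurableT_comp measurable_fst); exact: measurable_snd.
have mi : measurable_fun setT (fun p : V * (R * V) => p.2.1^-1).
  exact: (measurableT_comp (@measurable_inv R) ms).
have mb : measurable_fun setT (fun p : V * (R * V) => p.2.2).
  by apply: (measurableT_comp measurable_snd); exact: measurable_snd.
rewrite E; apply: measurableCM; first exact: (measurableC_comp mck measurable_snd).
apply: measurableCM.
  rewrite (_ : (fun _ => _) = fun p : V * (R * V) => (p.2.1^-1 ^+ n.+1)%:C).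
    by apply: measurableC_real; exact: measurable_funX.
  by apply/funext => p; rewrite rmorphXn.
apply: measurableCJ; apply: (measurableC_comp (measurable_smooth _)); first by case: gpsi.
have -> : (fun p : V * (R * V) => p.2.1^-1 *: p.1 - p.2.1^-1 *: p.2.2) =
    fun p => p.2.1^-1 *: p.1 + ((- p.2.1^-1) *: p.2.2 + 0).
  by apply/funext => p; rewrite addr0 scaleNr.
apply: measurable_affine_rV; [exact: mi|exact: measurable_fst|].
by apply: measurable_affine_rV; [exact: measurableT_comp|exact: mb|exact: measurable_cst].
Qed.

Lemma field_decay : exists2 C : R, 0 <= C &
  forall w x, normc (F w x) <= C * (decay x * env w).
Proof.
have [K [C [K1 C0 FB]]] := field_bound n0 h1 h2 ht hs gpsi gphi gg.
have [K' [M [KK M0 hM]]] := @gs_bound_decay R n s t K s0 t0 K1.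
have K'0 : 0 <= K' by apply: le_trans KK; exact: le_trans ler01 K1.
exists (M * C * (K' ^+ (0 + 0) * (fpow 0 t * fpow 0 s))).
  by rewrite !mulr_ge0 ?exprn_ge0 ?fpow_ge0.
move=> w x; have C'0 : 0 <= C * env w by rewrite mulr_ge0// ltW// env_gt0.
have := hM _ _ C'0 (FB w) 0%N [::] x isT; rewrite /= expr0 mul1r => h; apply: le_trans h _.
by rewrite le_eqVlt; apply/orP; left; apply/eqP; ring.
Qed.

Lemma integrable_field : integrableC (leb \x @scale_space R n)%E setT (fun p : V * (R * V) => F p.2 p.1).
Proof.
have [C C0 hC] := field_decay.
apply: (@integrableC_le _ _ R (leb \x @scale_space R n)%E (fun p : V * (R * V) => F p.2 p.1) (fun p => C * (decay p.1 * env p.2))).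
- exact: measurable_field.
- under eq_fun do rewrite EFinM; apply: integrableZl => //.
  apply: (@integrable_prod _ _ _ _ R leb (@scale_space R n) (@decay R n) (@env R n)).
  + exact: decay_ge0.
  + by move=> w; exact/ltW/env_gt0.
  + exact: integrable_decay.
  + exact: integrable_env.
- by move=> p; exact: hC.
Qed.

Definition synthesis (x : V) : R[i] := integralC mu setT (fun w => F w x).

Lemma integrable_field_slice x : integrableC mu setT (fun w => F w x).
Proof.
have [C C0 hC] := field_decay.
apply: (@integrableC_le _ _ R mu _ (fun w => C * decay x * env w)).
- have mp : measurable_fun setT (fun w : R * V => (x, w)).
    by apply/measurable_fun_pair; [exact: measurable_cst|exact: measurable_id].
  exact: (measurableC_comp measurable_field mp).
- by under eq_fun do rewrite EFinM; apply: integrableZl => //; exact: integrable_env.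
- by move=> w; rewrite -mulrA; exact: hC.
Qed.

Lemma gs0_F w : gs0 s t (F w).
Proof. exact: (gs0_field h1 h2 ht hs phi g gpsi). Qed.

Lemma fourier_synthesis xi : integrableC leb setT synthesis /\
  integrableC mu setT (fun w => fourier (F w) xi) /\
  fourier synthesis xi = integralC mu setT (fun w => fourier (F w) xi).
Proof.
pose G (p : V * (R * V)) := F p.2 p.1 * expi (dot p.1 xi).
have iG : integrableC (leb \x @scale_space R n)%E setT G.
  apply: (integrableC_bounded (c := 1) integrable_field).
    by apply: measurable_expi_dot; [exact: measurable_fst|exact: measurable_cst].
  by move=> p; rewrite normc_expiE.
have iG1 x : integrableC mu setT (fun w => G (x, w)).
  apply: eq_integrableC (integrableCZ (expi (dot x xi)) (integrable_field_slice x)) => w.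
  by rewrite mulrC.
have iG2 w : integrableC leb setT (fun x => G (x, w)).
  exact: integrable_expi (gs0_integrable s0 t0 (gs0_F w)).
have [_ e1] := fubiniC1 iG iG1; have [i2 e2] := fubiniC2 iG iG2.
have [i3 _] := fubiniC1 integrable_field integrable_field_slice.
split; first exact: i3.
split; first exact: i2.
rewrite fourierE -[RHS]e2 e1; apply: eq_integralC => x.
rewrite mulrC -integralCZ; last exact: integrable_field_slice.
by apply: eq_integralC => w; rewrite mulrC.
Qed.

Lemma fourier_field xi w : fourier (F w) xi = if 0 < w.1 then
  (w.1^-1)%:C * coef phi g w.1 w.2 * (expi (dot w.2 xi) * conjc (fourier psi (- (w.1 *: xi))))
  else 0.
Proof.
rewrite /field; case: ifPn => w0; last first.
  rewrite fourierE -[RHS](integralC0 leb); apply: eq_integralC => x; exact: mul0r.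
rewrite -(fourier_atom _ _ r10 r20 w0 gpsi) !fourierE -integralCZ.
  by apply: eq_integralC => x; rewrite mulrA.
exact: integrable_expi (gs0_integrable r10 r20 (gs0_atom _ r10 r20 w0 gpsi)).
Qed.

Lemma fourier_synthesisE xi : fourier synthesis xi =
  integralC leb1 setT (fun a => if 0 < a then
    (a^-1)%:C * conjc (fourier psi (- (a *: xi))) * fourier phi (- (a *: xi)) * fourier g xi
    else 0).
Proof.
have [_ [iw ->]] := fourier_synthesis xi.
have slice a : integrableC leb setT (fun b => fourier (F (a, b)) xi) /\
   integralC leb setT (fun b => fourier (F (a, b)) xi) = if 0 < a then
    (a^-1)%:C * conjc (fourier psi (- (a *: xi))) * fourier phi (- (a *: xi)) * fourier g xi
    else 0.
  have [a0|a0] := boolP (0 < a); last first.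
    have E b : fourier (F (a, b)) xi = 0 by rewrite fourier_field/= (negbTE a0).
    split; last by rewrite -[RHS](integralC0 leb); apply: eq_integralC.
    by apply: eq_integrableC (integrableC0 leb) => b; rewrite E.
  have [ic ec] := fourier_coef xi r10 r20 s10 t10 a0 gphi gg.
  have E b : (a^-1)%:C * conjc (fourier psi (- (a *: xi))) * (coef phi g a b * expi (dot b xi)) =
      fourier (F (a, b)) xi.
    by rewrite fourier_field/= a0; ring.
  split; first by apply: eq_integrableC (integrableCZ _ ic) => b; exact: E.
  by rewrite -(eq_integralC _ E) integralCZ// ec !mulrA.
have [_ ->] := fubiniC1 iw (fun a => (slice a).1).
by apply: eq_integralC => a; rewrite (slice a).2.
Qed.

(** Substituting r = a |xi| turns the integral over the scales into the
    admissibility constant in the direction of - xi. *)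
Lemma admissible_scales xi : fourier synthesis xi = c * fourier g xi.
Proof.
have ig := gs0_integrable s10 t10 gg.
rewrite fourier_synthesisE.
have [->|xi0] := eqVneq xi 0.
  have -> : fourier g 0 = 0.
    have [_ z] := gs0_annihilates_monom [ffun=> 0%N] 1 s10 t10 gg.
    rewrite fourierE -[RHS]z; apply: eq_integralC => u.
    rewrite mul1r /monom big1 => [|i _]; last by rewrite ffunE expr0.
    by congr (_ * _); rewrite /dot big1 ?expi0// => i _; rewrite mxE mulr0.
  rewrite mulr0 -[RHS](integralC0 leb1); apply: eq_integralC => a.
  by rewrite mulr0; case: ifP.
pose r := Num.sqrt (dot xi xi).
have d0 : 0 < dot xi xi.
  have [i xi_i] : exists i, xi ord0 i != 0.
    apply/existsP; apply: contraNT xi0 => /existsPn h; apply/eqP/rowP => i.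
    by rewrite mxE; apply/eqP; have := h i; rewrite negbK.
  rewrite /dot (bigD1 i)//= ltr_pwDl//.
    by rewrite -expr2 lt0r sqr_ge0 andbT sqrf_eq0.
  by apply: sumr_ge0 => j _; rewrite -expr2 sqr_ge0.
have r0 : 0 < r by rewrite sqrtr_gt0.
have r2 : r * r = dot xi xi by rewrite -expr2 sqr_sqrtr// ltW.
pose w := - (r^-1 *: xi).
have sw : sphere w.
  rewrite /sphere /= /w dotNl dotNr opprK dotZl dotZr -r2.
  by field; rewrite gt_eqF.
have [iA eA] := adm sw.
have iA' := (integrableC_halfline _).1 iA.
rewrite integralC_halfline in eA.
have [iS eS] := integralC_scale r0 iA'.
rewrite -eA eS mulrC mulrA -integralCZ//; apply: eq_integralC => a.
rewrite pmulr_rgt0//; case: ifPn => a0; last by rewrite mulr0.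
rewrite /admissibility_integrand.
have -> : (r * a) *: w = - (a *: xi).
  by rewrite /w scalerN scalerA mulrAC mulfV ?mul1r// gt_eqF.
have -> : ((r * a)%:C)^-1 = (r^-1)%:C * (a^-1)%:C.
  by rewrite -rmorphM -invfM -fmorphV.
have rr : (r : R)%:C * (r^-1)%:C = 1 by rewrite -rmorphM mulfV// gt_eqF.
set A := conjc _; set B := fourier phi _; set D := fourier g xi.
rewrite [LHS](_ : _ = ((r : R)%:C * (r^-1)%:C) * (a^-1)%:C * A * B * D); last by rewrite rr mul1r.
rewrite -[Num.conj _]/A; ring.
Qed.

(** Both sides are continuous and integrable and have the same Fourier
    transform. *)
Lemma synthesisE x : synthesis x = c * g x.
Proof.
have [K [C [K1 C0 FB]]] := field_bound n0 h1 h2 ht hs gpsi gphi gg.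
have [sg [Kg [Cg [Kg1 Cg0 gB]]] _] := gg.
have ig := gs0_integrable s10 t10 gg.
have K0 : 0 <= K by exact: le_trans ler01 K1.
have Kg0 : 0 <= Kg by exact: le_trans ler01 Kg1.
have sF w : smooth (F w) by case: (gs0_F w).
have E0 (w : R * V) : 0 <= C * env w by rewrite mulr_ge0// ltW// env_gt0.
pose J := (\int[mu]_w env w)%R.
have J0 : 0 <= J by apply: Rintegral_ge0 => w _; exact/ltW/env_gt0.
have lip u v : normc (synthesis v - synthesis u) <=
    2 * (2 * (C * (K * fpow 1 s * n%:R)) * J) * `|v - u|.
  rewrite /synthesis -integralCB; [|exact: integrable_field_slice..].
  pose q := 2 * (C * (K * fpow 1 s * n%:R)) * `|v - u|.
  have iq : mu.-integrable setT (fun w : R * V => (q * env w)%:E).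
    by under eq_fun do rewrite EFinM; apply: integrableZl => //; exact: integrable_env.
  have i1 := integrableCB (integrable_field_slice v) (integrable_field_slice u).
  apply: le_trans (normc_integralC_le i1 iq _) _ => [w|].
    have hl := gs_lipschitz K0 (E0 w) (sF w) (FB w) u v; apply: (le_trans hl).
    by rewrite /q le_eqVlt; apply/orP; left; apply/eqP; ring.
  rewrite RintegralZl//; last exact: integrable_env.
  by rewrite -/J /q le_eqVlt; apply/orP; left; apply/eqP; ring.
pose h y := synthesis y - c * g y.
have sI := (fourier_synthesis 0).1.
have ih : integrableC leb setT h by apply: integrableCB => //; exact: integrableCZ.
pose L1 := 2 * (2 * (C * (K * fpow 1 s * n%:R)) * J).
pose L2 := 2 * (Cg * (Kg * fpow 1 (s - sigma) * n%:R)).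
have L10 : 0 <= L1 by rewrite /L1 !mulr_ge0 ?fpow_ge0.
have L20 : 0 <= L2 by rewrite /L2 !mulr_ge0 ?fpow_ge0.
have hlip u v : normc (h v - h u) <= (L1 + normc c * L2) * `|v - u|.
  rewrite (_ : h v - h u = (synthesis v - synthesis u) - c * (g v - g u)); last first.
    by rewrite /h; ring.
  apply: le_trans (le_normcD _ _) _; rewrite normcN normcM mulrDl; apply: lerD; first exact: lip.
  by rewrite -mulrA ler_wpM2l ?normc_ge0//; exact: gs_lipschitz gB u v.
have L0 : 0 <= L1 + normc c * L2 by rewrite addr_ge0// mulr_ge0// normc_ge0.
have [c1 c2] := lipschitz_continuous L0 hlip.
have [M hM] : exists M, forall y, normc (h y) <= M.
  have [Cd Cd0 hd] := field_decay.
  exists (2 * (Cd * J) + normc c * (Cg * Kg ^+ 0 * (fpow 0 (t - sigma) * fpow 0 (s - sigma)))).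
  move=> y; apply: le_trans (le_normcD _ _) _; rewrite normcN normcM; apply: lerD.
    have iq : mu.-integrable setT (fun w : R * V => (Cd * env w)%:E).
      by under eq_fun do rewrite EFinM; apply: integrableZl => //; exact: integrable_env.
    apply: le_trans (normc_integralC_le (integrable_field_slice y) iq _) _ => [w|].
      apply: le_trans (hd w y) _; rewrite ler_wpM2l// ler_piMl ?(ltW (env_gt0 _))//.
      apply: prodr_ile1 => i _; rewrite invr_ge0 addr_ge0 ?sqr_ge0//=.
      by rewrite invf_le1 ?lerDl ?sqr_ge0// ltr_pwDl// sqr_ge0.
    by rewrite RintegralZl//; exact: integrable_env.
  rewrite ler_wpM2l ?normc_ge0//; have := gB 0%N [::] y isT.
  by rewrite expr0 mul1r.
have h0 xi : fourier h xi = 0.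
  rewrite fourierE.
  have i1 := integrable_expi xi sI; have i2 := integrable_expi xi ig.
  have -> : integralC leb setT (fun y => h y * expi (dot y xi)) =
     integralC leb setT (fun y => synthesis y * expi (dot y xi) - c * (g y * expi (dot y xi))).
    by apply: eq_integralC => y; rewrite /h mulrBl mulrA.
  rewrite integralCB//; last exact: integrableCZ.
  by rewrite integralCZ// -!fourierE admissible_scales subrr.
have := @fourier_unique R n h M ih c1 c2 hM h0 x.
by move/eqP; rewrite subr_eq0 => /eqP.
Qed.

End reproducing.

(** * Derivatives of the reconstruction formula, and functionals *)

Section synthesis_derivatives.
Context {R : realType} {n : nat}.
Hypothesis n0 : (0 < n)%N.
Local Notation V := 'rV[R]_n.
Local Notation leb := (@lebesgue_rV R n).
Local Notation leb1 := (@lebesgue_measure R).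
Local Notation mu := (@lebesgue_measure R \x @lebesgue_rV R n)%E.
Variables (rho1 rho2 s t : R).
Hypotheses (h1 : 0 < rho1) (h2 : 1 < rho2) (ht : rho1 + rho2 < t) (hs : rho1 + rho2 - 1 < s).
Local Notation sigma := (rho1 + rho2 - 1).
Variables (psi phi g : V -> R[i]) (c : R[i]).
Hypotheses (gpsi : gs0 rho1 rho2 psi) (gphi : gs0 rho1 rho2 phi)
  (gg : gs0 (s - sigma) (t - sigma) g).
Hypothesis adm : forall w, sphere w ->
  integrableC leb1 `]0, +oo[%classic (admissibility_integrand psi phi w) /\
  integralC leb1 `]0, +oo[%classic (admissibility_integrand psi phi w) = c.
Local Notation F := (field psi phi g).

Let s0 : 0 <= s. Proof. by move: h1 h2 hs => ? ? ?; lra. Qed.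
Let t0 : 0 <= t. Proof. by move: h1 h2 ht => ? ? ?; lra. Qed.
Let s10 : 0 <= s - sigma. Proof. by rewrite subr_ge0 ltW. Qed.
Let t10 : 0 <= t - sigma. Proof. by move: h1 h2 ht => ? ? ?; lra. Qed.

Lemma field_nonpositive (w : R * V) : w.1 <= 0 -> F w = fun=> 0.
Proof. by move=> w0; rewrite /field ltNge w0. Qed.

Lemma integrable_field_pderives l x : sorted lei l ->
  integrableC mu setT (fun w => pderives l (F w) x).
Proof.
move=> sl; have [K [C [K1 C0 FB]]] := field_bound n0 h1 h2 ht hs gpsi gphi gg.
apply: (@integrableC_le _ _ R mu _ (fun w => C * K ^+ size l * fpow (size l) s * env w)).
- apply: measurable_pderives_family => //.
    exact: field_nonpositive.
  by move=> m r l'; exact: (bucont_field h1 h2 ht hs gpsi gphi gg).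
- by under eq_fun do rewrite EFinM; apply: integrableZl => //; exact: integrable_env.
- move=> w; have := FB w 0%N l x sl; rewrite expr0 mul1r fpow0 mul1r add0n => h.
  by apply: (le_trans h); rewrite le_eqVlt; apply/orP; left; apply/eqP; ring.
Qed.

(** Differentiation under the integral, one sorted direction at a time: two
    second-order Taylor bounds along an axis are subtracted, so that both first
    derivatives agree up to the step. *)
Lemma synthesis_pderives l x : sorted lei l ->
  pderives l (fun x => c * g x) x = integralC mu setT (fun w => pderives l (F w) x).
Proof.
have [K [C [K1 C0 FB]]] := field_bound n0 h1 h2 ht hs gpsi gphi gg.
have gH := gs0Z c s10 t10 gg; set H := fun x => c * g x in gH *.
have [sH [KH [CH [KH1 CH0 HB]]] _] := gH.
have sF w : smooth (F w) by case: (gs0_F h1 h2 ht hs phi g gpsi w).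
have K0 : 0 <= K by exact: le_trans ler01 K1.
have KH0 : 0 <= KH by exact: le_trans ler01 KH1.
pose J := (\int[mu]_w env w)%R.
have J0 : 0 <= J by apply: Rintegral_ge0 => w _; exact/ltW/env_gt0.
elim: l x => [|i l IH] x sl.
  by rewrite /H /= -(synthesisE n0 h1 h2 ht hs gpsi gphi gg adm).
have sl' : sorted lei l by exact: path_sorted sl.
have sll : sorted lei (i :: i :: l) by move: sl => /=; rewrite /lei leqnn.
pose BH := CH * KH ^+ (size l).+2 * fpow (size l).+2 (s - sigma).
pose BF := C * K ^+ (size l).+2 * fpow (size l).+2 s.
have BF0 : 0 <= BF by apply: mulr_ge0; [apply: mulr_ge0 => //; exact: exprn_ge0|exact: fpow_ge0].
have BH0 : 0 <= BH by apply: mulr_ge0; [apply: mulr_ge0 => //; exact: exprn_ge0|exact: fpow_ge0].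
have tay (G : V -> R[i]) (B h : R) : smooth G ->
    (forall z, normc (pderives (i :: i :: l) G z) <= B) ->
    normc (pderives l G (x + h *: axis i) - (pderives l G x + h%:C * pderives (i :: l) G x)) <=
    B * h ^+ 2.
  move=> sG hB; have := @taylor_axis R n _ i x h B 2 (smooth_pderives l sG) (fun u _ => hB _).
  have [f0 f1 f2] : [/\ 0`! = 1, 1`! = 1 & 2`! = 2]%N by [].
  rewrite big_ord_recr big_ord_recr big_ord0 /= add0r expr0 expr1 f0 f1 f2 !divr1 mul1r => h'.
  apply: (le_trans h'); rewrite real_normK ?num_real//.
  by rewrite le_eqVlt; apply/orP; left; apply/eqP; field.
have tH h := tay H BH h sH.
have tF w h := tay (F w) (BF * env w) h (sF w).
have iP := integrable_field_pderives _ sl'.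
have iQ := integrable_field_pderives x sl.
set D1 := pderives (i :: l) H x; set D2 := integralC _ _ _.
have key (h : R) : normc (h%:C * (D1 - D2)) <= (BH + 2 * (BF * J)) * h ^+ 2.
  pose G w := pderives l (F w) (x + h *: axis i) - (pderives l (F w) x + h%:C * pderives (i :: l) (F w) x).
  have i2 : integrableC mu setT (fun w => pderives l (F w) x + h%:C * pderives (i :: l) (F w) x).
    by apply: integrableCD; [exact: iP|exact: integrableCZ].
  have iG : integrableC mu setT G by apply: integrableCB.
  have eG : integralC mu setT G = pderives l H (x + h *: axis i) - (pderives l H x + h%:C * D2).
    rewrite /G integralCB// integralCD//; last exact: integrableCZ.
    by rewrite integralCZ// !IH.
  have bG : normc (integralC mu setT G) <= 2 * (BF * h ^+ 2 * J).
    have iq : mu.-integrable setT (fun w : R * V => (BF * h ^+ 2 * env w)%:E).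
      by under eq_fun do rewrite EFinM; apply: integrableZl => //; exact: integrable_env.
    apply: le_trans (normc_integralC_le iG iq _) _ => [w|].
      have h3 : normc (G w) <= BF * env w * h ^+ 2.
        apply: tF => z; have := FB w 0%N (i :: i :: l) z sll; rewrite expr0 mul1r fpow0 mul1r add0n => h4.
        by apply: (le_trans h4); rewrite /BF le_eqVlt; apply/orP; left; apply/eqP; rewrite /=; ring.
      by apply: (le_trans h3); rewrite le_eqVlt; apply/orP; left; apply/eqP; ring.
    by rewrite RintegralZl//; exact: integrable_env.
  rewrite (_ : h%:C * (D1 - D2) = integralC mu setT G -
     (pderives l H (x + h *: axis i) - (pderives l H x + h%:C * D1))); last by rewrite eG; ring.
  apply: le_trans (le_normcD _ _) _; rewrite normcN.
  rewrite [leRHS](_ : _ = 2 * (BF * h ^+ 2 * J) + BH * h ^+ 2); last by ring.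
  apply: lerD => //; apply: tH => z; have := HB 0%N (i :: i :: l) z sll.
  by rewrite expr0 mul1r fpow0 mul1r add0n.
apply/eqP; rewrite -subr_eq0; apply/eqP/normc_le_eq0 => e e0.
pose Q := BH + 2 * (BF * J) + 1.
have BJ0 : 0 <= BF * J by exact: mulr_ge0.
have Q0 : 0 < Q by rewrite ltr_wpDl// addr_ge0// mulr_ge0.
have h0 : 0 < e / Q by rewrite divr_gt0.
have := key (e / Q); rewrite normcM normc_real gtr0_norm// expr2 mulrCA ler_pM2l// => h3.
apply: (le_trans h3); rewrite mulrCA ler_piMr ?(ltW e0)// ler_pdivrMr// mul1r.
by rewrite /Q lerDl.
Qed.

End synthesis_derivatives.

Theorem corollary1 (R : realType) (n : nat) (rho1 rho2 s t : R)
  (hn : (0 < n)%N) (hrho1 : 0 < rho1) (hrho2 : 1 < rho2) (hs : 0 < s)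
  (ht : rho1 + rho2 < t) (hsigma : rho1 + rho2 - 1 < s)
  (psi phi : 'rV[R]_n -> R[i]) (c : R[i])
  (hpsi : gelfand_shilov0 rho1 rho2 psi) (hpsiw : nondegenerate_wavelet psi)
  (hphi : gelfand_shilov0 rho1 rho2 phi)
  (hrec : reconstruction_wavelet psi phi c)
  (f : ('rV[R]_n -> R[i]) -> R[i]) (hf : gs0_dual s t f) :
  let sigma := rho1 + rho2 - 1 in
  forall g : 'rV[R]_n -> R[i], gelfand_shilov0 (s - sigma) (t - sigma) g ->
  let integrand (a : R) (b : 'rV[R]_n) : R[i] :=
    wavelet_transform psi f b a *
    wavelet_transform (fun x => (phi x)^*) (pairing g) b a in
  let inner (a : R) : R[i] :=
    integralC (lebesgue_rV n) setT (integrand a) / a%:C in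
  [/\ (forall a : R, 0 < a -> integrableC (lebesgue_rV n) setT (integrand a)),
      integrableC lebesgue_measure `]0, +oo[ inner &
      f g = c^-1 * integralC lebesgue_measure `]0, +oo[ inner].
Proof.
move=> sigma g hg integrand inner.
have r10 : 0 <= rho1 by exact: ltW.
have r20 : 0 <= rho2 by apply: le_trans (ltW hrho2).
have s10 : 0 <= s - sigma by rewrite subr_ge0 ltW.
have t10 : 0 <= t - sigma by rewrite /sigma; lra.
have s0 := ltW hs.
have t0 : 0 <= t by lra.
have gpsi := (gs0P hn psi r10 r20).1 hpsi.
have gphi := (gs0P hn phi r10 r20).1 hphi.
have gg := (gs0P hn g s10 t10).1 hg.
have [_ _ c0 adm] := hrec.
pose F := field psi phi g.
have [K [C [K1 C0 FB]]] := field_bound hn hrho1 hrho2 ht hsigma gpsi gphi gg.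
have gF w : gs0 s t (F w) by exact: (gs0_field hrho1 hrho2 ht hsigma phi g gpsi).
have F0 (w : R * 'rV[R]_n) : w.1 <= 0 -> F w = fun=> 0 by exact: field_nonpositive.
have cF := bucont_field hrho1 hrho2 ht hsigma gpsi gphi gg.
have sigma0 : 0 <= sigma by rewrite /sigma; lra.
have gg' : gs0 s t g by apply: gs0_mono gg; rewrite gerBl.
have gH := gs0Z c s0 t0 gg'.
have [ifF efF] := dual_integral hn s0 t0 K1 C0 gF FB F0 cF hf gH
  (fun l x sl => synthesis_pderives hn hrho1 hrho2 ht hsigma gpsi gphi gg adm x sl).
rewrite (gs0_dualZ hn c s0 t0 hf gg') in efF.
have fF a b : 0 < a -> integrand a b = a%:C * f (F (a, b)).
  move=> a0; rewrite /integrand (wavelet_transform_coef b a0 s10 t10 gphi gg).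
  have gA : gs0 s t (wavelet_atom psi b a).
    by apply: gs0_atom => //; apply: gs0_mono gpsi; lra.
  rewrite /F /field /= a0 (gs0_dualZ hn _ s0 t0 hf gA) /wavelet_transform.
  have aa : a%:C * (a^-1)%:C = 1 :> R[i] by rewrite -rmorphM mulfV// gt_eqF.
  by rewrite -!mulrA mulrA aa mul1r mulrC.
have slice a : integrableC (lebesgue_rV n) setT (fun b => f (F (a, b))).
  have [B B0 [fB _]] := dual_family_bound hn s0 t0 K1 C0 gF FB hf.
  have mp : measurable_fun setT (fun b : 'rV[R]_n => (a, b)).
    by apply/measurable_fun_pair; [exact: measurable_cst|exact: measurable_id].
  have mF := measurable_dual_family hn s0 t0 K1 C0 gF FB F0 cF hf.
  apply: (@integrableC_le _ _ R (lebesgue_rV n) _ (fun b => B * C * decay b)).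
  - exact: (measurableC_comp mF mp).
  - by under eq_fun do rewrite EFinM; apply: integrableZl => //; exact: integrable_decay.
  - move=> b; apply: le_trans (fB (a, b)) _; rewrite -mulrA; apply: ler_wpM2l => //.
    apply: ler_wpM2l => //; rewrite /env /= ler_piMl ?decay_ge0//.
    by rewrite invf_le1 ?lerDl ?sqr_ge0// ltr_pwDl// sqr_ge0.
have pos a : 0 < a -> inner a = integralC (lebesgue_rV n) setT (fun b => f (F (a, b))).
  move=> a0; rewrite /inner (eq_integralC _ (fun b => fF a b a0)) integralCZ; last exact: slice.
  by rewrite mulrC mulKf// fmorph_eq0 gt_eqF.
have [i1 e1] := fubiniC1 ifF slice.
have E a : integralC (lebesgue_rV n) setT (fun b => f (F (a, b))) = if 0 < a then inner a else 0.
  case: ifPn => [/pos//|]; rewrite -leNgt => a0.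
  rewrite -[RHS](integralC0 (lebesgue_rV n)); apply: eq_integralC => b.
  by rewrite F0//; exact: (gs0_dual0 hn s0 t0 hf).
split.
- move=> a a0; apply: eq_integrableC (integrableCZ a%:C (slice a)) => b.
  by rewrite fF.
- by apply/integrableC_halfline; apply: eq_integrableC i1 => a; exact: E.
have {}e1 : integralC lebesgue_measure `]0, +oo[%classic inner = c * f g.
  by rewrite integralC_halfline efF e1; apply: eq_integralC => a; rewrite E.
by rewrite e1 mulrA mulVf ?mul1r.
Qed.
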